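(* Let $\Omega$ be a finite set, $n=|\Omega|$, and let $G$ be $\mathrm{Sym}(\Omega)$ or $\mathrm{Alt}(\Omega)$. Let $\Sigma$ be a non-trivial regular partition of $\Omega$, $G_1=G_{\{\Sigma\}}$, let $G_2,G_3$ be maximal subgroups of $G$ and $H=G_1\cap G_2\cap G_3$. Assume $\mathcal{O}_G(H)$ is a Boolean lattice of rank $3$ with maximal elements (other than $G$) $G_1,G_2,G_3$, and that $H$ is transitive on $\Omega$. Then one of the following holds: (1) for every $i\in\{1,2,3\}$ there is a non-trivial regular partition $\Sigma_i$ with $G_i=G_{\{\Sigma_i\}}$, and after relabeling $\{1,2,3\}$, $\Sigma_1<\Sigma_2<\Sigma_3$; (2) $G=\mathrm{Sym}(\Omega)$ and, after relabeling, $G_3=\mathrm{Alt}(\Omega)$, for every $i\in\{1,2\}$ there is a non-trivial regular partition $\Sigma_i$ with $G_i=G_{\{\Sigma_i\}}$, and $\Sigma_i<\Sigma_{3-i}$ for some $i\in\{1,2\}$; (3) $G=\mathrm{Alt}(\Omega)$, $|\Omega|=8$, $H=\mathrm{Alt}(8)\cap(\mathrm{Sym}(2)\,\mathrm{wr}\,\mathrm{Sym}(2)\,\mathrm{wr}\,\mathrm{Sym}(2))$, and the maximal elements of $\mathcal{O}_G(H)\setminus\{G\}$ are $\mathrm{Alt}(8)\cap(\mathrm{Sym}(4)\,\mathrm{wr}\,\mathrm{Sym}(2))$ and two subgroups isomorphic to $\mathrm{AGL}_3(2)$ (the atoms being $\mathrm{Alt}(8)\cap(\mathrm{Sym}(2)\,\mathrm{wr}\,\mathrm{Sym}(4))$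 and two subgroups isomorphic to $2^3\rtimes\mathrm{Sym}(4)$).
   Context: $\mathcal{O}_G(H)=\{K\mid H\le K\le G\}$; Boolean of rank $r$ means isomorphic to the lattice of subsets of an $r$-set. For a partition $\Sigma$ of $\Omega$, $G_{\{\Sigma\}}=\{g\in G\mid X^g\in\Sigma\ \forall X\in\Sigma\}$. A partition is regular if all parts have equal size, non-trivial if it is neither $\{\Omega\}$ nor the partition into singletons. $\Sigma_1\le\Sigma_2$ means $\Sigma_2$ refines $\Sigma_1$. *)

(* Defs.v *)
From mathcomp Require Import all_boot all_order all_algebra all_fingroup all_solvable.
Set Implicit Arguments. Unset Strict Implicit. Unset Printing Implicit Defensive.
Import GRing.Theory.
Local Open Scope group_scope.

Section Parts.
Variable T : finType.

Definition regular_part (S : {set {set T}}) : bool :=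
  partition S [set: T] && [forall X in S, forall Y in S, #|X| == #|Y|].

Definition nontrivial_part (S : {set {set T}}) : bool :=
  (S != [set [set: T]]) && (S != [set [set x] | x : T]).

Definition ntreg_part (S : {set {set T}}) : bool :=
  regular_part S && nontrivial_part S.

Definition part_le (S1 S2 : {set {set T}}) : bool :=
  [forall Y in S2, exists X in S1, Y \subset X].
Definition part_lt (S1 S2 : {set {set T}}) : bool :=
  part_le S1 S2 && (S1 != S2).

Definition part_stab (G : {set {perm T}}) (S : {set {set T}}) : {set {perm T}} :=
  [set g in G | [forall X in S, [set g x | x in X] \in S]].
End Parts.

Section Overgroups.
Variable gT : finGroupType.

Definition overgroups (G H : {set gT}) : {set {set gT}} :=
  [set K : {set gT} | [&& group_set K, H \subset K & K \subset G]].

Definition boolean3 (L : {set {set gT}}) : Prop :=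
  exists f : {set 'I_3} -> {set gT},
    (forall K, K \in L <-> exists A, K = f A) /\
    (forall A B, (f A \subset f B) = (A \subset B)).

Definition coatoms (G H : {set gT}) : {set {set gT}} :=
  [set K in overgroups G H :\ G |
     [forall K' in overgroups G H :\ G, (K \subset K') ==> (K' == K)]].

Definition atoms (G H : {set gT}) : {set {set gT}} :=
  [set K in overgroups G H :\ H |
     [forall K' in overgroups G H :\ H, (K' \subset K) ==> (K' == K)]].
End Overgroups.

Definition i0 : 'I_3 := Ordinal (isT : 0 < 3)%N.
Definition i1 : 'I_3 := Ordinal (isT : 1 < 3)%N.
Definition i2 : 'I_3 := Ordinal (isT : 2 < 3)%N.

Definition AGL3_2 : {set {perm 'rV['F_2]_3}} :=
  [set p : {perm 'rV['F_2]_3} | [exists A : 'M['F_2]_3, exists b : 'rV['F_2]_3,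
     (A \in unitmx) && [forall v, p v == (v *m A + b)%R]]].

Definition is_2cube_sdprod_S4 (gT : finGroupType) (L : {set gT}) : Prop :=
  exists (N K : {group gT}),
    [/\ 2.-abelem N, #|N| = 8%N, K \isog 'Sym_('I_4) & N ><| K = L].

(* Main.v *)
(** Transitive subgroups are studied through the equivalence relations they preserve. Let A be the
    stabilizer of the given partition (classes of size a), B and C the other two maximal subgroups, and
    K = A /\ B, which is maximal in A. If B is primitive without 3-cycles, or preserves a partition with trivial
    meet, then K contains no 3-cycle. When a > 2, comparing K with the product of K and the group of all
    kernel elements that agree on every class with some element of K shows that either the elements of K
    supported on one class act transitively on it, or G is alternating, there are two classes and K meets the
    kernel in the graph of an isomorphism Sym(a) -> Sym(a). In the first case a class is a Jordan set of B, and
    a Steiner-system argument produces a 3-cycle in B unless a = 4 and n = 8. The graph case is ruled out by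
    the elements of the interval above H. When a = 2 the same comparison is made with the even part of
    the kernel, an elementary abelian 2-group. Hence outside degree 8 any two of the three groups are either
    comparable partition stabilizers or one of them is Alt. In degree 8 the group H determines a pairing
    refining the given 4|4 partition, and B and C are the two affine groups attached to it. *)
Require Import Defs.
From mathcomp Require Import all_boot all_order all_algebra all_fingroup all_solvable.
From mathcomp Require Import zify.
Set Implicit Arguments. Unset Strict Implicit. Unset Printing Implicit Defensive.
Local Open Scope group_scope.

(** * Three-cycles in primitive groups *)

(** A 3-cycle is the certificate sought throughout: by Jordan's theorem a primitive group containing
    one contains the alternating group, so a primitive maximal subgroup other than ['Alt_T] has
    none. Nearly every step adjoins to a group K a subgroup that K normalizes, so that the join is a
    product; maximality then puts the adjoined elements in K or factors every element of the larger
    group. The same device at the bottom of the lattice, with H in place of K, leaves three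
    outcomes: the join lies in B, lies in C, or is all of A. The Steiner-system argument makes B
    homogeneous on sets of the size of a class; two conjugates of the class then meet in one point,
    and a commutator is a 3-cycle. What survives is a class of four points, where the Klein
    four-group is regular and normal in Sym(4). Degree 8 is exceptional because the even
    permutations preserving a pairing of eight points are affine over the field with two elements: a
    pairing stabilizer in Alt(8) is not maximal and lies in two copies of AGL_3(2). The finite facts
    about these maps are settled by evaluation on triples of booleans. *)

Ltac rwneq := repeat match goal with
  | H : is_true (?a != ?b) |- context [?a == ?b] => rewrite (negPf H)
  | H : is_true (?a != ?b) |- context [?b == ?a] => rewrite (eq_sym b a) (negPf H)
  | |- context [?a == ?a] => rewrite (eqxx a)
  end.
Ltac neq := solve [rwneq; done].

Section Perm3.
Variable T : finType.
Implicit Types (x y z t : T) (g h : {perm T}) (X Y : {set T}).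

Definition cyc3 x y z : {perm T} := tperm x y * tperm x z.

Lemma cyc3E x y z t : x != y -> x != z -> y != z ->
  cyc3 x y z t = if t == x then y else if t == y then z
                 else if t == z then x else t.
Proof.
move=> xy xz yz; rewrite /cyc3 permM; case: (altP (t =P x)) => [->|tx].
  by rewrite tpermL tpermD //; neq.
case: (altP (t =P y)) => [->|ty]; first by rewrite tpermR tpermL.
rewrite (@tpermD _ x y t); try neq.
by case: (altP (t =P z)) => [->|tz]; rewrite ?tpermR // tpermD //; neq.
Qed.

Lemma cyc3J x y z g : cyc3 x y z ^ g = cyc3 (g x) (g y) (g z).
Proof. by rewrite conjMg !tpermJ. Qed.

Lemma odd_cyc3 x y z : x != y -> x != z -> odd_perm (cyc3 x y z) = false.
Proof. by move=> xy xz; rewrite odd_permM !odd_tperm xy xz. Qed.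

Lemma cyc3_on X x y z : x \in X -> y \in X -> z \in X -> perm_on X (cyc3 x y z).
Proof.
move=> xX yX zX; apply: perm_onM; apply/subsetP=> t; rewrite !inE;
by case: tpermP => [->|->|]; rewrite ?eqxx.
Qed.

Lemma cyc3_rot x y z : x != y -> x != z -> y != z -> cyc3 y z x = cyc3 x y z.
Proof.
move=> xy xz yz; apply/permP=> t; rewrite !cyc3E; try neq.
case: (altP (t =P x)) => [->|//]; first neq.
Qed.

Lemma cyc3V x y z : x != y -> x != z -> y != z -> (cyc3 x y z)^-1 = cyc3 x z y.
Proof. by move=> xy xz yz; rewrite /cyc3 invMg !tpermV. Qed.

Lemma cyc3_neq1 x y z : x != y -> x != z -> y != z -> cyc3 x y z != 1.
Proof.
move=> xy xz yz; apply/eqP=> /permP/(_ x)/eqP; rewrite cyc3E // eqxx perm1; neq.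
Qed.

Lemma cyc3_sq x y z : x != y -> x != z -> y != z -> cyc3 x z y * cyc3 x z y = cyc3 x y z.
Proof.
move=> xy xz yz; apply/permP=> t; rewrite permM.
have [->|tx] := eqVneq t x; first by rewrite !cyc3E; try neq; rwneq.
have [->|ty] := eqVneq t y; first by rewrite !cyc3E; try neq; rwneq.
have [->|tz] := eqVneq t z; first by rewrite !cyc3E; try neq; rwneq.
by rewrite !cyc3E; try neq; rwneq.
Qed.

Lemma cyc3_cube x y z : x != y -> x != z -> y != z ->
  cyc3 x y z * cyc3 x y z * cyc3 x y z = 1.
Proof. by move=> xy xz yz; rewrite (@cyc3_sq x z y) ?(eq_sym z) // -(@cyc3V x y z) // mulVg. Qed.

Lemma even_gen_cyc3 (A : {group {perm T}}) X :
  (forall x y z, x \in X -> y \in X -> z \in X -> x != y -> x != z -> y != z ->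
     cyc3 x y z \in A) ->
  forall g, perm_on X g -> ~~ odd_perm g -> g \in A.
Proof.
move=> hA g; have [k] := ubnP #|[set x | g x != x]|.
elim: k g => // k IH g lek gX ge.
have [->|/eqP g1] := altP (g =P 1); first exact: group1.
have [x gx] : exists x, g x != x.
  apply/existsP; apply: contra_notT g1; rewrite negb_exists => /forallP h.
  by apply/permP=> x; rewrite perm1; apply/eqP; move: (h x); rewrite negbK.
have gy : g (g x) != g x by rewrite (inj_eq perm_inj).
have inX t : g t != t -> t \in X by move=> ht; apply: (subsetP gX).
have [/existsP[z /and3P[zx zy gz]]|] := boolP [exists z, [&& z != x, z != g x & g z != z]].
  have yx : g x != x by [].
  (* This cycle sends [g x] back to [x], so the product fixes [x]; its three points are already
     moved by [g], so the support strictly shrinks. *)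
  have c3 : cyc3 (g x) x z \in A by apply: hA; rewrite ?inX // eq_sym.
  rewrite -(groupMr _ c3); apply: IH; last 2 first.
  - by apply: perm_onM => //; apply: cyc3_on; rewrite inX.
  - by rewrite odd_permM odd_cyc3 ?addbF // eq_sym.
  apply: leq_trans (_ : #|[set t | g t != t]| <= k) => //.
  apply: proper_card; apply/properP; split.
    apply/subsetP=> t; rewrite !inE; apply: contraNneq => gt.
    rewrite permM gt cyc3E; try neq.
    case: (altP (t =P g x)) => [tE|_]; first by rewrite -tE gt eqxx in gy.
    case: (altP (t =P x)) => [tE|_]; first by rewrite -tE gt eqxx in yx.
    by case: (altP (t =P z)) => [tE|//]; rewrite -tE gt eqxx in gz.
  exists x; first by rewrite inE.
  by rewrite inE permM cyc3E ?eqxx // eq_sym.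
rewrite negb_exists => /forallP h.
have gE : g = tperm x (g x).
  apply/permP=> t; case: tpermP => [->//|->|/eqP tx /eqP ty].
    apply/eqP; rewrite -(negbK (_ == x)); apply/negP=> ggx.
    by have := h (g (g x)); rewrite !(inj_eq perm_inj) gx ggx.
  by move: (h t); rewrite tx ty /= negbK => /eqP.
by rewrite gE odd_tperm eq_sym gx in ge.
Qed.

Definition einv (K : {set {perm T}}) (e : rel T) :=
  forall g, g \in K -> forall x y, e (g x) (g y) = e x y.
(** Primitivity through invariant relations instead of blocks; transitivity is not included and is
    carried separately by [ptrans]. *)
Definition prim (K : {set {perm T}}) :=
  forall e : rel T, equivalence_rel e -> einv K e ->
    (forall x y, e x y -> x = y) \/ (forall x y, e x y).
Definition has_cyc3 (K : {set {perm T}}) :=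
  exists x y z, [/\ x != y, x != z, y != z & cyc3 x y z \in K].

Lemma eqrelP (e : rel T) : reflexive e -> symmetric e -> transitive e -> equivalence_rel e.
Proof.
move=> r s t x y z; split=> // xy; apply/idP/idP; last exact: t.
by apply: t; rewrite s.
Qed.

(** Jordan's theorem. Lying on a common 3-cycle of [K] is an invariant equivalence relation, hence
    universal, and every 3-cycle is then obtained by conjugation. *)
Lemma prim_cyc3 (K : {group {perm T}}) : prim K -> has_cyc3 K -> 'Alt_T \subset K.
Proof.
move=> pK [x0 [y0 [z0 [xy xz yz c0]]]].
pose e x y := (x == y) || [exists z, [&& x != y, x != z, y != z & cyc3 x y z \in K]].
have eP x y : reflect (x = y \/ exists z, [/\ x != y, x != z, y != z & cyc3 x y z \in K]) (e x y).
  apply: (iffP orP) => [[/eqP->|/existsP[z /and4P[? ? ? ?]]]|[->|[z [? ? ? ?]]]].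
  - by left.
  - by right; exists z.
  - by left.
  - by right; apply/existsP; exists z; apply/and4P.
have ev_s : symmetric e.
  move=> x y; wlog suff: x y / e x y -> e y x by move=> h; apply/idP/idP; apply: h.
  case/eP=> [->|[z [h1 h2 h3 h4]]]; apply/eP; [by left|right; exists z].
  rewrite eq_sym; split=> //.
  by rewrite -groupV cyc3V ?(@cyc3_rot x y z); try neq.
have ev_t : transitive e.
  move=> y x w /eP[->//|[z [h1 h2 h3 h4]]] /eP[<-|[v [k1 k2 k3 k4]]].
    by apply/eP; right; exists z.
  have [->|xw] := eqVneq x w; first by apply/eP; left.
  have [<-|zw] := eqVneq z w.
    rewrite ev_s; apply/eP; right; exists y; split; try neq.
    by rewrite (@cyc3_rot y z x) ?(@cyc3_rot x y z); try neq.
  have [xv|xv] := eqVneq x v.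
    rewrite ev_s; apply/eP; right; exists y; rewrite -xv in k2 k3 k4; split; try neq.
    by rewrite (@cyc3_rot y w x); try neq.
  (* Conjugating [cyc3 x y z] by [cyc3 y w v], which fixes [x] and sends [y] to [w], gives a 3-cycle
     through [x] and [w]. *)
  apply/eP; right; exists (cyc3 y w v z).
  have cx : cyc3 y w v x = x by rewrite cyc3E; neq.
  have cy : cyc3 y w v y = w by rewrite cyc3E; neq.
  split=> //; first by rewrite -{1}cx (inj_eq perm_inj).
    by rewrite -{1}cy (inj_eq perm_inj).
  by have := groupJ h4 k4; rewrite cyc3J cx cy.
case: (pK e).
- by apply: eqrelP => // x; apply/eP; left.
- move=> g gK x y; wlog suff: g gK x y / e x y -> e (g x) (g y).
    by move=> h; apply/idP/idP => [/(h g^-1)|]; [rewrite !permK groupV; apply|apply: h].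
  case/eP=> [->|[z [h1 h2 h3 h4]]]; apply/eP; [by left|right; exists (g z)].
  by rewrite !(inj_eq perm_inj) -cyc3J groupJ.
- by move=> h; case/eqP: (xy); apply: h; apply/eP; right; exists z0.
move=> eT; apply/subsetP=> g; rewrite Alt_even => ge; have gT : perm_on setT g by apply/subsetP.
apply: (@even_gen_cyc3 K setT _ g gT ge) => x y z _ _ _ xy' xz' yz'.
case/eP: (eT x y) => [/eqP|[u [_ xu yu c1]]]; first by rewrite (negPf xy').
(* A second 3-cycle, through [u] and [z], is used to move [u] to [z] in the first one. If its third
   point is [x] or [y], its inverse does this up to inversion and rotation of the result. *)
have [<-//|uz] := eqVneq u z.
case/eP: (eT u z) => [/eqP|[w [_ uw zw c2]]]; first by rewrite (negPf uz).
have [wx|wx] := eqVneq w x.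
  rewrite wx in c2 uw zw.
  have := groupJ c1 (groupVr c2); rewrite cyc3J cyc3V; try neq; rewrite !cyc3E; try neq.
  rwneq => h; rewrite -groupV cyc3V //.
  by move: h; rewrite (@cyc3_rot x z y); neq.
have [wy|wy] := eqVneq w y.
  rewrite wy in c2 uw zw.
  have := groupJ c1 (groupVr c2); rewrite cyc3J cyc3V; try neq; rewrite !cyc3E; try neq.
  by rwneq => h; rewrite -groupV cyc3V.
have := groupJ c1 c2; rewrite cyc3J !cyc3E; by rwneq.
Qed.

End Perm3.

(** * Jordan sets in primitive groups *)

Section Images.
Variable T : finType.
Implicit Types (x y z t : T) (g h u : {perm T}) (X Y Z A : {set T}).

Lemma imP g X y : (y \in g @: X) = (g^-1 y \in X).
Proof.
apply/imsetP/idP => [[x xX ->]|yX]; first by rewrite permK.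
by exists (g^-1 y) => //; rewrite permKV.
Qed.
Lemma im_mem g X x : (g x \in g @: X) = (x \in X).
Proof. by rewrite imP permK. Qed.
Lemma imM g h X : (g * h) @: X = h @: (g @: X).
Proof. by apply/setP=> x; rewrite !imP invMg permM. Qed.
Lemma im1 X : (1 : {perm T}) @: X = X.
Proof. by apply/setP=> x; rewrite imP invg1 perm1. Qed.
Lemma imKV g X : g @: (g^-1 @: X) = X.
Proof. by rewrite -imM mulVg im1. Qed.
Lemma imC g X : g @: (~: X) = ~: (g @: X).
Proof. by apply/setP=> x; rewrite !(imP, inE). Qed.
Lemma imU g X Y : g @: (X :|: Y) = g @: X :|: g @: Y.
Proof. by apply/setP=> x; rewrite !(imP, inE). Qed.
Lemma imI g X Y : g @: (X :&: Y) = g @: X :&: g @: Y.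
Proof. by apply/setP=> x; rewrite !(imP, inE). Qed.
Lemma im_card g X : #|g @: X| = #|X|.
Proof. by rewrite card_imset //; exact: perm_inj. Qed.
Lemma im_fix g X : (forall x, x \in X -> g x = x) -> g @: X = X.
Proof.
move=> h; apply/setP=> x; rewrite imP; apply/idP/idP => xX.
  by rewrite -(permKV g x) (h _ xX).
by rewrite -{1}(h x xX) permK.
Qed.
Lemma perm_onV X g : perm_on X g -> perm_on X g^-1.
Proof.
move=> h; apply/subsetP=> x; rewrite inE => xg; apply: (subsetP h); rewrite inE.
by apply: contra xg => /eqP e; rewrite -{1}e permK.
Qed.
Lemma perm_onJ X g h : perm_on X g -> perm_on (h @: X) (g ^ h).
Proof.
move=> gX; apply/subsetP=> x; rewrite inE imP => xg; apply: (subsetP gX); rewrite inE.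
apply: contra xg => /eqP e; rewrite -{1}(permKV h x) permJ e permKV //.
Qed.
Lemma perm_on_sub X Y g : X \subset Y -> perm_on X g -> perm_on Y g.
Proof. by move=> XY gX; apply: subset_trans gX XY. Qed.

(** The supports meet in [x] alone, so [u] fixes [v x] and [v] fixes [u x]; everywhere else at least
    one of the two acts trivially and the commutator cancels. *)
Lemma comm_cyc3 (u v : {perm T}) x : u x != x -> v x != x ->
  (forall y, y != x -> u y = y \/ v y = y) ->
  exists y z, [/\ x != y, x != z, y != z & [~ u, v] = cyc3 x y z].
Proof.
move=> ux vx h; exists (v x), (u x).
have uu : v (u x) = u x by case: (h _ ux) => // /perm_inj/eqP; rewrite (negPf ux).
have vv : u (v x) = v x by case: (h _ vx) => // /perm_inj/eqP; rewrite (negPf vx).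
have uv : v x != u x.
  apply: contra ux => /eqP e; apply/eqP/(@perm_inj _ v); by rewrite uu e.
split; try by rewrite // eq_sym.
have cE t : [~ u, v] t = v (u (v^-1 (u^-1 t))) by rewrite /commg /conjg !permM.
apply/permP=> t; rewrite cE cyc3E; try by rewrite // eq_sym.
have fixV (w : {perm T}) s : w s = s -> w^-1 s = s by move=> e; rewrite -{1}e permK.
have [->|tx] := altP (t =P x).
  have p : v (u^-1 x) = u^-1 x.
    case: (h (u^-1 x)) => //; first by apply: contra ux => /eqP {1}<-; rewrite permKV.
    by rewrite permKV => e; rewrite {1}e permKV eqxx in ux.
  by rewrite (fixV _ _ p) permKV.
have [->|tv] := altP (t =P v x); first by rewrite (fixV _ _ vv) permK uu.
have [->|tu] := altP (t =P u x).
  have p : u (v^-1 x) = v^-1 x.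
    case: (h (v^-1 x)) => //; first by apply: contra vx => /eqP {1}<-; rewrite permKV.
    by rewrite permKV => e; rewrite {1}e permKV eqxx in vx.
  by rewrite permK p permKV.
have sx : u^-1 t != x by apply: contra tu => /eqP <-; rewrite permKV.
have rx : v^-1 t != x by apply: contra tv => /eqP <-; rewrite permKV.
have [us|vs] := h _ sx.
  rewrite permKV in us; rewrite -us.
  have [ur|vr] := h _ rx; [by rewrite ur permKV|move: vr; rewrite permKV => vr].
  by rewrite -vr {1}us permKV {1}vr permKV.
rewrite (fixV _ _ vs) permKV; case: (h _ tx) => // ut.
by rewrite (fixV _ _ ut) in vs.
Qed.

Lemma ex_subset_card A k : k <= #|A| -> exists2 B : {set T}, B \subset A & #|B| = k.
Proof.
move=> kA; exists [set x in take k (enum A)].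
  by apply/subsetP=> x; rewrite inE => /mem_take; rewrite mem_enum.
by rewrite cardsE (card_uniqP _) ?take_uniq ?enum_uniq // size_takel // -cardE.
Qed.

End Images.

Section Jordan.
Variables (T : finType) (G : {group {perm T}}).
Implicit Types (x y z t : T) (g h u : {perm T}) (X Y Z A B : {set T}).

Definition ptrans (K : {set {perm T}}) X :=
  forall x y, x \in X -> y \in X -> exists2 g, g \in K & g x = y.
(** A Jordan set of [G]: the pointwise stabilizer of its complement is transitive on it. *)
Definition jordan Y := forall x y, x \in Y -> y \in Y ->
  exists2 g, g \in G & perm_on Y g /\ g x = y.
Definition homog k := forall A B, #|A| = k -> #|B| = k ->
  exists2 g, g \in G & g @: A = B.

Lemma jordanJ Y g : g \in G -> jordan Y -> jordan (g @: Y).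
Proof.
move=> gG jY x y; rewrite !imP => xY yY; have [h hG [hY hx]] := jY _ _ xY yY.
exists (h ^ g); rewrite ?groupJ //; split; first exact: perm_onJ.
by rewrite -{1}(permKV g x) permJ hx permKV.
Qed.

(** Both points are routed through a common point of the two sets. *)
Lemma jordanU X Y : jordan X -> jordan Y -> X :&: Y != set0 -> jordan (X :|: Y).
Proof.
move=> jX jY /set0Pn[z]; rewrite inE => /andP[zX zY].
have toz x : x \in X :|: Y -> exists2 g, g \in G & perm_on (X :|: Y) g /\ g x = z.
  rewrite inE => /orP[xX|xY].
    have [g gG [gX gx]] := jX _ _ xX zX; exists g => //; split=> //.
    by apply: perm_on_sub gX; apply: subsetUl.
  have [g gG [gX gx]] := jY _ _ xY zY; exists g => //; split=> //.
  by apply: perm_on_sub gX; apply: subsetUr.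
move=> x y /toz[g gG [gX gx]] /toz[h hG [hX hy]]; exists (g * h^-1).
  by rewrite groupM ?groupV.
by split; [apply: perm_onM => //; apply: perm_onV|rewrite permM gx -hy permK].
Qed.

(** All points but one are moved into place by homogeneity; the last one is moved by an element
    supported off the points already placed. *)
Lemma homogS k : homog k -> (forall Y, #|Y| = #|T| - k -> jordan Y) -> k < #|T| -> homog k.+1.
Proof.
move=> hk jk kT A B cA cB.
have [a aA] : exists a, a \in A by apply/set0Pn; rewrite -card_gt0 cA.
have [b bB] : exists b, b \in B by apply/set0Pn; rewrite -card_gt0 cB.
have cA' : #|A :\ a| = k by move: cA; rewrite (cardsD1 a) aA => -[].
have cB' : #|B :\ b| = k by move: cB; rewrite (cardsD1 b) bB => -[].
have [g gG gA] := hk _ _ cA' cB'.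
have jB : jordan (~: (B :\ b)) by apply: jk; rewrite cardsCs setCK cB'.
have ga : g a \in ~: (B :\ b) by rewrite inE -gA im_mem !inE eqxx.
have [h hG [hY hab]] := jB _ b ga (ltac:(by rewrite !inE eqxx)).
exists (g * h); first exact: groupM.
rewrite imM -(setD1K aA) imU gA imset_set1 imU imset_set1 hab.
rewrite (im_fix (X := B :\ b)) ?setD1K // => x xB.
by apply: (out_perm hY); rewrite inE negbK.
Qed.

(** Otherwise the translates of [Y] are equal or disjoint, and lying in a common translate is an
    invariant relation; the bounds on [#|Y|] make it neither equality nor universal. *)
Lemma prim_block Y : prim G -> ptrans G setT -> (1 < #|Y| < #|T|)%N ->
  exists2 g, g \in G & Y :&: g @: Y != set0 /\ g @: Y != Y.
Proof.
move=> pG tG /andP[Y1 YT].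
have [/existsP[g /and3P[? ? ?]]|] := boolP [exists g, [&& g \in G, Y :&: g @: Y != set0 & g @: Y != Y]].
  by exists g.
rewrite negb_exists => /forallP h.
have blk g1 g2 x : g1 \in G -> g2 \in G -> x \in g1 @: Y -> x \in g2 @: Y -> g1 @: Y = g2 @: Y.
  move=> g1G g2G x1 x2; have := h (g2 * g1^-1); rewrite groupM ?groupV //=.
  rewrite negb_and !negbK => /orP[/eqP/setP/(_ (g1^-1 x))|/eqP e].
    by rewrite inE -(imP g1 Y) x1 imM im_mem x2 inE.
  by rewrite -{1}e imM imKV.
pose e x y := [exists g, [&& g \in G, x \in g @: Y & y \in g @: Y]].
have eP x y : reflect (exists2 g, g \in G & x \in g @: Y /\ y \in g @: Y) (e x y).
  by apply: (iffP existsP) => [[g /and3P[]]|[g ? []]] *; exists g => //; apply/and3P.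
have [y0 y0Y] : exists y, y \in Y by apply/set0Pn; rewrite -card_gt0 (ltn_trans _ Y1).
case: (pG e).
- apply: eqrelP.
  + by move=> x; apply/eP; have [g gG gx] := tG y0 x (in_setT _) (in_setT _); exists g; rewrite // -gx im_mem.
  + by move=> x y; apply/eP/eP => -[g ? []]; exists g.
  + move=> y x z /eP[g gG [gx gy]] /eP[k kG [ky kz]]; apply/eP; exists g => //; split=> //.
    by rewrite (blk g k y).
- move=> g gG x y; apply/eP/eP => -[k kG []]; rewrite ?imP => kx ky.
    by exists (k * g^-1); rewrite ?groupM ?groupV // !imP invMg invgK !permM.
  by exists (k * g); rewrite ?groupM // !imP invMg !permM !permK.
- move=> he; move: Y1; rewrite (cardsD1 y0) y0Y ltnS card_gt0 => /set0Pn[y].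
  rewrite !inE => /andP[/eqP ny yY]; case: ny; apply: he; apply/eP; exists 1; rewrite ?group1 // im1 //.
- move=> he; move: YT; rewrite -cardsT ltnNge subset_leq_card //; apply/subsetP=> x _.
  have /eP[g gG [g0 gx]] := he y0 x.
  by rewrite -(im1 Y) (blk 1 g y0) ?group1 ?im1.
Qed.

Variable X : {set T}.
Hypotheses (pG : prim G) (tG : ptrans G setT) (jX : jordan X) (X2 : 1 < #|X|)
  (X2T : #|X|.*2 <= #|T|).
(** Since [s] fixes [X] pointwise and displaces [A] by a single point, a block containing [A] and
    two points of [X] shares k+1 points with its image under [s]. The lemma [shift_set] supplies
    such pairs. *)
Hypothesis shift : forall k, 0 < k -> k.+2 <= #|X| ->
  exists A, exists2 s, s \in G & [/\ (forall x, x \in X -> s x = x), A \subset ~: X,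
     #|A| = k & #|A :&: s @: A| = k.-1].

(* A largest Jordan set Y with at most n-k-1 points has a complement Z two of whose conjugates never
   share k+1 points unless they are equal. So the conjugates of Z are the blocks of a Steiner system, which
   the sets A of [shift] contradict unless Y has n-k-1 points. *)
Lemma jordan_step k : k.+2 <= #|X| -> homog k.+1 -> exists2 Y : {set T}, #|Y| = #|T| - k.+1 & jordan Y.
Proof.
move=> kX hk.
pose P m := [exists Y : {set T}, (#|Y| == m) && (m <= #|T| - k.+1) && [forall x in Y, forall y in Y, [exists g in G, perm_on Y g && (g x == y)]]].
have PP m : reflect (exists Y : {set T}, [/\ #|Y| = m, m <= #|T| - k.+1 & jordan Y]) (P m).
  apply: (iffP existsP) => [[Y /andP[/andP[/eqP cY lem] h]]|[Y [cY lem jY]]]; exists Y.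
    split=> // x y xY yY; move/forall_inP/(_ x xY)/forall_inP/(_ y yY): h.
    by case/exists_inP=> g gG /andP[gY /eqP gx]; exists g.
  rewrite cY eqxx lem /=; apply/forall_inP=> x xY; apply/forall_inP=> y yY.
  by have [g gG [gY gx]] := jY _ _ xY yY; apply/exists_inP; exists g; rewrite // gY gx eqxx.
have exP : exists m, P m.
  exists #|X|; apply/PP; exists X; split=> //; lia.
have ubP m : P m -> m <= #|T| by case/PP=> Y [<- _ _]; apply: max_card.
case: (ex_maxnP exP ubP) => m /PP[Y [cY mT jY]] maxm.
have mX : #|X| <= m by apply: maxm; apply/PP; exists X; split=> //; lia.
have [mE|mN] := eqVneq m (#|T| - k.+1); first by exists Y; rewrite ?cY.
have lm : m < #|T| - k.+1 by rewrite ltn_neqAle mN.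
set Z := ~: Y.
have cZ : #|Z| = #|T| - m by rewrite cardsCs setCK cY.
have cZI g : #|Z :&: g @: Z| + #|Y :|: g @: Y| = #|T|.
  by rewrite imC -setCU addnC cardsC.
have cYU g : #|Y :|: g @: Y| + #|Y :&: g @: Y| = m + m by rewrite cardsUI im_card cY.
(* The union is a Jordan set, and the overlap of the complements bounds its size, so maximality of
   [m] applies to it. *)
have star g : g \in G -> Y :&: g @: Y != set0 -> k.+1 <= #|Z :&: g @: Z| -> g @: Y = Y.
  move=> gG YY ZZ; have jU := jordanU jY (jordanJ gG jY) YY.
  have := maxm #|Y :|: g @: Y|; have := cZI g => hc h.
  have le : #|Y :|: g @: Y| <= m by apply: h; apply/PP; exists (Y :|: g @: Y); split=> //; lia.
  have /eqP e1 : Y == Y :|: g @: Y by rewrite eqEcard subsetUl cY.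
  by apply/eqP; rewrite eqEcard im_card leqnn andbT e1 -{1}e1 subsetUr.
(* Were [Y] smaller than half of the points, homogeneity would give an image of [Y] that keeps k
   points of a (k+1)-subset of [Y] and acquires a point outside; a count of the complements
   contradicts [star]. For k = 0 primitivity gives such an image. *)
have m2 : #|T| <= m.*2.
  rewrite leqNgt; apply/negP => lt.
  have [k0|k0] := posnP k.
    have [g gG [YY gY]] := @prim_block Y pG tG (ltac:(lia)).
    case/eqP: gY; apply: star => //; move: YY; rewrite -card_gt0; have := cZI g; have := cYU g.
    lia.
  have [y0 y0Z] : exists y, y \in Z by apply/set0Pn; rewrite -card_gt0; lia.
  have [A AY cA] : exists2 A : {set T}, A \subset Y & #|A| = k.+1 by apply: ex_subset_card; lia.
  have [a aA] : exists a, a \in A by apply/set0Pn; rewrite -card_gt0 cA.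
  have cA' : #|A :\ a| = k by move: cA; rewrite (cardsD1 a) aA => -[].
  have y0A : y0 \notin A :\ a.
    by apply: contraL y0Z; rewrite inE => /andP[_ /(subsetP AY)]; rewrite inE negbK.
  have cB : #|y0 |: (A :\ a)| = k.+1 by rewrite cardsU1 y0A cA'.
  have [g gG gA] := hk _ _ cA cB.
  have gsub : A :\ a \subset Y :&: g @: Y.
    rewrite subsetI (subset_trans _ AY) ?subsetDl //=.
    by apply: subset_trans (imsetS g AY); rewrite gA subsetUr.
  have y0g : y0 \in g @: Y by apply: (subsetP (imsetS g AY)); rewrite gA setU11.
  have := subset_leq_card gsub; rewrite cA' => kle.
  have : g @: Y = Y.
    apply: star => //; first by rewrite -card_gt0; lia.
    have := cZI g; have := cYU g; lia.
  by move=> e; rewrite e in y0g; rewrite inE y0g in y0Z.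
(* If [Y] and its image were disjoint they would cover everything by [m2], leaving no common point
   to the complements. *)
have star2 g : g \in G -> k.+1 <= #|Z :&: g @: Z| -> g @: Z = Z.
  move=> gG ZZ; have [Y0|YY] := eqVneq (Y :&: g @: Y) set0; last by rewrite imC star.
  by have := cZI g; have := cYU g; rewrite Y0 cards0; lia.
have star3 g h : g \in G -> h \in G -> k.+1 <= #|g @: Z :&: h @: Z| -> g @: Z = h @: Z.
  move=> gG hG le; have /star2 : h * g^-1 \in G by rewrite groupM ?groupV.
  rewrite imM => e; rewrite -{1}e ?imKV //.
  by rewrite -(im_card g) imI imKV.
have [k0|k0] := posnP k.
  have [g gG [YY gY]] := @prim_block Z pG tG (ltac:(lia)).
  case/eqP: gY; apply: star2 => //; rewrite k0 card_gt0 //.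
have [A [s sG [sX AX cA cAs]]] := shift k0 kX.
have cover B : #|B| = k.+1 -> exists2 g, g \in G & B \subset g @: Z.
  move=> cB; have [A' A'Z cA'] : exists2 A' : {set T}, A' \subset Z & #|A'| = k.+1 by apply: ex_subset_card; lia.
  by have [g gG <-] := hk _ _ cA' cB; exists g => //; apply: imsetS.
(* Elements supported on [X] fix k+1 points of the block, hence the block itself, and are transitive
   on [X]. *)
have star4 g : g \in G -> k.+1 <= #|g @: Z :&: ~: X| -> g @: Z :&: X != set0 -> X \subset g @: Z.
  move=> gG le /set0Pn[x]; rewrite inE => /andP[xg xX]; apply/subsetP=> y yX.
  have [u uG [uX ux]] := jX xX yX.
  suff <- : (g * u) @: Z = g @: Z by rewrite imM -ux im_mem.
  apply: star3; rewrite ?groupM //; apply: leq_trans le _; apply: subset_leq_card.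
  rewrite subsetI subsetIl imM andbT; apply/subsetP=> z /setIP[zg]; rewrite inE => zX.
  by rewrite -(out_perm uX zX) im_mem.
(* A block has at least k+2 points: either k+1 of them are outside [X] and it contains [X], or two
   are left for [X]. *)
have star5 g x : g \in G -> k <= #|g @: Z :&: ~: X| -> x \in g @: Z -> x \in X -> 2 <= #|g @: Z :&: X|.
  move=> gG le xg xX; have := cardsID X (g @: Z); rewrite im_card cZ setDE.
  have [le2|] := leqP k.+1 #|g @: Z :&: ~: X|; last by lia.
  have XZ : X \subset g @: Z by apply: star4 => //; apply/set0Pn; exists x; rewrite inE xg.
  by move=> _; rewrite (setIidPr XZ).
have [x xX] : exists x, x \in X by apply/set0Pn; rewrite -card_gt0; lia.
have xA : x \notin A by apply: contraL xX => /(subsetP AX); rewrite inE.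
have [g gG sub] := cover (x |: A) (ltac:(by rewrite cardsU1 xA cA)).
have [xg Ag] : x \in g @: Z /\ A \subset g @: Z.
  by move: sub; rewrite subUset sub1set => /andP.
have AgX : A \subset g @: Z :&: ~: X by rewrite subsetI Ag.
have le2 : 2 <= #|g @: Z :&: X|.
  by apply: (star5 g x) => //; rewrite -cA subset_leq_card.
(* The k-1 points of [A :&: s @: A] and two points of [X], fixed by [s], are common to the block and
   its image. The block thus contains [A :|: s @: A], which has k+1 points outside [X], and by
   [star4] all of [X]. *)
have sg : (g * s) @: Z = g @: Z.
  apply: star3; rewrite ?groupM //; apply: (@leq_trans #|(A :&: s @: A) :|: (g @: Z :&: X)|).
    have := cardsUI (A :&: s @: A) (g @: Z :&: X).
    rewrite (_ : _ :&: (_ :&: X) = set0) ?cards0 ?cAs; first by clear - k0 le2; lia.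
    apply/setP=> z; rewrite !inE; apply/negP=> /andP[/andP[/(subsetP AX)]].
    by rewrite inE => /negPf-> _; rewrite andbF.
  apply: subset_leq_card; rewrite subUset !subsetI imM; apply/andP; split.
    rewrite (subset_trans (subsetIr _ _)) ?imsetS //=.
    by rewrite (subset_trans (subsetIl _ _)).
  rewrite subsetIl andbT; apply/subsetP=> z /setIP[zg zX].
  by rewrite -(sX z zX) im_mem.
have sAX : s @: A \subset ~: X.
  apply/subsetP=> z; rewrite imP inE => zA; apply: contraL (subsetP AX _ zA) => zX.
  by rewrite inE negbK -(sX z zX) permK.
have XgZ : X \subset g @: Z.
  apply: star4 => //; last by apply/set0Pn; exists x; rewrite inE xg.
  apply: (@leq_trans #|A :|: s @: A|).
    have := cardsUI A (s @: A); rewrite im_card cA cAs; clear - k0; lia.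
  by rewrite subset_leq_card // subUset AgX /= subsetI sAX andbT -sg imM imsetS.
(* Replacing a point [a] of [A] by a point [c] off the block yields a second block through [x]; it
   also has two points in [X], so it shares k+1 points with the first one and would contain [c] and
   equal it. *)
have [c cN] : exists c, c \notin g @: Z.
  apply/existsP; rewrite -negb_forall; apply/negP=> /forallP h.
  have : #|g @: Z| = #|T| by rewrite -cardsT; congr #|pred_of_set _|; apply/setP=> z; rewrite h inE.
  by rewrite im_card cZ => e; clear - e mX X2 X2T; lia.
have cX : c \notin X by apply: contra cN; apply: (subsetP XgZ).
have [a aA] : exists a, a \in A by apply/set0Pn; rewrite -card_gt0 cA.
have cA' : #|A :\ a| = k.-1 by rewrite -cA (cardsD1 a A) aA.
have cA2 : c \notin A :\ a by apply: contra cN; rewrite inE => /andP[_]; apply: (subsetP Ag).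
have xcA : x \notin c |: (A :\ a).
  rewrite !inE negb_or negb_and xA orbT andbT; apply: contraNneq cX => <- //.
have [h hG sub2] := cover (x |: (c |: (A :\ a))) (ltac:(rewrite !cardsU1 xcA cA2 cA'; clear - k0; lia)).
have [xh ch Ah] : [/\ x \in h @: Z, c \in h @: Z & A :\ a \subset h @: Z].
  by move: sub2; rewrite !subUset !sub1set => /and3P.
have le3 : 2 <= #|h @: Z :&: X|.
  apply: (star5 h x) => //; apply: (@leq_trans #|c |: (A :\ a)|).
    by rewrite cardsU1 cA2 cA'; clear - k0; lia.
  rewrite subset_leq_card // subsetI !subUset !sub1set ch Ah inE cX /=.
  by rewrite (subset_trans _ AX) // subsetDl.
suff e : h @: Z = g @: Z by rewrite -e ch in cN.
apply: star3 => //; apply: (@leq_trans #|(A :\ a) :|: (h @: Z :&: X)|).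
  have := cardsUI (A :\ a) (h @: Z :&: X).
  rewrite (_ : _ :&: (_ :&: X) = set0) ?cards0 ?cA'; first by clear - k0 le3; lia.
  apply/setP=> z; rewrite !inE; apply/negP=> /andP[/andP[_ /(subsetP AX)]].
  by rewrite inE => /negPf-> ; rewrite andbF.
apply: subset_leq_card; rewrite subUset !subsetI Ah subsetIl /=.
by rewrite (subset_trans _ Ag) ?subsetDl //= (subset_trans (subsetIr _ _)).
Qed.

(** One Jordan set with n-k-1 points suffices at each stage: (k+1)-homogeneity carries its
    complement to every (k+1)-set, so all sets of that size are Jordan and [homogS] applies. *)
Lemma jordan_homog : homog #|X|.
Proof.
suff h k : k < #|X| -> homog k.+1 by rewrite -(prednK (ltnW X2)); apply: h; lia.
elim: k => [_|k IH kX].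
  apply: homogS; rewrite ?subn0; last 1 first.
  - lia.
  - by move=> A B /cards0_eq-> /cards0_eq->; exists 1; rewrite ?group1 ?im1.
  - move=> Y cY x y _ _; have [g gG gx] := tG (in_setT x) (in_setT y); exists g => //; split=> //.
    have -> : Y = setT by apply/eqP; rewrite eqEcard subsetT cardsT cY /=.
    exact/subsetP.
have hk := IH (ltnW kX); have [Y cY jY] := jordan_step kX hk.
apply: homogS => //; last by lia.
move=> Y' cY'; have [||g gG gY] := hk (~: Y) (~: Y').
- by rewrite cardsCs setCK cY; lia.
- by rewrite cardsCs setCK cY'; lia.
by rewrite -(setCK Y') -gY imC setCK; apply: jordanJ.
Qed.

(** By homogeneity [x |: C], with [C] outside [X], is a Jordan set too. It meets [X] in [x] alone,
    so [comm_cyc3] applies to elements moving [x] supported on the two sets. The bound [X2T] leaves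
    room for [C]. *)
Lemma jordan_cyc3 : has_cyc3 G.
Proof.
have [x xX] : exists x, x \in X by apply/set0Pn; rewrite -card_gt0; lia.
have [C CX cC] : exists2 C : {set T}, C \subset ~: X & #|C| = #|X|.-1.
  by apply: ex_subset_card; have := cardsC X; lia.
have xC : x \notin C by apply: contraL xX => /(subsetP CX); rewrite inE.
have [g gG gX] := jordan_homog (erefl #|X|) (ltac:(rewrite -(prednK (ltnW X2)) cardsU1 xC cC //) : #|x |: C| = #|X|).
have jgX := jordanJ gG jX.
have mv Y : jordan Y -> x \in Y -> #|Y| = #|X| -> exists2 u, u \in G & perm_on Y u /\ u x != x.
  move=> jY xY cY; have [y] : exists y, y \in Y :\ x.
    by apply/set0Pn; rewrite -card_gt0; move: X2; rewrite -cY (cardsD1 x) xY.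
  rewrite !inE => /andP[yx yY]; have [u uG [uY ux]] := jY _ _ xY yY.
  by exists u => //; rewrite ux.
have [u uG [uX ux]] := mv _ jX xX erefl.
have [v vG [vX vx]] := mv _ jgX (ltac:(by rewrite gX setU11)) (im_card _ _).
have [y [z [? ? ? e]]] : exists y z, [/\ x != y, x != z, y != z & [~ u, v] = cyc3 x y z].
  apply: comm_cyc3 => // y yx; have [yX|yX] := boolP (y \in X); last by left; apply: (out_perm uX).
  right; apply: (out_perm vX); rewrite gX !inE (negPf yx) /=.
  by apply: contraL yX => /(subsetP CX); rewrite inE.
by exists x, y, z; split=> //; rewrite -e groupR.
Qed.

End Jordan.

(** * Restrictions of permutations *)

Section Restr.
Variable T : finType.
Implicit Types (x y z t : T) (g h u : {perm T}) (X Y Z A : {set T}).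

Lemma astabs_im X g : g @: X = X -> g \in 'N(X | 'P).
Proof.
by move=> gX; rewrite !inE; apply/subsetP=> x xX; rewrite inE -{1}gX im_mem.
Qed.

Lemma rsE X g x : g @: X = X -> x \in X -> restr_perm X g x = g x.
Proof. by move=> gX xX; rewrite restr_permE ?astabs_im. Qed.

Lemma rs_on X g : perm_on X (restr_perm X g).
Proof. exact: restr_perm_on. Qed.

Lemma rsM X g h : g @: X = X -> h @: X = X ->
  restr_perm X (g * h) = restr_perm X g * restr_perm X h.
Proof. by move=> gX hX; rewrite morphM ?astabs_im. Qed.

Lemma rsV X g : g @: X = X -> restr_perm X g^-1 = (restr_perm X g)^-1.
Proof. by move=> gX; rewrite morphV ?astabs_im. Qed.

Lemma rsR X g h : g @: X = X -> h @: X = X ->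
  restr_perm X [~ g, h] = [~ restr_perm X g, restr_perm X h].
Proof. by move=> gX hX; rewrite morphR ?astabs_im. Qed.

Lemma rs_id X g : perm_on X g -> restr_perm X g = g.
Proof.
move=> gX; apply/permP=> x; have [xX|xX] := boolP (x \in X).
  by rewrite rsE // im_perm_on.
by rewrite (out_perm (rs_on _ _) xX) (out_perm gX xX).
Qed.

Lemma rs_eq X g h : g @: X = X -> h @: X = X -> {in X, g =1 h} ->
  restr_perm X g = restr_perm X h.
Proof.
move=> gX hX gh; apply/permP=> x; have [xX|xX] := boolP (x \in X).
  by rewrite !rsE // gh.
by rewrite !(out_perm (rs_on _ _) xX).
Qed.

Lemma rs_eq1 X g : (forall x, x \in X -> g x = x) -> restr_perm X g = 1.
Proof.
move=> h; apply/permP=> x; rewrite perm1; have [xX|xX] := boolP (x \in X).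
  by rewrite rsE ?im_fix // h.
by rewrite (out_perm (rs_on _ _) xX).
Qed.

Lemma rs_eq1P X g x : g @: X = X -> restr_perm X g = 1 -> x \in X -> g x = x.
Proof. by move=> gX e xX; rewrite -(rsE gX xX) e perm1. Qed.

Lemma tperm_on X x y : x \in X -> y \in X -> perm_on X (tperm x y).
Proof.
move=> xX yX; apply/subsetP=> t; rewrite inE; case: tpermP => [->|->|] //.
by rewrite eqxx.
Qed.

Lemma move3 X (a b c u v w : T) :
  [/\ a \in X, b \in X & c \in X] -> [/\ u \in X, v \in X & w \in X] ->
  [/\ a != b, a != c & b != c] -> [/\ u != v, u != w & v != w] ->
  exists2 g, perm_on X g & [/\ g a = u, g b = v & g c = w].
Proof.
move=> [aX bX cX] [uX vX wX] [ab ac bc] [uv uw vw].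
pose s1 := tperm a u; pose s2 := tperm (s1 b) v; pose s3 := tperm (s2 (s1 c)) w.
have h1 : perm_on X s1 by apply: tperm_on.
have h2 : perm_on X s2 by apply: tperm_on; rewrite // (perm_closed _ h1).
have h3 : perm_on X s3 by apply: tperm_on; rewrite // (perm_closed _ h2) (perm_closed _ h1).
have a1 : s1 a = u by rewrite tpermL.
have b1 : s1 b != u by rewrite -a1 (inj_eq perm_inj) eq_sym.
have c1 : s1 c != u by rewrite -a1 (inj_eq perm_inj) eq_sym.
have a2 : s2 u = u by rewrite tpermD // eq_sym.
have b2 : s2 (s1 b) = v by rewrite tpermL.
have c2 : s2 (s1 c) != u by rewrite -a2 (inj_eq perm_inj).
have c2' : s2 (s1 c) != v by rewrite -b2 !(inj_eq perm_inj) eq_sym.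
exists (s1 * s2 * s3); first by rewrite !perm_onM.
rewrite !permM a1 a2 b2 tpermL; split=> //; rewrite tpermD // eq_sym //.
Qed.

(** A 3-cycle has to be found by hand, since [X] may have only three or four points. The elements
    [q^-1 * q ^ t], for [t] a transposition, are products of two transpositions; if they never lead
    to a 3-cycle, then [q] is a double transposition, hence even. *)
Lemma normal_odd_full (A : {group {perm T}}) X : 2 < #|X| ->
  (forall g, g \in A -> perm_on X g) ->
  (forall g h, g \in A -> perm_on X h -> g ^ h \in A) ->
  forall q, q \in A -> odd_perm q -> forall h, perm_on X h -> h \in A.
Proof.
move=> X3 AX An q qA qo.
suff [a [b [c [[aX bX cX] [ab ac bc] cA]]]] : exists a b c,
    [/\ [/\ a \in X, b \in X & c \in X], [/\ a != b, a != c & b != c] & cyc3 a b c \in A].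
  have ev : forall h : {perm T}, perm_on X h -> ~~ odd_perm h -> h \in A.
    apply: even_gen_cyc3 => u' v w uX vX wX uv uw vw.
    by have [g gX [<- <- <-]] := move3 (And3 aX bX cX) (And3 uX vX wX) (And3 ab ac bc) (And3 uv uw vw);
      rewrite -cyc3J An.
  move=> h hX; have [ho|he] := boolP (odd_perm h); last exact: ev.
  rewrite -(groupMl _ qA); apply: ev; first by apply: perm_onM => //; apply: AX.
  by rewrite odd_permM qo ho.
have qX := AX _ qA.
have inX t : t \in X -> q t \in X by rewrite (perm_closed _ qX).
have comm x z : z \in X -> x \in X -> tperm (q x) (q z) * tperm x z \in A.
  move=> zX xX; rewrite -tpermJ (_ : _ * _ = q^-1 * q ^ tperm x z).
  by rewrite groupM ?groupV ?An // tperm_on.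
  by rewrite /conjg tpermV !mulgA.
have [x qx] : exists x, q x != x.
  apply/existsP; apply: contraTT qo; rewrite negb_exists => /forallP h.
  rewrite (_ : q = 1) ?odd_perm1 //; apply/permP=> t; rewrite perm1; apply/eqP.
  by move: (h t); rewrite negbK.
have xX : x \in X by apply: (subsetP qX).
have [/existsP[a /existsP[b /existsP[c /and5P[aX bX cX ab /and3P[ac bc cA]]]]]|] :=
  boolP [exists a, exists b, exists c, [&& a \in X, b \in X, c \in X, a != b, a != c, b != c & cyc3 a b c \in A]].
  by exists a, b, c.
move=> no; have {}no a b c : a \in X -> b \in X -> c \in X -> a != b -> a != c -> b != c -> cyc3 a b c \notin A.
  move=> aX bX cX ab ac bc; apply: contra no => cA; apply/existsP; exists a; apply/existsP; exists b.
  by apply/existsP; exists c; rewrite aX bX cX ab ac bc.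
(* If [q] fixed [z] or sent it to [s], the two transpositions of [comm] would share one point and
   multiply to a 3-cycle. *)
have key s z : s \in X -> q s != s -> z \in X -> z != s -> z != q s -> q z != s /\ q z != z.
  move=> sX qs zX zs zqs; split; apply/eqP => e; have := comm s z zX sX.
    by rewrite e tpermC => h; have := no s (q s) z; rewrite h sX zX inX // ; move/(_ isT isT isT); rewrite eq_sym qs eq_sym zs eq_sym zqs; move/(_ isT isT isT).
  rewrite e tpermC (tpermC s) => h; have := no z (q s) s; rewrite h sX zX inX //.
  by move/(_ isT isT isT); rewrite zs zqs qs; move/(_ isT isT isT).
have inv s : s \in X -> q s != s -> q (q s) = s.
  move=> sX qs; have pX : q^-1 s \in X by rewrite -(perm_closed _ qX) permKV.
  have ps : q^-1 s != s by apply: contra qs => /eqP {1}<-; rewrite permKV.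
  have [<-|pq] := eqVneq (q^-1 s) (q s); first by rewrite permKV.
  by have [] := key s (q^-1 s) sX qs pX ps pq; rewrite permKV eqxx.
have [z] : exists z, z \in X :\: [set x; q x].
  apply/set0Pn; rewrite -card_gt0 cardsD subn_gt0; apply: leq_ltn_trans X3.
  by apply: leq_trans (subset_leq_card (subsetIr _ _)) _; rewrite cards2; case: eqP.
rewrite !inE negb_or => /andP[/andP[zx zqx] zX].
have [qzx qz] := key x z xX qx zX zx zqx.
have qzqx : q z != q x by rewrite (inj_eq perm_inj).
(* With a fifth point [t], conjugating by [tperm z t] changes only one of the two transpositions,
   and the quotient is a 3-cycle. *)
have [/existsP[t /and5P[tX tx tqx tz tqz]]|] :=
  boolP [exists t, [&& t \in X, t != x, t != q x, t != z & t != q z]].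
  have c1 := comm x z zX xX.
  have := An _ (tperm z t) c1 (tperm_on zX tX).
  rewrite conjMg !tpermJ (@tpermD _ z t (q x)) ?(@tpermD _ z t (q z)) ?(@tpermD _ z t x) ?tpermL //; try neq.
  move=> c2; have := groupM (groupVr c1) c2; rewrite invMg -mulgA mulKg tpermV.
  by move=> c3; exists x, z, t; split=> //; split=> //; rewrite eq_sym.
rewrite negb_exists => /forallP h; suff qE : q = tperm x (q x) * tperm z (q z).
  by move: qo; rewrite qE odd_permM !odd_tperm; rewrite (eq_sym x) (eq_sym z) qx qz.
apply/permP=> t; rewrite permM.
have [->|tx] := eqVneq t x; first by rewrite tpermL tpermD //; rewrite eq_sym.
have [->|tqx] := eqVneq t (q x).
  by rewrite tpermR tpermD // inv.
have [->|tz] := eqVneq t z.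
  by rewrite (@tpermD _ x (q x) z) ?tpermL //; neq.
have [->|tqz] := eqVneq t (q z).
  by rewrite (@tpermD _ x (q x) (q z)) ?tpermR ?inv //; neq.
rewrite !tpermD; try neq.
by apply: (out_perm qX); move: (h t); rewrite tx tqx tz tqz !andbT.
Qed.

Lemma ex_swap (A B : {set T}) : [disjoint A & B] -> #|A| = #|B| ->
  exists2 s : {perm T}, perm_on (A :|: B) s & s @: A = B /\ s @: B = A.
Proof.
move=> dAB cAB.
have nA t : t \in B -> t \in A = false.
  by move=> tB; apply/negbTE; apply: contraL tB => tA; rewrite (disjointFr dAB tA).
pose f (A B : {set T}) t := nth t (enum B) (index t (enum A)).
have fin (A' B' : {set T}) t : #|A'| = #|B'| -> t \in A' -> f A' B' t \in B'.
  move=> c tA; rewrite -mem_enum mem_nth // -cardE -c cardE index_mem mem_enum //.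
have fK (A' B' : {set T}) t : #|A'| = #|B'| -> t \in A' -> f B' A' (f A' B' t) = t.
  move=> c tA; rewrite /f index_uniq ?enum_uniq //.
    by rewrite (set_nth_default t) ?nth_index ?mem_enum // index_mem mem_enum.
  by rewrite -cardE -c cardE index_mem mem_enum.
pose g t := if t \in A then f A B t else if t \in B then f B A t else t.
have gg : involutive g.
  move=> t; rewrite /g; case: (boolP (t \in A)) => tA.
    have tB := fin A B t cAB tA; rewrite (nA _ tB) tB fK //.
  case: (boolP (t \in B)) => tB; last by rewrite (negPf tA) (negPf tB).
  by rewrite (fin B A t (esym cAB) tB) fK.
exists (perm (inv_inj gg)).
  apply/subsetP=> t; rewrite !inE permE /g; case: ifP => //; case: ifP => // _ _.
  by rewrite eqxx.
have sub (A' : {set T}) (B' : {set T}) : #|A'| = #|B'| -> (forall t, t \in A' -> g t \in B') -> perm (inv_inj gg) @: A' = B'.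
  move=> c h; apply/eqP; rewrite eqEcard im_card c leqnn andbT.
  by apply/subsetP=> t /imsetP[u uA ->]; rewrite permE h.
split; apply: sub => // t tA; rewrite /g ?tA; first exact: fin.
by rewrite (nA _ tA); apply: fin.
Qed.

End Restr.

(** * Maximal subgroups of the stabilizer of an equivalence relation *)

Section Rstab.
Variable T : finType.
Implicit Types (x y z t : T) (g h u : {perm T}) (e : rel T).

Definition cls e x : {set T} := [set y | e x y].
Definition rstab (G : {set {perm T}}) e : {set {perm T}} :=
  [set g in G | [forall x, forall y, e (g x) (g y) == e x y]].

Lemma rstabP (G : {set {perm T}}) e g :
  reflect (g \in G /\ forall x y, e (g x) (g y) = e x y) (g \in rstab G e).
Proof.
rewrite inE; apply: (iffP andP) => [[gG /forallP h]|[gG h]]; split=> //.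
  by move=> x y; move/forallP/(_ y)/eqP: (h x).
by apply/forallP=> x; apply/forallP=> y; apply/eqP.
Qed.

Lemma rstab_group_set (G : {group {perm T}}) e : group_set (rstab G e).
Proof.
apply/group_setP; split; first by apply/rstabP; split=> // x y; rewrite !perm1.
move=> g h /rstabP[gG eg] /rstabP[hG eh]; apply/rstabP; split; first exact: groupM.
by move=> x y; rewrite !permM eh eg.
Qed.
Canonical rstab_group (G : {group {perm T}}) e := group (rstab_group_set G e).

Lemma rstab_sub (G : {group {perm T}}) e : rstab G e \subset G.
Proof. by apply/subsetP=> g /rstabP[]. Qed.

Lemma einv_rstab (G : {group {perm T}}) e : einv (rstab G e) e.
Proof. by move=> g /rstabP[]. Qed.

Lemma sub_rstab (G K : {group {perm T}}) e : K \subset G -> einv K e -> K \subset rstab G e.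
Proof. by move=> KG h; apply/subsetP=> g gK; apply/rstabP; rewrite (subsetP KG) //; split=> //; apply: h. Qed.

Section Eqv.
Variable e : rel T.
Hypothesis ee : equivalence_rel e.
Lemma eqv_refl x : e x x. Proof. by have [] := ee x x x. Qed.
Lemma eqv_sym x y : e x y = e y x.
Proof.
suff h a b : e a b -> e b a by apply/idP/idP; apply: h.
by move=> ab; have [_ h] := ee a b a; rewrite -(h ab) eqv_refl.
Qed.
Lemma eqv_trans y x z : e x y -> e y z -> e x z.
Proof. by move=> xy yz; have [_ h] := ee x y z; rewrite (h xy). Qed.
Lemma eqv_congr x y : e x y -> e x =1 e y.
Proof. by move=> xy z; have [_ h] := ee x y z; apply: h. Qed.
Lemma cls_eq x y : e x y -> cls e x = cls e y.
Proof. by move=> xy; apply/setP=> z; rewrite !inE (eqv_congr xy). Qed.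
Lemma mem_cls x : x \in cls e x. Proof. by rewrite inE eqv_refl. Qed.
Lemma cls_disj x y : ~~ e x y -> [disjoint cls e x & cls e y].
Proof.
move=> xy; rewrite -setI_eq0; apply/eqP/setP=> z; rewrite !inE.
by apply/negP=> /andP[xz yz]; case/negP: xy; apply: eqv_trans xz _; rewrite eqv_sym.
Qed.
Lemma in_pres g : (forall t, e t (g t)) -> forall x y, e (g x) (g y) = e x y.
Proof.
move=> h x y; rewrite -(eqv_congr (h x)); apply/idP/idP => xy.
  by apply: eqv_trans xy _; rewrite eqv_sym.
exact: eqv_trans xy _.
Qed.
Lemma perm_on_in g x t : perm_on (cls e x) g -> e t (g t).
Proof.
move=> gX; have [tX|tX] := boolP (t \in cls e x); last by rewrite (out_perm gX tX) eqv_refl.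
have := tX; rewrite -(perm_closed _ gX) => gtX; move: tX gtX; rewrite !inE => xt xgt.
by apply: eqv_trans xgt; rewrite eqv_sym.
Qed.
Lemma im_cls g x : (forall x y, e (g x) (g y) = e x y) -> g @: cls e x = cls e (g x).
Proof. by move=> h; apply/setP=> y; rewrite imP !inE -h permKV. Qed.
End Eqv.

(** A pointwise exchange of the classes may be odd; a transposition of [u] and [u'] inside one class
    then corrects the sign without changing the effect on the classes. *)
Lemma swap_cls (alt : bool) (G : {group {perm T}}) (f : rel T) (u u' v : T) :
  (forall g : {perm T}, (g \in G) = ~~ (alt && odd_perm g)) -> equivalence_rel f ->
  #|cls f u| = #|cls f v| -> ~~ f u v -> f u u' -> u != u' ->
  exists g : {perm T}, [/\ g \in G, perm_on (cls f u :|: cls f v) g, (forall a b, f (g a) (g b) = f a b),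
     g @: cls f u = cls f v & g @: cls f v = cls f u].
Proof.
move=> hG ff cf nf fu uu'.
have [s s_on [sAB sBA]] := ex_swap (cls_disj ff nf) cf.
have s_cls : forall a b, f (s a) (s b) = f a b.
  have mA a : (a \in cls f u) = (s a \in cls f v) by rewrite -sAB im_mem.
  have mB a : (a \in cls f v) = (s a \in cls f u) by rewrite -sBA im_mem.
  have out a : a \notin cls f u -> a \notin cls f v -> s a = a.
    by move=> aA aB; apply: (out_perm s_on); rewrite inE negb_or aA.
  move=> a b.
  have [aA|aA] := boolP (a \in cls f u).
    have := aA; rewrite mA !inE => h1; rewrite -(eqv_congr ff h1); move: (aA); rewrite inE => h2.
    by rewrite -(eqv_congr ff h2) -[f v _](in_set (f v)) -mA inE.
  have [aB|aB] := boolP (a \in cls f v).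
    have := aB; rewrite mB !inE => h1; rewrite -(eqv_congr ff h1); move: (aB); rewrite inE => h2.
    by rewrite -(eqv_congr ff h2) -[f u _](in_set (f u)) -mB inE.
  rewrite (out _ aA aB).
  have [bA|bA] := boolP (b \in cls f u).
    transitivity false; last first.
      apply/esym/negbTE; apply: contra aA => fab; rewrite inE (eqv_sym ff); apply: (eqv_trans ff fab).
      by rewrite (eqv_sym ff); rewrite inE in bA.
    apply/negbTE; apply: contra aB => fab; rewrite inE (eqv_sym ff); apply: (eqv_trans ff fab).
    by move: bA; rewrite mA inE (eqv_sym ff).
  have [bB|bB] := boolP (b \in cls f v).
    transitivity false; last first.
      apply/esym/negbTE; apply: contra aB => fab; rewrite inE (eqv_sym ff); apply: (eqv_trans ff fab).
      by rewrite (eqv_sym ff); rewrite inE in bB.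
    apply/negbTE; apply: contra aA => fab; rewrite inE (eqv_sym ff); apply: (eqv_trans ff fab).
    by move: bB; rewrite mB inE (eqv_sym ff).
  by rewrite (out _ bA bB).
have [sG|sG] := boolP (s \in G); first by exists s.
have t_st X : X = cls f u \/ X = cls f v -> tperm u u' @: X = X.
  have uX : u \in cls f u by rewrite inE eqv_refl.
  have uX' : u' \in cls f u by rewrite inE.
  case=> ->; first by rewrite im_perm_on ?tperm_on.
  apply: im_fix => t tv; rewrite (out_perm (tperm_on uX uX')) //.
  by rewrite (disjointFl (cls_disj ff nf)).
exists (tperm u u' * s); split.
- by move: sG; rewrite !hG odd_permM odd_tperm uu' !negbK => /andP[-> ->].
- apply: perm_onM s_on; apply: perm_on_sub (subsetUl _ _) _; apply: tperm_on; rewrite inE ?eqv_refl //.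
- move=> a b; rewrite !permM s_cls; apply: in_pres => // t.
  by case: tpermP => [->|->|_ _] //; [rewrite eqv_sym|rewrite eqv_refl].
- by rewrite imM t_st ?sAB //; left.
- by rewrite imM t_st ?sBA //; right.
Qed.

(** The form in which maximality of K in M is used: as K normalizes P, the join is the product,
    which is K or M. *)
Lemma mem_mulN (K P : {group {perm T}}) (M : {group {perm T}}) :
  K \subset M -> (forall L : {group {perm T}}, K \subset L -> L \subset M -> L \subset K \/ M \subset L) ->
  P \subset M -> K \subset 'N(P) -> P \subset K \/
   (forall m, m \in M -> exists2 k, k \in K & exists2 p, p \in P & m = k * p).
Proof.
move=> KM mx PM nP; have jE := norm_joinEl nP.
case: (mx (K <*> P)%G); rewrite /= ?joing_subl ?join_subG ?KM ?PM //.
  by move=> h; left; case/andP: h.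
rewrite jE => /subsetP h; right=> m /h /mulsgP[k p kK pP ->]; by exists k => //; exists p.
Qed.

End Rstab.

(** * The kernel of the action on classes, and restrictions to one class *)

Section LemmaN.
Variables (T : finType) (alt : bool) (G : {group {perm T}}) (e : rel T) (K : {group {perm T}}).
Implicit Types (x y z t : T) (g h d : {perm T}).
(* G is the alternating group if [alt] holds and the symmetric group otherwise. *)
Hypothesis hG : forall g, (g \in G) = ~~ (alt && odd_perm g).
Hypothesis ee : equivalence_rel e.
Let M := rstab G e.
Hypotheses (KM : K \subset M) (KneM : ~ M \subset K) (tK : ptrans K setT).
Hypothesis mx : forall L : {group {perm T}}, K \subset L -> L \subset M -> L \subset K \/ M \subset L.
Hypothesis a3 : forall x, 2 < #|cls e x|.
Hypothesis nall : exists x y, ~~ e x y.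

Lemma evG g : ~~ odd_perm g -> g \in G. Proof. by move=> h; rewrite hG negb_and h orbT. Qed.
Lemma K_inv : einv K e. Proof. by move=> g /(subsetP KM)/rstabP[]. Qed.

Lemma other x : exists y, ~~ e x y.
Proof.
have [a [b ab]] := nall; have [xa|xa] := boolP (e x a); last by exists a.
by exists b; rewrite (eqv_congr ee xa).
Qed.

Lemma cls_avoid x (S : seq T) : size S < #|cls e x| -> exists2 y, e x y & y \notin S.
Proof.
move=> h; have [/existsP[y /andP[xy yS]]|no] := boolP [exists y, e x y && (y \notin S)]; first by exists y.
move: h; rewrite ltnNge; have -> // : #|cls e x| <= size S.
apply: leq_trans (card_size S); apply: subset_leq_card; apply/subsetP=> y; rewrite inE => xy.
by move: no; rewrite negb_exists => /forallP/(_ y); rewrite xy negbK.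
Qed.

(** The base group of the imprimitive wreath product, cut down to [G]. *)
Definition bker := [set g in M | [forall x, e x (g x)]].
Lemma bkerP g : reflect (g \in G /\ forall x, e x (g x)) (g \in bker).
Proof.
rewrite inE; apply: (iffP andP) => [[/rstabP[gG _] /forallP]|[gG h]] //.
by split; [apply/rstabP; split=> //; apply: in_pres|apply/forallP].
Qed.
Lemma bker_group_set : group_set bker.
Proof.
apply/group_setP; split; first by apply/bkerP; split=> // x; rewrite perm1 eqv_refl.
move=> g h /bkerP[gG gk] /bkerP[hG' hk]; apply/bkerP; split; first exact: groupM.
by move=> x; rewrite permM; apply: eqv_trans (gk _) (hk _).
Qed.
Canonical bker_group := group bker_group_set.
Lemma bkerM : bker \subset M. Proof. by apply/subsetP=> g; rewrite inE => /andP[]. Qed.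
Lemma bkerJ g m : g \in bker -> m \in M -> g ^ m \in bker.
Proof.
move=> /bkerP[gG gk] /rstabP[mG me]; apply/bkerP; split; first exact: groupJ.
by move=> x; rewrite -{1}(permKV m x) -[X in (g ^ m) X](permKV m) permJ me.
Qed.
Lemma bker_st g x : g \in bker -> g @: cls e x = cls e x.
Proof.
move=> gk; have /bkerP[gG h] := gk; rewrite im_cls; last exact: in_pres.
by apply/esym/(cls_eq ee).
Qed.
Let D := (K :&: bker)%G.

Definition sgn x g := odd_perm (restr_perm (cls e x) g).
Lemma sgnM x g h : g \in bker -> h \in bker -> sgn x (g * h) = sgn x g (+) sgn x h.
Proof. by move=> gk hk; rewrite /sgn rsM ?bker_st // odd_permM. Qed.
Lemma sgnV x g : g \in bker -> sgn x g^-1 = sgn x g.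
Proof. by move=> gk; rewrite /sgn rsV ?bker_st // odd_permV. Qed.
Lemma sgn_on x g : perm_on (cls e x) g -> sgn x g = odd_perm g.
Proof. by move=> h; rewrite /sgn rs_id. Qed.
Lemma sgn_off x y g : ~~ e x y -> perm_on (cls e y) g -> sgn x g = false.
Proof.
move=> xy gy; rewrite /sgn rs_eq1 ?odd_perm1 // => t tx; apply: (out_perm gy).
by rewrite (disjointFr (cls_disj ee xy)).
Qed.
Lemma on_bker x g : perm_on (cls e x) g -> g \in G -> g \in bker.
Proof. move=> gx gG; apply/bkerP; split=> //.
move=> t.
exact: (perm_on_in ee t gx). Qed.
Lemma rs_sgnJ x g m : g \in bker -> m \in M -> sgn (m x) (g ^ m) = sgn x g.
Proof.
move=> gk mM; have /rstabP[mG me] := mM; rewrite /sgn -[in RHS](odd_permJ _ m).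
congr odd_perm; apply/permP=> t.
have imm := im_cls x me.
have [tX|tX] := boolP (t \in cls e (m x)).
  rewrite rsE ?bker_st ?bkerJ //; rewrite -{1 2}(permKV m t) !permJ rsE ?bker_st //.
  by rewrite -imP imm.
rewrite (out_perm (rs_on _ _) tX) -{2}(permKV m t) permJ (out_perm (rs_on _ _)) ?permKV //.
by rewrite -imP imm.
Qed.

(** The product of the alternating groups of the classes, available whether [G] is symmetric or
    alternating. *)
Definition evB := [set g in bker | [forall x, ~~ sgn x g]].
Lemma evBP g : reflect (g \in bker /\ forall x, sgn x g = false) (g \in evB).
Proof.
rewrite [_ \in evB]inE; apply: (iffP andP) => [[gk /forallP h]|[gk h]]; split=> //.
  by move=> x; apply/negbTE/h.
by apply/forallP=> x; rewrite h.
Qed.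
Lemma evB_group_set : group_set evB.
Proof.
apply/group_setP; split.
  apply/evBP; split; first exact: group1.
  by move=> x; rewrite /sgn rs_eq1 ?odd_perm1 // => y _; rewrite perm1.
move=> g h /evBP[gk gs] /evBP[hk hs]; apply/evBP; split; first exact: groupM.
by move=> x; rewrite sgnM // gs hs.
Qed.
Canonical evB_group := group evB_group_set.
Lemma evB_norm : K \subset 'N(evB_group).
Proof.
apply/subsetP=> k kK; rewrite inE; apply/subsetP=> _ /imsetP[g /evBP[gk gs] ->].
have kM := subsetP KM _ kK; apply/evBP; split; first exact: bkerJ.
by move=> x; rewrite -{1}(permKV k x) rs_sgnJ.
Qed.
Lemma cyc3_evB x y z t : y \in cls e x -> z \in cls e x -> t \in cls e x ->
  y != z -> y != t -> z != t -> cyc3 y z t \in evB.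
Proof.
move=> yX zX tX yz yt zt; have on := cyc3_on yX zX tX.
have k : cyc3 y z t \in bker by apply: (on_bker on); rewrite evG // odd_cyc3.
apply/evBP; split=> // w; have [xw|xw] := boolP (e w x); last exact: (sgn_off xw).
by rewrite /sgn (cls_eq ee xw) rs_id // odd_cyc3.
Qed.
Lemma evBM : evB_group \subset M.
Proof. by apply/subsetP=> g /evBP[gk _]; apply: (subsetP bkerM). Qed.

Lemma ex3 x : exists y z, [/\ e x y, e x z & [/\ x != y, x != z & y != z]].
Proof.
have [y xy] := cls_avoid (S := [:: x]) (ltnW (a3 x)); rewrite inE => yx.
have [z xz] := cls_avoid (S := [:: x; y]) (a3 x); rewrite !inE negb_or => /andP[zx zy].
by exists y, z; split=> //; split; rewrite // eq_sym.
Qed.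

Section Pieces.
Variable S : {group {perm T}}.
Hypothesis Sk : S \subset bker.
(* K normalizes [pieces] of its own kernel, so by maximality it contains them or generates A with them. *)
Definition pieces := [set g in bker | [forall x, [exists d in S, [forall y, e x y ==> (g y == d y)]]]].
Lemma piecesP g : reflect (g \in bker /\ forall x, exists2 d, d \in S & forall y, e x y -> g y = d y) (g \in pieces).
Proof.
rewrite [g \in pieces]inE; apply: (iffP andP) => [[gk /forallP h]|[gk h]]; split=> //.
  move=> x; have /exists_inP[d dS /forallP hd] := h x; exists d => // y xy.
  by apply/eqP; move: (hd y); rewrite xy.
apply/forallP=> x; have [d dS hd] := h x; apply/exists_inP; exists d => //.
by apply/forallP=> y; apply/implyP=> /hd->.
Qed.
Lemma pieces_group_set : group_set pieces.
Proof.
apply/group_setP; split.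
  by apply/piecesP; split; [exact: group1|move=> x; exists 1; rewrite ?group1].
move=> g h /piecesP[gk gs] /piecesP[hk hs]; apply/piecesP; split; first exact: groupM.
move=> x; have [d dS hd] := gs x; have [d' dS' hd'] := hs x; exists (d * d'); first exact: groupM.
move=> y xy; rewrite !permM -(hd _ xy) hd' //; have /bkerP[_ /(_ y) gy] := gk.
exact: eqv_trans xy gy.
Qed.
Canonical pieces_group := group pieces_group_set.
Lemma pieces_bker : pieces \subset bker. Proof. by apply/subsetP=> g /piecesP[]. Qed.
Lemma pieces_norm (L : {group {perm T}}) : L \subset M -> L \subset 'N(S) -> L \subset 'N(pieces).
Proof.
move=> LM /subsetP nS; apply/subsetP=> m mL; rewrite inE.
apply/subsetP=> _ /imsetP[g /piecesP[gk gs] ->].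
have mM := subsetP LM _ mL; have /rstabP[mG me] := mM.
apply/piecesP; split; first exact: bkerJ.
move=> x; have [d dS hd] := gs (m^-1 x); exists (d ^ m); first by rewrite memJ_norm ?nS.
move=> y xy; rewrite -(permKV m y) !permJ hd // -me !permKV //.
Qed.
Lemma rs_pieces x d : d \in S -> restr_perm (cls e x) d \in G -> restr_perm (cls e x) d \in pieces.
Proof.
move=> dS rG; have on := rs_on (cls e x) d.
have dk := subsetP Sk _ dS; apply/piecesP; split; first exact: (on_bker on).
move=> y; have [xy|xy] := boolP (e x y).
  by exists d => // z yz; rewrite rsE ?bker_st // inE; apply: eqv_trans xy yz.
exists 1; rewrite ?group1 // => z yz; rewrite perm1 (out_perm on) // inE.
by apply: contra xy => xz; apply: (eqv_trans ee xz); rewrite eqv_sym.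
Qed.
End Pieces.

Section LemmaO.
Variable e' : rel T.
Hypotheses (ee' : equivalence_rel e') (ie' : einv K e') (se' : forall x y, e' x y -> e x y).
Hypotheses (e'1 : exists x y, x != y /\ e' x y) (e'2 : exists x y, e x y /\ ~~ e' x y).
(** The stabilizer of [e'] in [M] contains [K]. It is not [M]: a 3-cycle on two [e']-related points
    and a third point of their [e]-class destroys [e']. So it is contained in [K]. *)
Lemma lemmaO g : g \in M -> (forall x y, e' (g x) (g y) = e' x y) -> g \in K.
Proof.
move=> gM ge.
case: (mx (L := [group of rstab M e'])) => /=.
- exact: sub_rstab.
- exact: rstab_sub.
- by move/subsetP; apply; apply/rstabP.
move=> sub; have [x [y [xy exy]]] := e'1; have [x' [z' [xz' nxz']]] := e'2.
have [k kK kx] := tK (in_setT x') (in_setT x).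
have xz : e x (k z') by rewrite -kx K_inv.
have nxz : ~~ e' x (k z') by rewrite -kx ie'.
set z := k z' in xz nxz; have exy' := se' exy.
have xnz : x != z by apply: contra nxz => /eqP <-; apply: eqv_refl.
have ynz : y != z by apply: contra nxz => /eqP <-.
have c3 : cyc3 x y z \in M.
  apply: (subsetP evBM); apply: (@cyc3_evB x); rewrite ?inE ?eqv_refl //.
have /rstabP[_ /(_ x y)] := subsetP sub _ c3; rewrite !cyc3E; try neq; rwneq => h.
by case/negP: nxz; apply: (eqv_trans ee' exy); rewrite h.
Qed.
End LemmaO.

Hypothesis noc : ~ has_cyc3 K.

Lemma D_norm : K \subset 'N(D).
Proof.
apply/subsetP=> k kK; rewrite inE; apply/subsetP=> _ /imsetP[g /setIP[gK gk] ->].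
by rewrite inE groupJ // bkerJ // (subsetP KM).
Qed.

(** [K] has no 3-cycle, so it cannot absorb [evB]. *)
Lemma evB_lift m : m \in M -> exists2 k, k \in K & exists2 p, p \in evB & m = k * p.
Proof.
case: (mem_mulN (M := [group of M]) KM mx evBM evB_norm) => [/subsetP sub|h]; last exact: h.
have [x0 _] := nall; have [y [z [xy xz [xny xnz ynz]]]] := ex3 x0.
case: noc; exists x0, y, z; split=> //; apply: sub; apply: (@cyc3_evB x0); rewrite ?inE ?eqv_refl //.
Qed.

(** The factor in [evB] is even on each class, so every pattern of signs found in the kernel already
    occurs in [K]. *)
Lemma sgn_lift w : w \in bker -> exists2 d, d \in D & forall x, sgn x d = sgn x w.
Proof.
move=> wk; have [k kK [p /evBP[pk ps] wE]] := evB_lift (subsetP bkerM _ wk).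
have kk : k \in bker by rewrite -(groupMr _ pk) -wE.
by exists k; [rewrite inE kK|move=> x; rewrite wE sgnM // ps addbF].
Qed.

Definition full := forall x w, perm_on (cls e x) w -> exists2 d, d \in K :&: bker & restr_perm (cls e x) d = w.

(** This is [mem_mulN] for the pieces of [D]. If [K] contains them, restrictions to one class stay
    in [K]. If instead [M] is the product, a kernel element with prescribed action on a class is
    some [k * p], and there [p] agrees with an element of [D]. *)
Lemma K_cases : (forall x d, d \in K :&: bker -> restr_perm (cls e x) d \in G -> restr_perm (cls e x) d \in K) \/ full.
Proof.
have Dk : D \subset bker := subsetIr _ _.
case: (mem_mulN (P := pieces_group D) (M := [group of M]) KM mx) => /=.
- exact: subset_trans (pieces_bker _) bkerM.
- exact: pieces_norm KM D_norm.
- by move/subsetP=> h; left=> x d dD rG; apply: h; apply: rs_pieces.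
move=> h; right=> x w wx.
suff [w' w'G ww'] : exists2 w', w' \in bker & forall t, e x t -> w' t = w t.
  have [k kK [p /piecesP[pk /(_ x)[d /setIP[dK dk] hd]] w'E]] := h _ (subsetP bkerM _ w'G).
  have kk : k \in bker by rewrite -(groupMr _ pk) -w'E.
  exists (k * d); first by rewrite inE !groupM.
  rewrite -(rs_id wx); apply: rs_eq; [by rewrite bker_st ?groupM|by rewrite im_perm_on|].
  move=> t; rewrite inE => xt; rewrite -ww' // w'E !permM hd //.
  by have /bkerP[_ /(_ t)] := kk; apply: eqv_trans.
have [wG|wG] := boolP (w \in G); first by exists w => //; apply: (on_bker wx).
(* An odd [w] enters the alternating group once balanced by a transposition in another class, which
   leaves its action on the class of [x] unchanged. *)
have [y xy] := other x; have [z [t [yz _ [ynz _ _]]]] := ex3 y.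
have on : perm_on (cls e y) (tperm y z) by apply: tperm_on; rewrite !inE ?eqv_refl.
exists (w * tperm y z).
  apply/bkerP; split.
    by move: wG; rewrite !hG odd_permM odd_tperm ynz negbK => /andP[-> ->].
  move=> u; rewrite permM; apply: (eqv_trans ee (perm_on_in ee u wx)).
  exact: (perm_on_in ee _ on).
move=> u xu; rewrite permM (out_perm on) //.
have : w u \in cls e x by rewrite (perm_closed _ wx) inE.
by move=> wu; rewrite (disjointFr (cls_disj ee xy)).
Qed.

(** * The kernel of K inducing the full symmetric group on each class *)

Section Full.
Hypothesis fl : full.
Variable x : T.

Definition indep y := exists2 d, d \in D & sgn x d /\ sgn y d = false.

Lemma Dker d : d \in K :&: bker -> d \in bker. Proof. by case/setIP. Qed.

(** Otherwise the sign on the class of [x] is determined by the action on the class of [y]. Since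
    3-cycles have odd order, their lifts are even on the class of [x], hence so is some lift of
    every even permutation of the class of [y]; the witness of [indep] contradicts this. *)
Lemma full1 y : indep y -> exists2 q, q \in D & restr_perm (cls e y) q = 1 /\ sgn x q.
Proof.
case=> d0 d0D [sx sy].
have [/exists_inP[q qD /andP[/eqP q1 qs]]|no] := boolP [exists q in D, (restr_perm (cls e y) q == 1) && sgn x q].
  by exists q.
have {}no q : q \in D -> restr_perm (cls e y) q = 1 -> sgn x q = false.
  move=> qD q1; apply/negbTE; apply: contra no => qs; apply/exists_inP; exists q => //.
  by rewrite q1 eqxx.
pose U := [set d in D | ~~ sgn x d].
have UE g : (g \in U) = (g \in D) && ~~ sgn x g by rewrite in_set.
have Ug : group_set U.
  apply/group_setP; split.
    rewrite UE group1 /=; rewrite /sgn rs_eq1 ?odd_perm1 // => t _; exact: perm1.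
  by move=> g h; rewrite !UE => /andP[gD gs] /andP[hD hs]; rewrite groupM //= sgnM ?Dker // (negPf gs) (negPf hs).
have UN : U \subset 'N(cls e y | 'P).
  by apply/subsetP=> d; rewrite UE => /andP[/Dker dk _]; apply: astabs_im; rewrite bker_st.
have : restr_perm (cls e y) d0 \in restr_perm (cls e y) @* [group of group Ug].
  apply: (@even_gen_cyc3 _ _ (cls e y)); last 2 first.
  - exact: rs_on.
  - by rewrite -/(sgn y d0) sy.
  move=> a b c aY bY cY ab ac bc; have [d dD dE] := fl (cyc3_on aY bY cY).
  rewrite -dE; apply: mem_morphim; first by apply: astabs_im; rewrite bker_st ?Dker.
  rewrite UE dD /=; have dk := Dker dD.
  have : sgn x (d * d * d) = false.
    apply: no; first by rewrite !groupM.
    by rewrite !rsM; try (by rewrite bker_st ?groupM); rewrite dE cyc3_cube.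
  by rewrite !sgnM ?groupM //; case: (sgn x d).
case/morphimP=> u _; rewrite UE => /andP[uD us] e0.
have := no (d0 * u^-1); rewrite sgnM ?sgnV ?groupV ?Dker // sx (negPf us) /=.
have -> : restr_perm (cls e y) (d0 * u^-1) = 1.
  by rewrite rsM ?rsV ?bker_st ?groupV ?Dker // -e0 mulgV.
by rewrite groupM ?groupV // => /(_ isT erefl).
Qed.

(** The elements of [D] trivial on the class of [y] induce on that of [x] a subgroup normalized by
    the whole symmetric group and containing an odd permutation, so [normal_odd_full] applies. *)
Lemma full2 y (u v : T) : indep y -> e x u -> e x v -> 
  exists2 q, q \in D & restr_perm (cls e y) q = 1 /\ restr_perm (cls e x) q = tperm u v.
Proof.
case/full1=> q0 q0D [q01 q0s] xu xv.
pose E := [set d in D | restr_perm (cls e y) d == 1].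
have EE g : (g \in E) = (g \in D) && (restr_perm (cls e y) g == 1) by rewrite in_set.
have Eg : group_set E.
  apply/group_setP; split; first by rewrite EE group1 /= morph1.
  by move=> g h; rewrite !EE => /andP[gD /eqP gs] /andP[hD /eqP hs]; rewrite groupM //= rsM ?bker_st ?Dker // gs hs mulg1.
have EN d : d \in D -> d \in 'N(cls e x | 'P) by move=> /Dker dk; apply: astabs_im; rewrite bker_st.
have : tperm u v \in restr_perm (cls e x) @* [group of group Eg].
  have q0E : q0 \in E by rewrite EE q0D q01 eqxx.
  apply: (@normal_odd_full _ [group of restr_perm (cls e x) @* [group of group Eg]] _ (a3 x) _ _ _ (mem_morphim _ (EN _ q0D) q0E)) => //.
  - by move=> _ /morphimP[g _ _ ->]; apply: rs_on.
  - move=> _ h /morphimP[g _ gE ->] hx; have [d dD <-] := fl hx.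
    move: gE; rewrite EE => /andP[gD /eqP g1].
    rewrite -morphJ ?EN //; apply: mem_morphim; first by rewrite EN // groupJ.
    rewrite EE groupJ //= /conjg !rsM ?rsV ?bker_st ?groupM ?groupV ?Dker // g1 mul1g mulVg //.
  by apply: tperm_on; rewrite inE.
case/morphimP=> q _; rewrite EE => /andP[qD /eqP q1] qE; by exists q.
Qed.

(** Each commutator kills one more class: [p] is trivial on the classes treated so far and [q] on
    the new one, while on the class of [x] the commutator is the same 3-cycle again. *)
Lemma full3 (ys : seq T) (u v w : T) : {in ys, forall y, indep y} -> e x u -> e x v -> e x w ->
  [/\ u != v, u != w & v != w] ->
  exists2 d, d \in D & restr_perm (cls e x) d = cyc3 u v w /\ {in ys, forall y, restr_perm (cls e y) d = 1}.
Proof.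
move=> hys xu xv xw [uv uw vw]; elim: ys hys => [|y ys IH] hys.
  by have [||//|d dD dE] := fl (@cyc3_on _ (cls e x) u v w _ _ _); rewrite ?inE //; exists d.
have [|p pD [pE p1]] := IH; first by move=> t tys; apply: hys; rewrite inE tys orbT.
have [q qD [q1 qE]] := full2 (hys y (mem_head _ _)) xu xv.
exists [~ p, q]; first by rewrite groupR.
split.
  rewrite rsR ?bker_st ?Dker // pE qE /commg cyc3J tpermL tpermR tpermD; try neq.
  by rewrite cyc3V // -(@cyc3_rot _ v u w) ?cyc3_sq //; neq.
move=> t; rewrite inE rsR ?bker_st ?Dker // => /orP[/eqP->|tys]; first by rewrite q1 commg1.
by rewrite p1 // comm1g.
Qed.

(** If all other classes were independent of that of [x], [full3] would leave a 3-cycle in [K]. *)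
Lemma full_no_indep : exists2 y, ~~ e x y & ~ indep y.
Proof.
have [y [z [xy xz [xny xnz ynz]]]] := ex3 x.
pose ys := [seq t <- enum T | ~~ e x t].
have [/existsP[t /andP[xt /negP nt]]|no] := boolP [exists t, ~~ e x t && ~~ [exists d in D, sgn x d && ~~ sgn t d]].
  exists t => // -[d dD [sx st]]; apply: nt; apply/exists_inP; exists d => //.
  by rewrite sx st.
have [||d dD [dE d1]] := @full3 ys x y z _ (eqv_refl ee x) xy xz; [|by split|].
  move=> t; rewrite mem_filter => /andP[xt _]; move: no; rewrite negb_exists => /forallP/(_ t).
  rewrite xt negbK => /exists_inP[d dD /andP[sx st]]; exists d => //; split=> //; exact/negbTE.
case: noc; exists x, y, z; split=> //; suff -> : cyc3 x y z = d by case/setIP: dD.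
apply/permP=> t; have [xt|xt] := boolP (e x t).
  by rewrite -dE rsE ?bker_st ?Dker // inE.
rewrite (out_perm (cyc3_on (mem_cls ee x) _ _)) ?inE //.
have ty : t \in ys by rewrite mem_filter xt mem_enum.
by rewrite (rs_eq1P (bker_st t (Dker dD)) (d1 t ty)) // mem_cls.
Qed.

End Full.

Definition nontriv x := [exists u in K, (u != 1) && perm_on (cls e x) u].
Lemma nontrivP x : reflect (exists2 u, u \in K & u != 1 /\ perm_on (cls e x) u) (nontriv x).
Proof. by apply: (iffP exists_inP) => [[u uK /andP[]]|[u uK []]] ? ?; exists u => //; apply/andP. Qed.

Lemma on_J x k u : k \in K -> perm_on (cls e x) u -> perm_on (cls e (k x)) (u ^ k).
Proof. by move=> kK ux; rewrite -im_cls; [apply: perm_onJ|apply: K_inv]. Qed.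

Lemma nontriv_all x y : nontriv x -> nontriv y.
Proof.
case/nontrivP=> u uK [u1 ux]; have [k kK <-] := tK (in_setT x) (in_setT y).
apply/nontrivP; exists (u ^ k); first exact: groupJ.
by rewrite conjg_eq1; split=> //; apply: on_J.
Qed.

Lemma class_pair x : exists2 x', e x x' & x != x'.
Proof. by have [y [z [xy _ [xny _ _]]]] := ex3 x; exists y. Qed.

Lemma dt_bker x x' y y' : e x x' -> e y y' -> x != x' -> y != y' -> tperm x x' * tperm y y' \in bker.
Proof.
move=> xx yy nx ny; apply/bkerP; split; first by rewrite evG // odd_permM !odd_tperm nx ny.
have inc a b t : e a b -> e t (tperm a b t).
  by move=> ab; case: tpermP => [->|->|_ _] //; rewrite ?eqv_refl // eqv_sym.
by move=> t; rewrite permM; apply: (eqv_trans ee (inc x x' t xx) (inc _ _ _ yy)).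
Qed.

(** Lifting signs by [sgn_lift], a transposition in the class of [x], if [G] has odd elements, or
    one balanced in a third class, would separate the signs on two classes, against
    [full_no_indep]. *)
Lemma full_two : full -> alt /\ (forall x y z, ~~ e x y -> e x z || e y z).
Proof.
move=> fl; split.
  have [x _] := nall; have [y xy ny] := full_no_indep fl x; have [x' xx xn] := class_pair x.
  apply/negPn/negP => /negbTE na; apply: ny.
  have on : perm_on (cls e x) (tperm x x') by apply: tperm_on; rewrite !inE ?eqv_refl.
  have tk : tperm x x' \in bker by apply: (on_bker on); rewrite hG na.
  have [d dD dw] := sgn_lift tk; exists d => //; rewrite !dw sgn_on // odd_tperm xn; split=> //.
  by apply: (sgn_off _ on); rewrite eqv_sym.
move=> x b c xb; apply/negPn/negP; rewrite negb_or => /andP[xc bc].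
have [y xy ny] := full_no_indep fl x; have [x' xx xn] := class_pair x.
have [z xz yz] : exists2 z, ~~ e x z & ~~ e y z.
  have [yb|yb] := boolP (e y b); last by exists b.
  by exists c; rewrite // (eqv_congr ee yb).
have [z' zz zn] := class_pair z; apply: ny.
have on : perm_on (cls e x) (tperm x x') by apply: tperm_on; rewrite !inE ?eqv_refl.
have onz : perm_on (cls e z) (tperm z z') by apply: tperm_on; rewrite !inE ?eqv_refl.
have [d dD dw] := sgn_lift (dt_bker xx zz xn zn); exists d => //; rewrite !dw.
have split_sgn t : sgn t (tperm x x' * tperm z z') = sgn t (tperm x x') (+) sgn t (tperm z z').
  have st a (X : {set T}) : perm_on X a -> (X = cls e x) \/ (X = cls e z) -> a @: cls e t = cls e t.
    move=> aX h; rewrite im_cls; last first.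
      by apply: in_pres => // s; case: h aX => -> aX; apply: (perm_on_in ee _ aX).
    by apply/esym/(cls_eq ee); case: h aX => -> aX; apply: (perm_on_in ee _ aX).
  rewrite /sgn rsM ?odd_permM //; first by apply: (st _ _ on); left.
  by apply: (st _ _ onz); right.
rewrite !split_sgn !(sgn_on on) (sgn_off xz onz) (sgn_off yz onz) odd_tperm xn.
by rewrite (sgn_off _ on) // eqv_sym.
Qed.

(** Suppose that only 1 is supported on a class and that restrictions stay in [K]. A kernel element
    even on a class is then trivial there, so the orbits of [D] have at most two points and form a
    [K]-invariant pairing. By [lemmaO] a double transposition inside one class lies in [K], a
    contradiction. *)
Lemma nontriv_or : (forall x, nontriv x) \/
  [/\ alt, (forall x y z, ~~ e x y -> e x z || e y z), full &
      forall x u, u \in K -> perm_on (cls e x) u -> u = 1].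
Proof.
have [x0 [y0 xy0]] := nall.
have [n0|n0] := boolP (nontriv x0); first by left=> x; apply: nontriv_all n0.
right; have noN x u : u \in K -> perm_on (cls e x) u -> u = 1.
  move=> uK ux; apply/eqP; apply: contraNT n0 => u1; apply: (@nontriv_all x).
  by apply/nontrivP; exists u.
case: K_cases => [hA|fl]; last by have [? ?] := full_two fl.
have [x' xx xn] := class_pair x0; have [y' yy yn] := class_pair y0.
have r1 x d : d \in D -> ~~ sgn x d -> restr_perm (cls e x) d = 1.
  by move=> dD sd; apply: (noN x); [apply: hA => //; rewrite evG|apply: rs_on].
have [d0 d0D d0s] := sgn_lift (dt_bker xx yy xn yn).
have on : perm_on (cls e x0) (tperm x0 x') by apply: tperm_on; rewrite !inE ?eqv_refl.
have ony : perm_on (cls e y0) (tperm y0 y') by apply: tperm_on; rewrite !inE ?eqv_refl.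
have s0 : sgn x0 d0.
  rewrite d0s /sgn (@rs_eq _ _ _ (tperm x0 x')).
  - by rewrite rs_id // odd_tperm.
  - by rewrite bker_st // dt_bker.
  - exact: im_perm_on.
  move=> t tx; rewrite permM (out_perm ony) //.
  by rewrite -(perm_closed _ on) in tx; rewrite (disjointFr (cls_disj ee xy0)).
exfalso; have [altE|altE] := boolP alt; last first.
  have e1 : restr_perm (cls e x0) d0 = 1.
    by apply: (noN x0); [apply: hA => //; rewrite hG (negPf altE)|apply: rs_on].
  by move: s0; rewrite /sgn e1 odd_perm1.
have Dk := Dker.
pose f u v := [exists d in D, d u == v].
have fP u v : reflect (exists2 d, d \in D & d u = v) (f u v).
  by apply: (iffP exists_inP) => -[d dD] /eqP; exists d => //; apply/eqP.
have fe u v : f u v -> e u v by case/fP=> d /Dk/bkerP[_ /(_ u)] h <-.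
have ff : equivalence_rel f.
  apply: eqrelP.
  - by move=> u; apply/fP; exists 1; rewrite ?group1 ?perm1.
  - by move=> u v; apply/fP/fP => -[d dD <-]; exists d^-1; rewrite ?groupV ?permK.
  - by move=> v u w /fP[d dD <-] /fP[d' dD' <-]; apply/fP; exists (d * d'); rewrite ?groupM ?permM.
have fK : einv K f.
  move=> k kK u v; apply/fP/fP => -[d dD].
    move=> h; exists (d ^ k^-1); last by rewrite -{1}(permK k u) permJ h permK.
    by rewrite memJ_norm // (subsetP D_norm) // groupV.
  by move=> <-; exists (d ^ k); rewrite ?permJ // memJ_norm // (subsetP D_norm).
have rsu u d : d \in D -> restr_perm (cls e u) d u = d u.
  by move=> dD; rewrite rsE ?bker_st ?Dk // mem_cls.
have uniq2 u v w : f u v -> f u w -> v != u -> w != u -> v = w.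
  move=> /fP[d dD dv] /fP[d' dD' dw] vu wu.
  have s1 g : g \in D -> g u != u -> sgn u g.
    by move=> gD; apply: contraNT => /(r1 u _ gD) e1; rewrite -(rsu u) // e1 perm1.
  have : restr_perm (cls e u) (d * d'^-1) = 1.
    by apply: r1; rewrite ?groupM ?groupV // sgnM ?sgnV ?groupV ?Dk // !s1 ?dv ?dw.
  rewrite rsM ?rsV ?bker_st ?groupV ?Dk // => /eqP; rewrite -eq_mulgV1 => /eqP e1.
  by rewrite -dv -dw -(rsu u d) // -(rsu u d') // e1.
have mv : exists u v, u != v /\ f u v.
  have [t dt] : exists t, d0 t != t.
    apply/existsP; apply: contraLR s0; rewrite negb_exists => /forallP h.
    by rewrite /sgn rs_eq1 ?odd_perm1 // => t _; apply/eqP; move: (h t); rewrite negbK.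
  by exists t, (d0 t); rewrite eq_sym; split=> //; apply/fP; exists d0.
have partner u : exists2 v, u != v & f u v.
  have [a [b [ab fab]]] := mv; have [k kK <-] := tK (in_setT a) (in_setT u).
  by exists (k b); rewrite ?(inj_eq perm_inj) ?fK.
have [u [v [uv fuv]]] := mv.
have [z uz] := cls_avoid (S := [:: u; v]) (a3 u); rewrite !inE negb_or => /andP[zu zv].
have [w zw fzw] := partner z.
have fuz : ~~ f u z by apply: contra zv => fuz; apply/eqP; apply: (uniq2 u) => //; rewrite eq_sym.
have gM := subsetP bkerM _ (dt_bker (fe _ _ fuv) (fe _ _ fzw) uv zw).
have gK : tperm u v * tperm z w \in K.
  apply: (@lemmaO f) => //; first by exists u, z.
  apply: in_pres => // t; rewrite permM.
  have inc a b s : f a b -> f s (tperm a b s).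
    by move=> ab; case: tpermP => [->|->|_ _] //; [rewrite eqv_sym|rewrite eqv_refl].
  exact: (eqv_trans ff (inc u v t fuv) (inc _ _ _ fzw)).
have ew : e u w by apply: eqv_trans uz (fe _ _ fzw).
have := noN u _ gK; rewrite perm_onM ?tperm_on ?inE ?eqv_refl ?(fe _ _ fuv) // => /(_ isT)/permP/(_ u).
rewrite permM tpermL perm1 tpermD // => [e1|]; first by rewrite e1 eqxx in uv.
by apply: contra fuz => /eqP wv; rewrite wv in fzw; apply: (eqv_trans ff fuv); rewrite eqv_sym.
Qed.

Section Trans.
Hypothesis nt : forall x, nontriv x.
(** Orbits of the elements supported on a class form an invariant relation. Were it smaller than
    [e], [lemmaO] would put in [K] an element supported on one [e]-class and exchanging two of these
    orbits. *)
Lemma local_trans x u v : e x u -> e x v -> exists2 k, k \in K & perm_on (cls e x) k /\ k u = v.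
Proof.
pose f a b := [exists k in K, perm_on (cls e a) k && (k a == b)].
have fP a b : reflect (exists2 k, k \in K & perm_on (cls e a) k /\ k a = b) (f a b).
  apply: (iffP exists_inP) => [[k kK /andP[? /eqP ?]]|[k kK [? ?]]]; exists k => //.
  by apply/andP; split=> //; apply/eqP.
have fe a b : f a b -> e a b by case/fP=> k kK [ka <-]; apply: (perm_on_in ee _ ka).
have ff : equivalence_rel f.
  apply: eqrelP.
  - by move=> a; apply/fP; exists 1; rewrite ?group1 ?perm1 ?perm_on1.
  - suff h a b : f a b -> f b a by move=> a b; apply/idP/idP; apply: h.
    move=> fab; have eab := fe _ _ fab; move/fP: fab => [k kK [ka kb]]; apply/fP; exists k^-1; rewrite ?groupV //.
    by rewrite -(cls_eq ee eab) -kb permK; split=> //; apply: perm_onV.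
  - move=> b a c fab; have eab := fe _ _ fab; move/fP: fab => [k kK [ka kb]] /fP[k' kK' [kb' kc]].
    apply/fP; exists (k * k'); rewrite ?groupM // permM kb kc; split=> //.
    by apply: perm_onM => //; rewrite (cls_eq ee eab).
have fK : einv K f.
  have h k a b : k \in K -> f a b -> f (k a) (k b).
    move=> kK /fP[g gK [ga gb]]; apply/fP; exists (g ^ k); rewrite ?groupJ //.
    by rewrite permJ gb; split=> //; apply: on_J.
  move=> k kK a b; apply/idP/idP; last exact: h.
  by move/(h k^-1 _ _ (groupVr kK)); rewrite !permK.
move=> xu xv; suff : f u v.
  by case/fP=> k kK [ku kv]; exists k => //; rewrite (cls_eq ee xu).
have [//|nf] := boolP (f u v); exfalso.
have euv : e u v by rewrite -(eqv_congr ee xu).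
have gK : forall g, g \in M -> (forall a b, f (g a) (g b) = f a b) -> g \in K.
  apply: lemmaO => //; last by exists u, v.
  have /nontrivP[w wK [w1 wx]] := nt u.
  have [t wt] : exists t, w t != t.
    apply/existsP; apply: contraNT w1; rewrite negb_exists => /forallP h.
    by apply/eqP/permP=> t; rewrite perm1; apply/eqP; move: (h t); rewrite negbK.
  have eut : e u t by rewrite -[e u t](in_set (e u)); apply: (subsetP wx).
  exists t, (w t); split; first by rewrite eq_sym.
  by apply/fP; exists w => //; rewrite -(cls_eq ee eut).
have cf a b : #|cls f a| = #|cls f b|.
  have [k kK <-] := tK (in_setT a) (in_setT b); rewrite -(im_cls a (fK k kK)) im_card //.
have [u' uu' fu] : exists2 u', u != u' & f u u'.
  have /nontrivP[w wK [w1 wx]] := nt u.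
  have [t wt] : exists t, w t != t.
    apply/existsP; apply: contraNT w1; rewrite negb_exists => /forallP h.
    by apply/eqP/permP=> t; rewrite perm1; apply/eqP; move: (h t); rewrite negbK.
  have eut : e u t by rewrite -[e u t](in_set (e u)); apply: (subsetP wx).
  have ftw : f t (w t) by apply/fP; exists w => //; rewrite -(cls_eq ee eut).
  have [k kK kt] := tK (in_setT t) (in_setT u); exists (k (w t)).
    by rewrite -kt (inj_eq perm_inj) eq_sym.
  by rewrite -kt fK.
have sub : cls f u :|: cls f v \subset cls e u.
  rewrite subUset; apply/andP; split; apply/subsetP=> t; rewrite !inE => /fe //.
  exact: eqv_trans.
have [g [gG gon gf gAB _]] := swap_cls hG ff (cf u v) nf fu uu'.
have g_on := perm_on_sub sub gon.
have gu : g u \in cls f v by rewrite -gAB im_mem mem_cls.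
have gM : g \in M by apply: (subsetP bkerM); apply: (on_bker g_on).
have : f u (g u) by apply/fP; exists g; rewrite ?gK.
by move=> h; case/negP: nf; apply: (eqv_trans ff h); rewrite eqv_sym //; rewrite inE in gu.
Qed.
End Trans.

End LemmaN.

(** * Primitive overgroups *)

(** A largest invariant set of at most k points is completed by a segment of a cycle of [s], which
    loses only its first point under [s]. If the invariant set already has k points, a fixed point
    and a moved point on opposite sides of its boundary are exchanged; when [C] is a single cycle
    this case cannot occur. *)
Lemma shift_set (T : finType) (s : {perm T}) (C : {set T}) (c0 : T) k :
  s @: C = C -> 0 < k -> k < #|C| -> c0 \in C -> s c0 != c0 ->
  (exists2 f, f \in C & s f = f) \/ C \subset porbit s c0 ->
  exists A : {set T}, [/\ A \subset C, #|A| = k & #|A :&: s @: A| = k.-1].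
Proof.
move=> sC k0 kC c0C mc0 hyp.
have sI t : (s t \in C) = (t \in C) by rewrite -{1}sC im_mem.
suff [A AC [cA [c cE]]] : exists2 A : {set T}, A \subset C & #|A| = k /\ exists c, A :\: s @: A = [set c].
  exists A; split=> //; have := cardsID (s @: A) A; rewrite cE cards1 cA; lia.
pose P m := [exists S : {set T}, [&& S \subset C, s @: S == S, #|S| == m & m <= k]].
have P0 : exists m, P m.
  exists 0; apply/existsP; exists set0; by rewrite sub0set imset0 eqxx cards0 eqxx.
have Pk m : P m -> m <= k by case/existsP=> S /and4P[].
case: (ex_maxnP P0 Pk) => m /existsP[S /and4P[SC /eqP sS /eqP cS mk]] mmax.
have sSI t : (s t \in S) = (t \in S) by rewrite -{1}sS im_mem.
have [mE|mN] := eqVneq m k; last first.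
  have lt : m < k by rewrite ltn_neqAle mN.
  have [c] : exists c, c \in C :\: S.
    by apply/set0Pn; rewrite -card_gt0; have := cardsID S C; rewrite (setIidPr SC) cS; lia.
  rewrite inE => /andP[cNS cC].
  have orbS t i : ((s ^+ i) t \in S) = (t \in S).
    by elim: i => [|i IH]; rewrite ?expg0 ?perm1 // expgSr permM sSI.
  have orbC t i : ((s ^+ i) t \in C) = (t \in C).
    by elim: i => [|i IH]; rewrite ?expg0 ?perm1 // expgSr permM sI.
  have dSO : S :&: porbit s c = set0.
    apply/setP=> t; rewrite !inE; apply/negP=> /andP[tS /porbitP[i tE]].
    by rewrite tE orbS (negPf cNS) in tS.
  have OC : porbit s c \subset C by apply/subsetP=> t /porbitP[i ->]; rewrite orbC.
  have sO : s @: porbit s c = porbit s c.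
    apply/eqP; rewrite eqEcard im_card leqnn andbT; apply/subsetP=> _ /imsetP[t /porbitP[i ->] ->].
    by rewrite -permM -expgSr mem_porbit.
  have big : k < m + #|porbit s c|.
    rewrite ltnNge; apply/negP => le.
    have : P (m + #|porbit s c|).
      apply/existsP; exists (S :|: porbit s c); rewrite subUset SC OC imU sS sO eqxx le /=.
      by rewrite cardsU dSO cards0 cS subn0 eqxx.
    move/mmax; have : 0 < #|porbit s c| by rewrite card_gt0; apply/set0Pn; exists c; apply: porbit_id.
    by lia.
  pose j := k - m; pose A := S :|: [set t in traject s c j].
  have jO : j < #|porbit s c| by rewrite /j; lia.
  have trE : traject s c j = take j (traject s c #|porbit s c|) by rewrite take_traject // ltnW.
  have trU : uniq (traject s c j) by rewrite trE take_uniq // uniq_traject_porbit.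
  have trO : [set t in traject s c j] \subset porbit s c.
    by apply/subsetP=> t; rewrite inE trE => /mem_take; rewrite -porbit_traject.
  have dA : S :&: [set t in traject s c j] = set0.
    by apply/eqP; rewrite -subset0 -dSO setIS.
  exists A; first by rewrite subUset SC (subset_trans trO).
  split.
    by rewrite cardsU dA cards0 cardsE (card_uniqP trU) size_traject cS /j subn0 subnKC.
  exists c; apply/setP=> t; rewrite in_setD in_set1 imU sS !in_setU imP !in_set.
  have [tS|tS] /= := boolP (t \in S); first by apply/esym/negbTE; apply: contra cNS => /eqP <-.
  have trC l : l < #|porbit s c| -> (iter l s c == c) = (l == 0).
    move=> lO; have O0 : 0 < #|porbit s c| by exact: leq_ltn_trans lO.
    have := uniq_traject_porbit s c => /(nth_uniq c); rewrite size_traject => /(_ l 0 lO O0).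
    by rewrite !nth_traject.
  have [->|tc] := eqVneq t c.
    have cin : c \in traject s c j by apply/trajectP; exists 0; rewrite // /j subn_gt0.
    rewrite cin andbT; apply/negP => /trajectP[l li lE].
    have : iter l.+1 s c == c by rewrite iterS -lE permKV.
    by rewrite trC //; clear - li jO; lia.
  apply/negP=> /andP[h1 /trajectP[l li lE]]; case/negP: h1.
  case: l li lE => [|l] li lE; first by rewrite lE eqxx in tc.
  by rewrite lE iterS permK; apply/trajectP; exists l => //; apply: ltnW.
have [x1 x1S] : exists x, x \in S by apply/set0Pn; rewrite -card_gt0 cS mE.
have [x2] : exists x, x \in C :\: S.
  by apply/set0Pn; rewrite -card_gt0; have := cardsID S C; rewrite (setIidPr SC) cS; lia.
rewrite inE => /andP[x2S x2C].
case: hyp => [[f0 f0C ff0]|sub]; last first.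
  have /porbitP[i i1] := subsetP sub _ (subsetP SC _ x1S).
  have /porbitP[l l1] := subsetP sub _ x2C.
  have inS t i' : ((s ^+ i') t \in S) = (t \in S).
    by elim: i' => [|i' IH]; rewrite ?expg0 ?perm1 // expgSr permM sSI.
  by rewrite l1 inS -(inS c0 i) -i1 x1S in x2S.
have build f c : f \in C -> c \in C -> s f = f -> s c != c -> (f \in S) != (c \in S) ->
    exists2 A : {set T}, A \subset C & #|A| = k /\ exists c, A :\: s @: A = [set c].
  move=> fC cC ff mc; have [fS|fS] := boolP (f \in S) => cS'.
    have cS0 : c \notin S by case: (c \in S) cS'.
    have cS1 : c \notin S :\ f by rewrite inE (negPf cS0) andbF.
    exists (c |: (S :\ f)); first by rewrite subUset sub1set cC (subset_trans _ SC) ?subsetDl.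
    split; first by rewrite cardsU1 cS1 -mE -cS (cardsD1 f S) fS.
    exists c; apply/setP=> t; rewrite in_setD in_set1 imP !in_setU1 !in_setD1.
    have sV : (s^-1 t \in S) = (t \in S) by rewrite -{2}(permKV s t) sSI.
    have fV : (s^-1 t == f) = (t == f) by rewrite -(inj_eq (@perm_inj _ s)) permKV ff.
    rewrite sV fV; have [->|tc] := eqVneq t c.
      by rewrite (negPf cS0) !andbF !orbF andbT; apply: contra mc => /eqP e1; rewrite -{1}e1 permKV.
    by case: ((t != f) && (t \in S)); rewrite ?orbT ?andbF.
  have cS0 : c \in S by case: (c \in S) cS'.
  have fS1 : f \notin S :\ c by rewrite inE (negPf fS) andbF.
  exists (f |: (S :\ c)); first by rewrite subUset sub1set fC (subset_trans _ SC) ?subsetDl.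
  split; first by rewrite cardsU1 fS1 -mE -cS (cardsD1 c S) cS0.
  exists (s c); apply/setP=> t; rewrite in_setD in_set1 imP !in_setU1 !in_setD1.
  have sV : (s^-1 t \in S) = (t \in S) by rewrite -{2}(permKV s t) sSI.
  have fV : (s^-1 t == f) = (t == f) by rewrite -(inj_eq (@perm_inj _ s)) permKV ff.
  have cV : (s^-1 t == c) = (t == s c) by rewrite -(inj_eq (@perm_inj _ s)) permKV.
  rewrite sV fV cV; have [->|tc] := eqVneq t (s c).
    rewrite mc sSI cS0 /= orbF orbT andbT.
    by apply: contra fS => /eqP <-; rewrite sSI.
  by rewrite /=; case: (t == f); case: (t \in S); rewrite ?orbT ?andbF.
have [/existsP[f /andP[fC /eqP ff]]|nof] := boolP [exists f, (f \in C) && (s f == f)]; last first.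
  by case/existsP: nof; exists f0; rewrite f0C ff0 eqxx.
have [e1|e1] := eqVneq (f0 \in S) (c0 \in S); last exact: build e1.
have [m1|m1] := eqVneq (s x1) x1.
  have [m2|m2] := eqVneq (s x2) x2.
    have [e2|e2] := eqVneq (x1 \in S) (c0 \in S); last by apply: (build x1 c0) => //; apply: (subsetP SC).
    by apply: (build x2 c0) => //; rewrite -e2 x1S (negPf x2S).
  by apply: (build x1 x2) => //; [apply: (subsetP SC)|rewrite x1S (negPf x2S)].
have [m2|m2] := eqVneq (s x2) x2.
  by apply: (build x2 x1) => //; [apply: (subsetP SC)|rewrite x1S (negPf x2S)].
have [f0S|f0S] := boolP (f0 \in S).
  by apply: (build f0 x2) => //; rewrite f0S (negPf x2S).
by apply: (build f0 x1) => //; [apply: (subsetP SC)|rewrite x1S (negPf f0S)].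
Qed.

(** * A primitive overgroup of K without 3-cycles *)

Section Primitive.
Variables (T : finType) (alt : bool) (G : {group {perm T}}) (e : rel T) (K : {group {perm T}}).
Implicit Types (x y z t : T) (g h d : {perm T}).
Hypothesis hG : forall g, (g \in G) = ~~ (alt && odd_perm g).
Hypothesis ee : equivalence_rel e.
Let M := rstab G e.
Hypotheses (KM : K \subset M) (tK : ptrans K setT).
Hypothesis mx : forall L : {group {perm T}}, K \subset L -> L \subset M -> L \subset K \/ M \subset L.
Hypothesis a3 : forall x, 2 < #|cls e x|.
Hypothesis nall : exists x y, ~~ e x y.
Variable P : {group {perm T}}.
Hypotheses (KP : K \subset P) (pP : prim P) (noP : ~ has_cyc3 P).
Hypothesis nt : forall x, nontriv e K x.

Let noc : ~ has_cyc3 K.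
Proof. by move=> [x [y [z [xy xz yz c]]]]; apply: noP; exists x, y, z; split=> //; apply: (subsetP KP). Qed.
Let kinv := K_inv KM.
Let lt := local_trans hG ee KM tK mx nt.

Lemma card_cls x y : #|cls e x| = #|cls e y|.
Proof. by have [k kK <-] := tK (in_setT x) (in_setT y); rewrite -(im_cls x (kinv kK)) im_card. Qed.

Lemma two_cls x : #|cls e x|.*2 <= #|T|.
Proof.
have [y xy] := other ee nall x; have := cls_disj ee xy; rewrite -setI_eq0 => /eqP d0.
have := cardsUI (cls e x) (cls e y); rewrite d0 cards0 addn0 -(card_cls x) addnn => <-; exact: max_card.
Qed.

(** By [local_trans] the class of [x] is a Jordan set of [P], and [s] acting on its complement feeds
    [shift_set]; [jordan_cyc3] then gives a 3-cycle. *)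
Lemma no_shift x y s : ~~ e x y -> s \in K -> (forall t, e x t -> s t = t) -> s y != y ->
  (exists2 f, ~~ e x f & s f = f) \/ (forall t, ~~ e x t -> t \in porbit s y) -> False.
Proof.
move=> xy sK sx sy hyp; apply: noP.
have fixX t : t \in cls e x -> s t = t by rewrite inE; apply: sx.
apply: (@jordan_cyc3 _ P (cls e x)) => //.
- by move=> u v _ _; have [k kK <-] := tK (in_setT u) (in_setT v); exists k => //; apply: (subsetP KP).
- move=> u v; rewrite !inE => xu xv; have [k kK [kx kv]] := lt xu xv; exists k => //; exact: (subsetP KP).
- exact: ltnW (a3 x).
- exact: two_cls.
move=> k k0 kx; have sC : s @: (~: cls e x) = ~: cls e x by rewrite imC im_fix.
case: (@shift_set T s (~: cls e x) y k sC k0) => //.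
- by have := cardsC (cls e x); have := two_cls x; lia.
- by rewrite !inE.
- case: hyp => [[f xf ff]|hyp]; [left; exists f|right] => //; first by rewrite !inE.
  by apply/subsetP=> t; rewrite !inE; apply: hyp.
by move=> A [AC cA cAs]; exists A, s; [apply: (subsetP KP)|split].
Qed.

(** An element supported on one class fixes a third class pointwise, which is the fixed point
    excluded by [no_shift]. *)
Lemma prim_two x y z : ~~ e x y -> e x z || e y z.
Proof.
move=> xy; apply/negPn/negP; rewrite negb_or => /andP[xz yz].
have /nontrivP[s sK [s1 sy]] := nt y.
have [t st] : exists t, s t != t.
  apply/existsP; apply: contraNT s1; rewrite negb_exists => /forallP h.
  by apply/eqP/permP=> t; rewrite perm1; apply/eqP; move: (h t); rewrite negbK.
have yt : e y t by rewrite -[e y t](in_set (e y)); apply: (subsetP sy).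
apply: (@no_shift x t s) => //.
- by apply: contra xy => xt; apply: (eqv_trans ee xt); rewrite eqv_sym.
- by move=> u xu; apply: (out_perm sy); rewrite inE; apply: contra xy => yu; apply: (eqv_trans ee xu); rewrite eqv_sym.
by left; exists z => //; apply: (out_perm sy); rewrite inE.
Qed.

(** Seen from another class, taken as the Jordan set, [t] is a fixed point in the complement, so
    [no_shift] applies. *)
Lemma prim_semireg x s t : s \in K -> perm_on (cls e x) s -> e x t -> s t = t -> s = 1.
Proof.
move=> sK sx xt st; apply/eqP/negPn/negP => s1.
have [y xy] := other ee nall x.
have [u su] : exists t, s t != t.
  apply/existsP; apply: contraNT s1; rewrite negb_exists => /forallP h.
  by apply/eqP/permP=> u; rewrite perm1; apply/eqP; move: (h u); rewrite negbK.
have xu : e x u by rewrite -[e x u](in_set (e x)); apply: (subsetP sx).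
have off v : e y v -> ~~ e x v by move=> yv; apply: contra xy => xv; apply: (eqv_trans ee xv); rewrite eqv_sym.
have off' v : e x v -> ~~ e y v by move=> xv; apply/negP => /off; rewrite xv.
apply: (@no_shift y u s) => //; first exact: off'.
  by move=> v yv; apply: (out_perm sx); rewrite inE off.
by left; exists t => //; apply: off'.
Qed.

Lemma card_cls_ge x (S : seq T) : uniq S -> all (e x) S -> size S <= #|cls e x|.
Proof.
move=> /card_uniqP <- /allP h; apply: subset_leq_card; apply/subsetP=> t /h.
by rewrite inE.
Qed.

(** The commutator of [u] with a lift of a transposition moves at most four points; in a class of
    five or more it would be 1 by semiregularity. In a class of three, [u] itself would be a
    3-cycle. *)
Lemma nontriv_full_alt4 : full G e K -> alt && [forall x, #|cls e x| == 4].
Proof.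
move=> fl; have [-> _] := full_two hG ee KM mx a3 nall noc fl; apply/forallP=> x.
have [y xy xny] := class_pair a3 x; have [u uK [ux uxy]] := lt (eqv_refl ee x) xy.
have uxx : u x != x by rewrite uxy eq_sym.
have xux : e x (u x) by rewrite uxy.
have u1 : u != 1 by apply: contra uxx => /eqP ->; rewrite perm1.
have uB t : e x t -> e x (u t).
  by move=> xt; apply: (eqv_trans ee xt); apply: (perm_on_in ee _ ux).
have le4 : #|cls e x| <= 4.
  rewrite leqNgt; apply/negP => lt4.
  have [z xz] := cls_avoid (S := [:: x; u x]) (a3 x); rewrite !inE negb_or => /andP[zx zu].
  have tz : perm_on (cls e x) (tperm x z) by apply: tperm_on; rewrite inE ?eqv_refl.
  have [d /setIP[dK dk] dE] := fl x _ tz.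
  have cE : [~ u, d] = tperm (u x) (u z) * tperm x z.
    have c_on : perm_on (cls e x) [~ u, d].
      rewrite perm_onM ?perm_onV //; have /(bkerP _ ee)[_ /(_ x)] := dk; move/(cls_eq ee) => ->.
      exact: (on_J KM).
    have := rsR (im_perm_on ux) (bker_st ee x dk).
    by rewrite (rs_id c_on) dE (rs_id ux) => ->; rewrite commgEr tpermV tpermJ.
  have [p xp] := cls_avoid (S := [:: x; z; u x; u z]) lt4; rewrite !inE !negb_or => /and4P[px pz pux puz].
  have c1 : [~ u, d] = 1.
    apply: (@prim_semireg x _ p); rewrite ?groupR //.
      by rewrite cE; apply: perm_onM => //; apply: tperm_on; rewrite inE //; apply: uB.
    by rewrite cE permM !tpermD; try neq.
  have /permP/(_ (u x)) := c1; rewrite cE permM tpermL perm1.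
  have [->|n1] := eqVneq (u z) x; first by rewrite tpermL => zE; rewrite zE eqxx in zu.
  have [->|n2] := eqVneq (u z) z; first by rewrite tpermR => /esym/eqP; rewrite (negPf uxx).
  by rewrite tpermD ; [move/perm_inj/eqP; rewrite (negPf zx)|neq|neq].
rewrite eqn_leq le4 /= ltnNge; apply/negP => le3.
have c3 : #|cls e x| = 3 by apply/eqP; rewrite eqn_leq le3 a3.
have [w xw] := cls_avoid (S := [:: x; u x]) (a3 x); rewrite !inE negb_or => /andP[wx wu].
have cE : [set x; u x; w] = cls e x.
  apply/eqP; rewrite eqEcard c3; apply/andP; split.
    by apply/subsetP=> t; rewrite !inE => /orP[/orP[]|] /eqP-> //; apply: eqv_refl.
  rewrite -setUA cardsU1 cards2 !inE (eq_sym x) (negPf uxx) (eq_sym x) (negPf wx) /=.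
  by rewrite eq_sym wu.
have inc t : e x t -> [\/ t = x, t = u x | t = w].
  move=> xt; have : t \in cls e x by rewrite inE.
  by rewrite -cE !inE => /orP[/orP[]|] /eqP; [constructor 1|constructor 2|constructor 3].
have uux : u (u x) = w.
  have := inc _ (uB _ xux); case=> // [e1|/perm_inj/eqP]; last by rewrite (negPf uxx).
  have : u w = w.
    have := inc _ (uB _ xw); case=> // [e2|/perm_inj/eqP]; last by rewrite (negPf wx).
    by have /perm_inj/eqP : u (u x) = u w; [rewrite e1 e2|rewrite eq_sym (negPf wu)].
  by move/(prim_semireg uK ux xw)/eqP; rewrite (negPf u1).
have uw : u w = x.
  have := inc _ (uB _ xw); case=> // [/perm_inj/eqP|]; first by rewrite (negPf wx).
  by rewrite -{2}uux => /perm_inj/eqP; rewrite (negPf wu).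
apply: noc; exists x, (u x), w; split; try by rewrite eq_sym.
rewrite (_ : cyc3 _ _ _ = u) //; apply/permP=> t; rewrite cyc3E; try by rewrite eq_sym.
have [->//|tx] := eqVneq t x; have [->//|tux] := eqVneq t (u x); have [->//|tw] := eqVneq t w.
apply/esym/(out_perm ux); rewrite -cE !inE; neq.
Qed.

(** By [lemmaO] all elements of [G] preserving each [f]-class are in [K]. The absence of 3-cycles
    makes the [f]-classes pairs; semiregularity then forbids a transposition, and allows a double
    transposition only when it fills the class. *)
Lemma nontriv_rel_alt4 (f : rel T) : equivalence_rel f -> einv K f -> (forall x y, f x y -> e x y) ->
  (exists x y, x != y /\ f x y) -> (exists x y, e x y /\ ~~ f x y) ->
  alt && [forall x, #|cls e x| == 4].
Proof.
move=> ff fK fe f1 f2.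
have inK g : g \in G -> (forall t, f t (g t)) -> g \in K.
  move=> gG gt; apply: (lemmaO hG ee KM tK mx ff fK fe f1 f2); last exact: in_pres.
  by apply/rstabP; split=> //; apply: in_pres => // t; apply: fe.
have inc a b t : f a b -> f t (tperm a b t).
  by move=> ab; case: tpermP => [->|->|_ _] //; [rewrite eqv_sym|rewrite eqv_refl].
have ev g : ~~ odd_perm g -> g \in G by move=> h; rewrite hG negb_and h orbT.
have uniq2 u v w : f u v -> f u w -> v != u -> w != u -> v = w.
  move=> uv uw vu wu; apply/eqP/negPn/negP=> vw; apply: noc; exists u, v, w; split; rewrite // 1?eq_sym //.
  apply: inK; first by rewrite ev // odd_cyc3 // eq_sym.
  move=> t; rewrite permM; exact: (eqv_trans ff (inc u v t uv) (inc _ _ _ uw)).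
have partner u : exists2 v, u != v & f u v.
  have [a [b [ab fab]]] := f1; have [k kK <-] := tK (in_setT a) (in_setT u).
  by exists (k b); rewrite ?(inj_eq perm_inj) ?fK.
have main x : alt /\ #|cls e x| = 4.
  have [v xv fxv] := partner x.
  have [z xz] := cls_avoid (S := [:: x; v]) (a3 x); rewrite !inE negb_or => /andP[zx zv].
  have [altE|altE] := boolP alt; last first.
    have tKK : tperm x v \in K.
      by apply: inK => [|t]; [rewrite hG (negPf altE)|apply: inc].
    have : tperm x v = 1.
      apply: (@prim_semireg x _ z) => //; first by apply: tperm_on; rewrite inE ?eqv_refl ?fe.
      by rewrite tpermD //; neq.
    by move/permP/(_ x)/eqP; rewrite tpermL perm1 eq_sym (negPf xv).
  have [w zw fzw] := partner z.
  have exw : e x w by apply: eqv_trans xz (fe _ _ fzw).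
  have wx : w != x.
    by apply: contra zv => /eqP wx; rewrite wx eqv_sym // in fzw; apply/eqP; apply: (uniq2 x); rewrite // eq_sym.
  have wv : w != v.
    apply: contra zx => /eqP wv; rewrite wv eqv_sym // in fzw; apply/eqP; apply: (uniq2 v) => //.
    by rewrite eqv_sym.
  split=> //; apply/eqP; rewrite eqn_leq; apply/andP; split; last first.
    apply: (@card_cls_ge x [:: x; v; z; w]) => /=; last by rewrite eqv_refl // fe // xz exw.
    by rewrite !inE !negb_or xv !(eq_sym x) zx wx !(eq_sym v) zv wv zw.
  rewrite leqNgt; apply/negP => lt4.
  have [p xp] := cls_avoid (S := [:: x; v; z; w]) lt4; rewrite !inE !negb_or => /and4P[px pv pz pw].
  have gK : tperm x v * tperm z w \in K.
    apply: inK; first by rewrite ev // odd_permM !odd_tperm xv zw.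
    by move=> t; rewrite permM; exact: (eqv_trans ff (inc x v t fxv) (inc _ _ _ fzw)).
  have : tperm x v * tperm z w = 1.
    apply: (@prim_semireg x _ p) => //; first by apply: perm_onM; apply: tperm_on; rewrite inE ?eqv_refl //; apply: fe.
    by rewrite permM !tpermD; try neq.
  move/permP/(_ x)/eqP; rewrite permM tpermL tpermD ?perm1; neq.
have [x0 _] := nall; have [-> _] := main x0; apply/forallP=> x; have [_ ->] := main x; exact: eqxx.
Qed.

Section Block.
Variables (x : T) (L : {group {perm T}}).
Hypotheses (LK : L \subset K) (SL : forall k, k \in K -> k x = x -> k \in L).
(** The block system attached to a subgroup [L] between the stabilizer of [x] and [K]: its block at
    [x] is the [L]-orbit of [x]. *)
Definition blk u v := [exists k in K, (k u == x) && [exists l in L, l x == k v]].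
Lemma blkP u v : reflect (exists2 k, k \in K & k u = x /\ exists2 l, l \in L & l x = k v) (blk u v).
Proof.
apply: (iffP exists_inP) => [[k kK /andP[/eqP ku /exists_inP[l lL /eqP lx]]]|[k kK [ku [l lL lx]]]]; exists k => //.
  by split=> //; exists l.
by rewrite ku eqxx /=; apply/exists_inP; exists l => //; apply/eqP.
Qed.
Lemma blk_eqv : equivalence_rel blk.
Proof.
have inLK l : l \in L -> l \in K by apply: (subsetP LK).
apply: eqrelP.
- move=> u; have [k kK ku] := tK (in_setT u) (in_setT x); apply/blkP; exists k => //; split=> //.
  by exists 1; rewrite ?group1 ?perm1.
- suff h u v : blk u v -> blk v u by move=> u v; apply/idP/idP; apply: h.
  case/blkP=> k kK [ku [l lL lx]]; apply/blkP; exists (k * l^-1); first by rewrite groupM ?groupV // inLK.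
  rewrite !permM -lx permK ku; split=> //; exists l^-1; by rewrite ?groupV.
- move=> v u w /blkP[k kK [ku [l lL lx]]] /blkP[k' kK' [kv [l' lL' lx']]].
  apply/blkP; exists k => //; split=> //.
  have mL : k'^-1 * k * l^-1 \in L.
    apply: SL; first by rewrite !groupM ?groupV // inLK.
    by rewrite !permM -kv permK -lx permK.
  exists (l' * (k'^-1 * k * l^-1) * l); first by rewrite groupM // groupM.
  by rewrite !permM lx' permK permKV.
Qed.
Lemma blk_inv : einv K blk.
Proof.
have h g u v : g \in K -> blk u v -> blk (g u) (g v).
  move=> gK /blkP[k kK [ku kv]]; apply/blkP; exists (g^-1 * k); first by rewrite groupM ?groupV.
  by rewrite !permM !permK.
move=> g gK u v; apply/idP/idP; last exact: h.
by move/(h g^-1 _ _ (groupVr gK)); rewrite !permK.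
Qed.
Lemma blk_x y : blk x y -> exists2 l, l \in L & l x = y.
Proof.
case/blkP=> k kK [kx [l lL lx]]; exists (l * k^-1); last by rewrite permM lx permK.
by rewrite groupM // groupV SL.
Qed.
Lemma blk_l l : l \in L -> blk x (l x).
Proof. by move=> lL; apply/blkP; exists 1; rewrite ?group1 ?perm1 //; split=> //; exists l; rewrite ?perm1. Qed.
End Block.

(** The stabilizer [S] of [x] induces at most one nontrivial permutation on the class ([H1], [H2]),
    and a group between [S] and the kernel fixes [x] or is transitive on the class ([H3]). Elements
    of [S] centralize or invert each [s] supported on the class ([H4]), so [S] normalizes [<[s]>].
    The product is transitive while [S] fixes [x]: thus [s] is one cycle on the class, which
    [no_shift] excludes. *)
Lemma nontriv_alt4 : alt && [forall x, #|cls e x| == 4].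
Proof.
apply/negPn/negP => nQ.
case: (K_cases hG ee KM mx a3 nall) => [hA|/nontriv_full_alt4]; last by rewrite (negPf nQ).
have [x _] := nall.
pose S := [set k in K | k x == x].
have SE k : (k \in S) = (k \in K) && (k x == x) by rewrite in_set.
have Sg : group_set S.
  apply/group_setP; split; first by rewrite SE group1 perm1 eqxx.
  by move=> g h; rewrite !SE => /andP[gK /eqP gx] /andP[hK /eqP hx]; rewrite groupM //= permM gx hx.
have KG k : k \in K -> k \in G by move/(subsetP KM)/rstabP => [].
have Sk d : d \in S -> d \in bker G e.
  rewrite SE => /andP[dK /eqP dx]; apply/(bkerP _ ee); split; [exact: KG|move=> t].
  have := kinv dK x t; rewrite dx; have [xt|xt] := boolP (e x t) => xdt.
    by apply: (eqv_trans ee _ xdt); rewrite eqv_sym.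
  by have := prim_two t (negbT xdt); rewrite (negPf xt) /= eqv_sym.
have SK d : d \in S -> d \in K by rewrite SE => /andP[].
have Sx d : d \in S -> d x = x by rewrite SE => /andP[_ /eqP].
have SD d : d \in S -> d \in K :&: bker G e by move=> dS; rewrite in_setI SK ?Sk.
have st d : d \in S -> d @: cls e x = cls e x by move=> dS; apply: bker_st (Sk _ dS).
have H1 d : d \in S -> restr_perm (cls e x) d \in G -> restr_perm (cls e x) d = 1.
  move=> dS rG; apply: (@prim_semireg x _ x); rewrite ?eqv_refl ?rs_on ?hA ?SD //.
  by rewrite (rsE (st _ dS)) ?Sx // mem_cls.
have H2 d d' : d \in S -> d' \in S -> restr_perm (cls e x) d != 1 -> restr_perm (cls e x) d' != 1 ->
    restr_perm (cls e x) d = restr_perm (cls e x) d'.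
  move=> dS dS' d1 d1'.
  have o c : c \in S -> restr_perm (cls e x) c != 1 -> alt && odd_perm (restr_perm (cls e x) c).
    by move=> cS; apply: contraNT => nG; rewrite (H1 c cS) // hG.
  have /eqP : restr_perm (cls e x) (d * d'^-1) = 1.
    have dd : d * d'^-1 \in S by rewrite (groupM (G := group Sg)) ?(groupV (group Sg)).
    apply: H1 => //; rewrite rsM ?rsV ?(st _ dS) ?(st _ dS') ?(st _ (groupVr (G := group Sg) dS')) // hG odd_permM odd_permV.
    by have /andP[-> ->] := o _ dS d1; have /andP[_ ->] := o _ dS' d1'.
  by rewrite rsM ?rsV ?(st _ dS) ?(st _ dS') ?(st _ (groupVr (G := group Sg) dS')) // -eq_mulgV1 => /eqP.
have H3 (L : {group {perm T}}) : S \subset L -> L \subset K :&: bker G e ->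
    (forall l, l \in L -> l x = x) \/ (forall y, e x y -> exists2 l, l \in L & l x = y).
  move=> /subsetP SL LD; have LK : L \subset K := subset_trans LD (subsetIl _ _).
  have SL' k : k \in K -> k x = x -> k \in L by move=> kK kx; apply: SL; rewrite SE kK kx eqxx.
  have [/forall_inP h|] := boolP [forall l in L, l x == x]; first by left=> l /h/eqP.
  case/forall_inPn=> l lL lx; right=> y xy.
  have [byx|nb] := boolP (blk x L x y); first exact: (blk_x SL' byx).
  exfalso; case/negP: nQ; apply: (nontriv_rel_alt4 (blk_eqv LK SL') (blk_inv x L)); last by exists x, y.
    move=> u v /blkP[k kK [ku [l' lL' lx']]].
    have /(bkerP _ ee)[_ /(_ x)] : l' \in bker G e by have /setIP[] := subsetP LD _ lL'.
    by rewrite lx' -ku kinv.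
  by exists x, (l x); rewrite eq_sym; split=> //; apply: blk_l.
have conjE s d : d \in S -> perm_on (cls e x) s -> s ^ d = s ^ restr_perm (cls e x) d.
  move=> dS sx; have on : perm_on (cls e x) (s ^ d) by rewrite -(st d dS); apply: perm_onJ.
  have sdV := st _ (groupVr (G := group Sg) dS).
  have sI : s @: cls e x = cls e x by apply: im_perm_on.
  have sdI : (s * d) @: cls e x = cls e x by rewrite imM sI st.
  by rewrite -(rs_id on) /conjg (rsM sdV sdI) (rsM sI (st _ dS)) (rsV (st _ dS)) (rs_id sx).
have H4 s d : s \in K -> perm_on (cls e x) s -> d \in S -> s ^ d = s \/ s ^ d = s^-1.
  move=> sK sx dS; have [r1|r1] := eqVneq (restr_perm (cls e x) d) 1.
    by left; rewrite conjE // r1 conjg1.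
  set t := restr_perm (cls e x) d in r1.
  have dd : d * d \in S by rewrite (groupM (G := group Sg)).
  have r2 : restr_perm (cls e x) (d * d) = 1.
    by apply: H1 => //; rewrite rsM ?st // hG odd_permM addbb andbF.
  (* The centralizer of [t] contains [S] by [H2]. If it is transitive on the class, [t] fixes every
     point because it fixes [x]; otherwise [t] commutes with no nontrivial element supported on the
     class. *)
  pose L := [set g in K :&: bker G e | restr_perm (cls e x) g * t == t * restr_perm (cls e x) g].
  have LE g : (g \in L) = (g \in K :&: bker G e) && (restr_perm (cls e x) g * t == t * restr_perm (cls e x) g) by rewrite in_set.
  have Lg : group_set L.
    apply/group_setP; split.
      rewrite LE (_ : restr_perm _ 1 = 1); last by apply: rs_eq1 => y _; rewrite perm1.
      by rewrite mul1g mulg1 eqxx in_setI group1 (group1 (bker_group G ee)).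
    move=> g h; rewrite !LE !in_setI => /andP[/andP[gK gk] /eqP gt] /andP[/andP[hK hk] /eqP ht].
    rewrite groupM //= (groupM (G := bker_group G ee)) //= (rsM (bker_st ee x gk) (bker_st ee x hk)).
    by rewrite -mulgA ht mulgA gt mulgA.
  have SL : S \subset L.
    apply/subsetP=> c cS; rewrite LE SD //=; have [->|c1] := eqVneq (restr_perm (cls e x) c) 1.
      by rewrite mul1g mulg1.
    by rewrite (H2 c d).
  case: (H3 (group Lg) SL) => /=; first by apply/subsetP=> g; rewrite LE => /andP[].
    move=> fixx.
    have cent n : n \in K -> perm_on (cls e x) n -> n ^ d = n -> n = 1.
      move=> nK nx nd; apply: (@prim_semireg x _ x) => //; first exact: eqv_refl.
      apply: fixx; rewrite LE in_setI nK (on_bker ee nx) ?KG //= rs_id //.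
      by rewrite -{2}nd conjE // -/t /conjg mulKVg.
    right; pose N := [set n in K | perm_on (cls e x) n].
    have NE n : (n \in N) = (n \in K) && perm_on (cls e x) n by rewrite in_set.
    have Nd n : n \in N -> n^-1 * n ^ d \in N.
      rewrite !NE => /andP[nK nx]; have dK := SK _ dS; rewrite groupM ?groupV ?groupJ //=.
      by rewrite perm_onM ?perm_onV // -(st d dS) perm_onJ.
    (* Conjugation by [d] fixes only 1 in [N], so [n^-1 * n ^ d] runs over all of [N]; as the square
       of [d] acts trivially, every such element is inverted. *)
    have injN : {in N &, injective (fun n => n^-1 * n ^ d)}.
      move=> n m; rewrite !NE => /andP[nK nx] /andP[mK mx'] /= eq1.
      apply/esym/eqP; rewrite eq_mulgV1; apply/eqP; apply: cent.
      - by rewrite groupM ?groupV.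
      - by rewrite perm_onM ?perm_onV.
      have e2 : m ^ d = m * n^-1 * n ^ d by rewrite -mulgA eq1 mulKVg.
      by rewrite conjMg conjVg e2 mulgK.
    have : s \in [set n^-1 * n ^ d | n in N].
      have /eqP -> : [set n^-1 * n ^ d | n in N] == N.
        by rewrite eqEcard card_in_imset // leqnn andbT; apply/subsetP=> _ /imsetP[n nN ->]; apply: Nd.
      by rewrite NE sK.
    case/imsetP=> n; rewrite NE => /andP[nK nx] ->.
    rewrite conjMg conjVg -conjgM (conjE n (d * d)) // r2 conjg1 [RHS]invMg invgK //.
  move=> tr; case/eqP: r1; apply/permP=> y; rewrite perm1.
  have [yx|yx] := boolP (y \in cls e x); last exact: (out_perm (rs_on _ _) yx).
  have xy : e x y by rewrite inE in yx.
  have [l] := tr y xy; rewrite LE in_setI => /andP[/andP[lK lk] /eqP lt'] <-.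
  rewrite -{1}(rsE (bker_st ee x lk)) ?mem_cls // -permM lt' permM.
  by rewrite (rsE (st _ dS)) ?mem_cls // Sx // (rsE (bker_st ee x lk)) ?mem_cls.
have /nontrivP[s sK [s1 sx]] := nt x.
have sxx : s x != x by apply: contra s1 => /eqP h; apply/eqP; apply: (@prim_semireg x _ x); rewrite ?eqv_refl.
have nS : group Sg \subset 'N(<[s]>).
  apply/subsetP=> d dS; rewrite inE -cycleJ cycle_subG.
  by case: (H4 s d sK sx dS) => ->; rewrite ?groupV cycle_id.
have LE : <[s]> <*> S = S * <[s]>.
  by rewrite joingC -(norm_joinEl nS).
have sk : s \in bker G e by apply: (on_bker ee sx); apply: KG.
case: (H3 [group of <[s]> <*> S]) => /=.
- exact: joing_subr.
- rewrite join_subG cycle_subG inE sK sk; apply/subsetP=> d; exact: SD.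
- move=> fixx; move: sxx; rewrite fixx ?eqxx //.
  by apply: (subsetP (joing_subl _ _)); apply: cycle_id.
move=> tr; have [y xy] := other ee nall x.
apply: (@no_shift y x s) => //; first by rewrite eqv_sym.
  move=> t yt; apply: (out_perm sx); rewrite inE; apply: contra xy => xt.
  by apply: (eqv_trans ee xt); rewrite eqv_sym.
right=> t yt; have yx : ~~ e y x by rewrite eqv_sym.
have := prim_two t yx; rewrite (negPf yt) /= => xt; have [l] := tr t xt.
rewrite LE => /mulsgP[d c dS /cycleP[i ->] ->] <-.
by rewrite permM Sx // mem_porbit.
Qed.

End Primitive.

(** * Intervals of rank three and pairs of relations *)

Section Boolean.
Variable gT : finGroupType.
Implicit Types (G A B C L : {group gT}).

Lemma double_card A B : A \subset B -> ~ B \subset A -> (#|A|).*2 <= #|B|.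
Proof.
move=> AB BA; have /dvdnP[k kE] := cardSg AB.
have A0 : 0 < #|A| by apply: cardG_gt0.
have lt : #|A| < #|B| by apply: proper_card; rewrite properE AB; apply/negP.
move: lt; rewrite kE -{1}[#|A|]mul1n ltn_pmul2r // => k2.
by rewrite -mul2n leq_pmul2r.
Qed.

(* Above A /\ B /\ C every subgroup is the meet of the members of {A, B, C} which contain it. *)
Definition boolean_triple G A B C : Prop :=
  [/\ [/\ A \subset G, B \subset G & C \subset G],
      [/\ ~ A :&: B \subset C, ~ A :&: C \subset B & ~ B :&: C \subset A] &
      forall L, A :&: B :&: C \subset L -> L \subset G ->
        (if L \subset A then (A : {set gT}) else G) :&: (if L \subset B then (B : {set gT}) else G)
        :&: (if L \subset C then (C : {set gT}) else G) \subset L].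

Lemma triple_swap G A B C : boolean_triple G A B C -> boolean_triple G B A C.
Proof.
case=> [[AG BG CG] [n1 n2 n3] h]; split; [by split|split=> //; by rewrite setIC|].
by move=> L HL LG; rewrite [X in X :&: _]setIC; apply: h; rewrite // (setIC A).
Qed.
Lemma triple_rot G A B C : boolean_triple G A B C -> boolean_triple G B C A.
Proof.
case=> [[AG BG CG] [n1 n2 n3] h]; split; [by split|split=> //; by rewrite setIC|].
by move=> L HL LG; rewrite setIC setIA; apply: h; rewrite // -setIA setIC.
Qed.

Section B3.
Variables (G A B C : {group gT}).
Hypothesis b : boolean_triple G A B C.

Lemma triple_nsub : ~ A \subset B.
Proof. by case: b => _ [n1 n2 n3] _ h; apply: n2; apply: subset_trans (subsetIl _ _) h. Qed.

Lemma triple_above L : A :&: B \subset L -> L \subset G -> [\/ L \subset A, L \subset B | G \subset L].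
Proof.
case: b => [[AG BG CG] [n1 n2 n3] h] ABL LG.
have nC : (L \subset C) = false by apply/negP=> LC; apply: n1; apply: subset_trans ABL LC.
have := h L (subset_trans (subsetIl _ _) ABL) LG; rewrite nC.
case: ifP => [LA|_]; first by constructor 1.
case: ifP => [LB|_]; first by constructor 2.
by rewrite !setIid; constructor 3.
Qed.

Lemma triple_max L : A :&: B \subset L -> L \subset A -> L \subset A :&: B \/ A \subset L.
Proof.
case: b => [[AG BG CG] [n1 n2 n3] h] ABL LA.
have nC : (L \subset C) = false by apply/negP=> LC; apply: n1; apply: subset_trans ABL LC.
have := h L (subset_trans (subsetIl _ _) ABL) (subset_trans LA AG); rewrite nC LA.
case: ifP => [LB _|_]; first by left; rewrite subsetI LA.
by rewrite (setIidPl AG) (setIidPl AG); right.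
Qed.

Lemma triple_ne : ~ A \subset A :&: B.
Proof. by rewrite subsetI subxx /=; apply: triple_nsub. Qed.

(** Strictly between the bottom and [A] there are only [A :&: B] and [A :&: C]; the two disjunctions
    are two readings of this. *)
Lemma triple_below L : A :&: B :&: C \subset L -> L \subset A ->
  [\/ L \subset B, L \subset C | A \subset L] /\ [\/ A :&: B \subset L, L \subset C | A \subset L].
Proof.
case: b => [[AG BG CG] [n1 n2 n3] h] HL LA.
have := h L HL (subset_trans LA AG); rewrite LA.
case: ifP => [LB|_]; case: ifP => [LC|_] hh; split; try (by constructor 1); try (by constructor 2).
- constructor 1; apply: subset_trans hh; rewrite subsetI subxx (subset_trans (subsetIl _ _)) //.
- by constructor 3; apply: subset_trans hh; rewrite !subsetI subxx AG.
- by constructor 3; apply: subset_trans hh; rewrite !subsetI subxx AG.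
Qed.
End B3.
End Boolean.

(** * Stabilizers of equivalence relations *)

Section Relations.
Variables (T : finType) (alt : bool) (G : {group {perm T}}).
Implicit Types (x y z t : T) (g h : {perm T}) (e : rel T).
Hypothesis hG : forall g, (g \in G) = ~~ (alt && odd_perm g).
Hypothesis T6 : 6 <= #|T|.

Definition proper_eq e := [/\ equivalence_rel e, exists x y, x != y /\ e x y & exists x y, ~~ e x y].
Definition uniform e := forall x y, #|cls e x| = #|cls e y|.

Lemma uniform_inv (K : {set {perm T}}) e : ptrans K setT -> einv K e -> uniform e.
Proof.
move=> tK h x y; have [k kK <-] := tK x y (in_setT _) (in_setT _).
by rewrite -(im_cls x (h k kK)) im_card.
Qed.

Lemma card_cls2 e : proper_eq e -> uniform e -> forall x, 1 < #|cls e x|.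
Proof.
move=> [ee [a [b [ab eab]]] _] ue x; rewrite (ue x a).
by apply: (@card_cls_ge _ _ a [:: a; b]); rewrite /= ?inE ?ab // eqv_refl // eab.
Qed.

Lemma exists_other e x : proper_eq e -> exists y, ~~ e x y.
Proof. by case=> [ee _ h]; apply: (other ee h). Qed.

(** In the alternating group the transposition of [y] and [z] is balanced by another one inside a
    different class, away from [w]. With classes of two points this takes a third class, hence
    degree at least 6. *)
Lemma move_fixing e y z w : proper_eq e -> uniform e -> e y z -> y != z -> w != y -> w != z ->
  exists2 g, g \in rstab G e & g y = z /\ g w = w.
Proof.
move=> pe ue yz nyz wy wz; have [ee _ _] := pe.
have inc a b t : e a b -> e t (tperm a b t).
  by move=> ab; case: tpermP => [->|->|_ _] //; [rewrite eqv_sym|rewrite eqv_refl].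
have [altE|altE] := boolP alt; last first.
  exists (tperm y z); last by rewrite tpermL tpermD // eq_sym.
  by apply/rstabP; split; [rewrite hG (negPf altE)|apply: in_pres => // t; apply: inc].
suff [u [v [uv euv yu [wu wv]]]] : exists u v, [/\ u != v, e u v, ~~ e y u & w != u /\ w != v].
  have yv : ~~ e y v by apply: contra yu => yv; apply: (eqv_trans ee yv); rewrite eqv_sym.
  have d a b : e y a -> ~~ e y b -> b != a by move=> ya; apply: contraNneq => ->.
  have yy := eqv_refl ee y.
  exists (tperm y z * tperm u v); last first.
    rewrite !permM tpermL (@tpermD _ y z w) ?tpermD //; try by rewrite eq_sym.
    - exact: d.
    - exact: d.
  apply/rstabP; split; first by rewrite hG odd_permM !odd_tperm nyz uv andbF.
  by apply: in_pres => // t; rewrite permM; exact: (eqv_trans ee (inc y z t yz) (inc _ _ _ euv)).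
have [c3|c2] := ltnP 2 #|cls e y|.
  have [t yt] := exists_other y pe.
  have [u tu] := cls_avoid (S := [:: w]) (card_cls2 pe ue t); rewrite inE => uw.
  have [v tv] := @cls_avoid _ _ t [:: w; u] (leq_trans c3 (eq_leq (ue y t))).
  rewrite !inE negb_or => /andP[vw vu]; exists u, v; split; rewrite 1?eq_sym //.
  - by rewrite -(eqv_congr ee tu).
  - by apply: contra yt => yu; apply: (eqv_trans ee yu); rewrite eqv_sym.
  - by split; rewrite // eq_sym.
have [t] : exists t, t \notin cls e y :|: cls e w.
  apply/existsP; rewrite -negb_forall; apply/negP=> /forallP h.
  have : #|T| <= #|cls e y :|: cls e w|.
    by rewrite -cardsT; apply: subset_leq_card; apply/subsetP=> t _; apply: h.
  have := cardsUI (cls e y) (cls e w); have := ue y w; lia.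
rewrite !inE negb_or => /andP[yt wt].
have [v tv] := cls_avoid (S := [:: t]) (card_cls2 pe ue t); rewrite inE => vt.
exists t, v; split; rewrite 1?eq_sym //; split.
  by apply: contraNneq wt => ->; apply: eqv_refl.
by apply: contraNneq wt => ->; rewrite eqv_sym.
Qed.

(** If [e x y] holds without [f x y], an element sending [x] to [y] and fixing an [f]-mate of [x]
    breaks [f]. In the other direction, exchanging the [e]-class of [y] with one outside the
    [f]-class, and keeping [x], breaks [f]. *)
Lemma rstab_inj e f : proper_eq e -> uniform e -> proper_eq f -> uniform f ->
  rstab G e \subset rstab G f -> forall x y, e x y = f x y.
Proof.
move=> pe ue pf uf /subsetP sub; have [ee _ _] := pe; have [ff _ _] := pf.
have ef x y : e x y -> f x y.
  move=> exy; have [<-|xy] := eqVneq x y; first exact: eqv_refl.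
  apply/negPn/negP => nf.
  have [w xw] := cls_avoid (S := [:: x]) (card_cls2 pf uf x); rewrite inE => wx.
  have wy : w != y by apply: contraNneq nf => <-.
  have [g /sub/rstabP[_ gf] [gx gw]] := move_fixing pe ue exy xy wx wy.
  case/negP: nf; apply: (eqv_trans ff xw); by rewrite -gx -{1}gw gf eqv_sym.
move=> x y; apply/idP/idP; first exact: ef.
move=> fxy; apply/negPn/negP => nxy.
have [t nxt] := exists_other x pf.
have nyt : ~~ f y t by rewrite -(eqv_congr ff fxy).
have eyt : ~~ e y t by apply: contra nyt; apply: ef.
have ext : ~~ e x t by apply: contra nxt; apply: ef.
have [y' yy' ny] := cls_avoid (S := [:: y]) (card_cls2 pe ue y); rewrite inE eq_sym in ny.
have [g [gG gon ge gyt _]] := swap_cls hG ee (ue y t) eyt yy' ny.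
have /sub/rstabP[_ gf] : g \in rstab G e by apply/rstabP.
have gx : g x = x.
  by apply: (out_perm gon); rewrite !inE negb_or (eqv_sym ee y) nxy (eqv_sym ee t).
have : g y \in cls e t by rewrite -gyt im_mem inE eqv_refl.
rewrite inE.
move/ef => h; case/negP: nxt; rewrite -gx (eqv_trans ff (y := g y)) // ?gf //.
by rewrite eqv_sym.
Qed.

Definition conj_rel e f : rel T := fun x y => e x y && f x y.
Lemma conj_rel_eqv e f : equivalence_rel e -> equivalence_rel f -> equivalence_rel (conj_rel e f).
Proof.
move=> ee ff; apply: eqrelP; rewrite /conj_rel.
- by move=> x; rewrite (eqv_refl ee) (eqv_refl ff).
- by move=> x y; rewrite (eqv_sym ee) (eqv_sym ff).
- by move=> y x z /andP[? ?] /andP[? ?]; apply/andP; split; [apply: (eqv_trans ee (y := y))|apply: (eqv_trans ff (y := y))].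
Qed.

(** The stabilizer of the common refinement lies above the meet of the two groups. Unless the
    refinement is trivial, [triple_above] locates this stabilizer and [rstab_inj] identifies the
    refinement with [e] or [f]. *)
Lemma meet_triv e f (C : {group {perm T}}) : proper_eq e -> proper_eq f ->
  boolean_triple G (rstab_group G e) (rstab_group G f) C -> ptrans (rstab G e :&: rstab G f) setT ->
  [\/ forall x y, e x y -> f x y, forall x y, f x y -> e x y | forall x y, e x y -> f x y -> x = y].
Proof.
move=> pe pf b tK; have [ee _ ne] := pe; have [ff _ _] := pf.
have cc := conj_rel_eqv ee ff.
have uu (h : rel T) : einv (rstab G e :&: rstab G f) h -> uniform h by apply: uniform_inv.
have ue : uniform e by apply: uu => g /setIP[/rstabP[_ h] _].
have uf : uniform f by apply: uu => g /setIP[_ /rstabP[_ h]].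
have uc : uniform (conj_rel e f).
  by apply: uu => g /setIP[/rstabP[_ h] /rstabP[_ h']] x y; rewrite /conj_rel h h'.
have [/existsP[x0 /existsP[y0 /andP[xy c]]]|no] :=
    boolP [exists x, exists y, (x != y) && conj_rel e f x y]; last first.
  constructor 3 => x y xy xy'; apply/eqP/negPn/negP=> n; case/negP: no.
  by apply/existsP; exists x; apply/existsP; exists y; rewrite n /conj_rel xy.
have pc : proper_eq (conj_rel e f).
  split=> //; first by exists x0, y0.
  by have [x [y n]] := ne; exists x, y; rewrite /conj_rel negb_and n.
have KL : rstab G e :&: rstab G f \subset rstab G (conj_rel e f).
  apply/subsetP=> g /setIP[/rstabP[gG h] /rstabP[_ h']]; apply/rstabP; split=> // x y.
  by rewrite /conj_rel h h'.
case: (triple_above b (L := rstab_group G (conj_rel e f)) KL (rstab_sub _ _)) => /= sub.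
- have h := rstab_inj pc uc pe ue sub; constructor 1 => x y; rewrite -h.
  by case/andP.
- have h := rstab_inj pc uc pf uf sub; constructor 2 => x y; rewrite -h.
  by case/andP.
- have h := rstab_inj pe ue pc uc (subset_trans (rstab_sub _ _) sub); constructor 1 => x y; rewrite h.
  by case/andP.
Qed.

(* The two ways in which B can fail both to contain Alt and to be comparable with the stabilizer of e. *)
Definition bad e (B : {group {perm T}}) :=
  (prim B /\ ~ has_cyc3 B) \/
  exists f, [/\ proper_eq f, einv B f & forall x y, e x y -> f x y -> x = y].

Section Bad.
Variables (e : rel T) (K B : {group {perm T}}).
Hypothesis pe : proper_eq e.
Let M := rstab G e.
Hypotheses (KM : K \subset M) (KneM : ~ M \subset K) (tK : ptrans K setT).
Hypothesis mx : forall L : {group {perm T}}, K \subset L -> L \subset M -> L \subset K \/ M \subset L.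
Hypothesis a3 : forall x, 2 < #|cls e x|.
Hypotheses (evB_lift : K \subset B) (bB : bad e B).

Let ee : equivalence_rel e. Proof. by case: pe. Qed.
Let nall : exists x y, ~~ e x y. Proof. by case: pe. Qed.

(** The class of [x] has more than two points: it contains a point fixed by the cycle, and is then
    preserved, or a second point of the cycle. *)
Lemma cyc3_cls x y z : cyc3 x y z \in M -> x != y -> x != z -> y != z -> e x y /\ e x z.
Proof.
move=> /rstabP[_ c] xy xz yz.
have cx : cyc3 x y z x = y by rewrite cyc3E; try neq; rwneq.
have cy : cyc3 x y z y = z by rewrite cyc3E; try neq; rwneq.
have cz : cyc3 x y z z = x by rewrite cyc3E; try neq; rwneq.
have [[w xw /and3P[wx wy wz]]|h] : (exists2 w, e x w & [&& w != x, w != y & w != z]) \/ e x y || e x z.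
- have [w xw] := cls_avoid (S := [:: x; y]) (a3 x); rewrite !inE negb_or => /andP[wx wy].
  by have [<-|wz] := eqVneq w z; [right; rewrite xw orbT|left; exists w => //; apply/and3P].
- have cw : cyc3 x y z w = w by rewrite cyc3E; try neq; rwneq.
  have yw : e y w by have := c x w; rewrite cx cw => ->.
  have zw : e z w by have := c y w; rewrite cy cw => ->.
  by split; apply: (eqv_trans ee xw); rewrite eqv_sym.
have exy : e x y.
  case/orP: h => // xz'; have := c x z; rewrite cx cz xz' => yx.
  by rewrite eqv_sym.
by split=> //; apply: (eqv_trans ee exy); have := c x y; rewrite cx cy => ->.
Qed.

(** A point of the class has an [f]-mate outside it, which [u] fixes; its image is therefore both
    [e]-related and [f]-related to it. *)
Lemma bad_imprim_triv f x u : proper_eq f -> einv B f -> (forall x y, e x y -> f x y -> x = y) ->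
  u \in K -> perm_on (cls e x) u -> u = 1.
Proof.
move=> pf iB tr uK ux; have [ff _ _] := pf.
have uf : uniform f by apply: (uniform_inv tK) => g gK; apply: iB; apply: (subsetP evB_lift).
apply/permP=> t; rewrite perm1; have [s ts st] := cls_avoid (S := [:: t]) (card_cls2 pf uf t).
rewrite inE in st; have [xt|xt] := boolP (t \in cls e x); last exact: (out_perm ux xt).
have et' := perm_on_in ee t ux.
have us : u s = s.
  apply: (out_perm ux); rewrite inE; apply: contra st => xs; apply/eqP/esym/tr => //.
  by rewrite -(eqv_congr ee (_ : e x t)) //; rewrite inE in xt.
apply/esym/tr => //; apply: (eqv_trans ff ts); rewrite eqv_sym // -us (iB u) ?(subsetP evB_lift) //.
Qed.

Lemma bad_noc : ~ has_cyc3 K.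
Proof.
case: bB => [[_ nB]|[f [pf iB tr]]] [x [y [z [xy xz yz cK]]]].
  by apply: nB; exists x, y, z; split=> //; apply: (subsetP evB_lift).
have [exy exz] := cyc3_cls (subsetP KM _ cK) xy xz yz.
have on : perm_on (cls e x) (cyc3 x y z) by apply: cyc3_on; rewrite inE ?eqv_refl.
by have /eqP := bad_imprim_triv pf iB tr cK on; rewrite (negPf (cyc3_neq1 xy xz yz)).
Qed.

Lemma bad3 : alt /\ (forall x y z, ~~ e x y -> e x z || e y z) /\
  ((full G e K /\ (forall x u, u \in K -> perm_on (cls e x) u -> u = 1)) \/
   [/\ forall x, #|cls e x| = 4, prim B, ~ has_cyc3 B & forall x, nontriv e K x]).
Proof.
case: (nontriv_or hG ee KM tK mx a3 nall bad_noc) => [nt|[h1 h2 h3 h4]]; last by split=> //; split=> //; left.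
case: bB => [[pB nB]|[f [pf iB tr]]]; last first.
  have [x _] := nall; have /nontrivP[u uK [u1 ux]] := nt x.
  by have /eqP := bad_imprim_triv pf iB tr uK ux; rewrite (negPf u1).
have /andP[altT /forallP c4] := nontriv_alt4 hG ee KM tK mx a3 nall evB_lift pB nB nt.
split=> //; split; first by move=> x y z; apply: (prim_two hG ee KM tK mx a3 nall evB_lift pB nB nt).
by right; split=> // x; apply/eqP.
Qed.

(** The second outcome of [bad3] has two classes of four points. *)
Lemma bad3_n8 : #|T| != 8 -> [/\ alt, (forall x y z, ~~ e x y -> e x z || e y z),
  full G e K & (forall x u, u \in K -> perm_on (cls e x) u -> u = 1)].
Proof.
move=> n8; have [h1 [h2 [[h3 h4]|[c4 _ _ _]]]] := bad3; first by split.
have [x [y xy]] := nall; case/eqP: n8.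
have := cardsUI (cls e x) (cls e y).
have /eqP -> : cls e x :&: cls e y == set0 by rewrite setI_eq0 cls_disj.
rewrite cards0 addn0 !c4 => h; rewrite -cardsT (_ : setT = cls e x :|: cls e y) ?h //.
by apply/setP=> z; rewrite !inE h2.
Qed.
End Bad.

End Relations.

(** * Relations with classes of size two *)

Lemma porbits_partition (T : finType) (s : {perm T}) : partition (porbits s) [set: T].
Proof.
have -> : porbits s = orbit 'P%act <[s]> @: setT.
  apply/setP=> A; apply/imsetP/imsetP => -[x _ ->].
    by exists x; rewrite ?inE // unlock.
  by exists x; rewrite // unlock.
apply: orbit_partition.
by apply/subsetP=> g _; rewrite !inE; apply/subsetP=> x _; rewrite !inE.
Qed.

Lemma fpf_invol (T : finType) (s : {perm T}) :
  (forall x, s x != x) -> (forall x, s (s x) = x) -> #|T| = (#|porbits s| * 2)%N.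
Proof.
move=> s1 s2.
have c2 A : A \in porbits s -> #|A| = 2.
  case/imsetP=> x _ ->; rewrite (_ : porbit s x = [set x; s x]) ?cards2 1?eq_sym ?s1 //.
  apply/setP=> y; rewrite !inE; apply/porbitP/orP => [[i ->]|[/eqP->|/eqP->]].
  - elim: i => [|i]; first by rewrite expg0 perm1 eqxx; left.
    by rewrite expgSr permM => -[/eqP->|/eqP->]; rewrite ?s2 eqxx; [right|left].
  - by exists 0; rewrite expg0 perm1.
  - by exists 1%N; rewrite expg1.
by have := card_uniform_partition c2 (porbits_partition s); rewrite cardsT.
Qed.

Lemma odd_fpf_invol (T : finType) (s : {perm T}) :
  (forall x, s x != x) -> (forall x, s (s x) = x) -> odd_perm s = odd #|T|./2.
Proof.
move=> s1 s2; have e := fpf_invol s1 s2.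
by rewrite /odd_perm e oddM andbF addFb muln2 doubleK.
Qed.

Section Pairs.
Variables (T : finType) (e : rel T).
Implicit Types (x y z w t : T) (g h k v : {perm T}).
Hypothesis ee : equivalence_rel e.
Hypothesis c2 : forall x, #|cls e x| = 2.

Definition mate x := odflt x [pick y | e x y && (y != x)].
Lemma mateP x : e x (mate x) /\ mate x != x.
Proof.
rewrite /mate; case: pickP => [y /andP[]//|no].
have [y xy] := @cls_avoid _ e x [:: x] (ltac:(by rewrite c2)); rewrite inE => yx.
by have := no y; rewrite xy yx.
Qed.
Lemma mate_rel x : e x (mate x). Proof. by case: (mateP x). Qed.
Lemma mate_ne x : mate x != x. Proof. by case: (mateP x). Qed.
Lemma pair_relE x y : e x y = (y == x) || (y == mate x).
Proof.
suff -> : e x y = (y \in [set x; mate x]) by rewrite !inE.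
have /eqP -> : [set x; mate x] == cls e x.
  rewrite eqEcard c2 cards2 eq_sym mate_ne /= andbT.
  by apply/subsetP=> t; rewrite !inE => /orP[]/eqP->; rewrite ?eqv_refl // mate_rel.
by rewrite inE.
Qed.
Lemma mate_uniq x y : e x y -> y != x -> y = mate x.
Proof. by rewrite pair_relE => /orP[->//|/eqP]. Qed.
Lemma mateK x : mate (mate x) = x.
Proof. by apply/esym/mate_uniq; [rewrite eqv_sym // mate_rel|rewrite eq_sym mate_ne]. Qed.
Lemma mate_comm g : (forall x y, e (g x) (g y) = e x y) -> forall x, g (mate x) = mate (g x).
Proof. by move=> h x; apply: mate_uniq; rewrite ?h ?mate_rel // (inj_eq perm_inj) mate_ne. Qed.
Lemma mate_neq x y : ~~ e x y -> [/\ x != y, x != mate y, mate x != y & mate x != mate y].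
Proof.
rewrite pair_relE negb_or => /andP[h1 h2]; split.
- by rewrite eq_sym.
- by apply: contra h2 => /eqP->; rewrite mateK.
- by rewrite eq_sym.
- by apply: contra h1 => /eqP /(congr1 mate); rewrite !mateK => ->.
Qed.

Definition flip x := tperm x (mate x).
Definition dflip x y := flip x * flip y.
Definition swp x y := tperm x y * tperm (mate x) (mate y).

Lemma flipE x z : flip x z = if e x z then mate z else z.
Proof.
rewrite /flip pair_relE; case: tpermP => [->|->|/eqP/negPf-> /eqP/negPf->] //=.
  by rewrite eqxx.
by rewrite eqxx orbT mateK.
Qed.
Lemma flip_e x z : e z (flip x z).
Proof. by rewrite flipE; case: ifP; rewrite ?eqv_refl // mate_rel. Qed.
Lemma dflip_e x y z : e z (dflip x y z).
Proof. by rewrite permM; apply: (eqv_trans ee (flip_e x z) (flip_e _ _)). Qed.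
Lemma flipJ g x : (forall x y, e (g x) (g y) = e x y) -> flip x ^ g = flip (g x).
Proof. by move=> h; rewrite tpermJ mate_comm. Qed.
Lemma dflipJ g x y : (forall x y, e (g x) (g y) = e x y) -> dflip x y ^ g = dflip (g x) (g y).
Proof. by move=> h; rewrite conjMg !flipJ. Qed.
Lemma odd_flip x : odd_perm (flip x). Proof. by rewrite odd_tperm eq_sym mate_ne. Qed.
Lemma odd_dflip x y : odd_perm (dflip x y) = false.
Proof. by rewrite odd_permM !odd_flip. Qed.

Lemma swpE x y z : ~~ e x y -> swp x y z =
  if z == x then y else if z == y then x else if z == mate x then mate y else if z == mate y then mate x else z.
Proof.
move=> xy; have [h1 h2 h3 h4] := mate_neq xy.
have px := mate_ne x; have py := mate_ne y; rewrite permM.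
have [->|zx] := eqVneq z x; first by rewrite tpermL tpermD; try neq.
have [->|zy] := eqVneq z y; first by rewrite tpermR tpermD; try neq.
rewrite (@tpermD _ x y z); try neq.
have [->|zpx] := eqVneq z (mate x); first by rewrite tpermL.
have [->|zpy] := eqVneq z (mate y); first by rewrite tpermR.
by rewrite tpermD //; neq.
Qed.
Lemma swp_pres x y : ~~ e x y -> forall z w, e (swp x y z) (swp x y w) = e z w.
Proof.
move=> xy; have [h1 h2 h3 h4] := mate_neq xy.
have px := mate_ne x; have py := mate_ne y.
have com z : swp x y (mate z) = mate (swp x y z).
  have pe a b : (mate a == b) = (a == mate b) by apply/eqP/eqP => [<-|->]; rewrite mateK.
  rewrite !(swpE _ xy) !pe !mateK.
  have [->|zx] := eqVneq z x; first by rwneq.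
  have [->|zy] := eqVneq z y; first by rwneq.
  have [_|zpx] := eqVneq z (mate x); first by rewrite mateK.
  by have [_|zpy] := eqVneq z (mate y); rewrite ?mateK.
by move=> z w; rewrite !pair_relE -com !(inj_eq perm_inj).
Qed.
Lemma odd_swp x y : ~~ e x y -> odd_perm (swp x y) = false.
Proof. by case/mate_neq=> h1 _ _ h4; rewrite odd_permM !odd_tperm h1 h4. Qed.

(** [k] induces on the set of pairs the transposition of two of them; how it matches their points is
    left open. *)
Definition swaps k x y := [/\ forall z, ~~ e x z -> ~~ e y z -> e z (k z), e y (k x) & e x (k y)].
Lemma swaps_sym k x y : swaps k x y -> swaps k y x.
Proof. by case=> h1 h2 h3; split=> // z yz xz; apply: h1. Qed.
Lemma swaps_cls k x y x' : (forall x y, e (k x) (k y) = e x y) -> e x x' -> swaps k x y -> swaps k x' y.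
Proof.
move=> ke xx [h1 h2 h3]; split=> [z|  |]; first by rewrite -(eqv_congr ee xx); apply: h1.
  by apply: (eqv_trans ee h2); rewrite ke.
by rewrite -(eqv_congr ee xx).
Qed.
Lemma swapsJ (t k : {perm T}) x y : (forall x y, e (k x) (k y) = e x y) -> swaps t x y -> swaps (t ^ k) (k x) (k y).
Proof.
move=> ke [h1 h2 h3]; split=> [z|  |]; rewrite ?permJ ?ke //.
by rewrite -{1 2 3}(permKV k z) -[X in (t ^ k) X](permKV k z) permJ !ke => xz yz; apply: h1.
Qed.
Lemma swp_swaps x y : ~~ e x y -> swaps (swp x y) x y.
Proof.
move=> xy; have [h1 h2 h3 h4] := mate_neq xy; split=> [z| |]; rewrite (swpE _ xy).
- rewrite !pair_relE !negb_or => /andP[/negPf-> /negPf->] /andP[/negPf-> /negPf->].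
  by rewrite eqxx.
- by rewrite eqxx eqv_refl.
- by rewrite eq_sym (negPf h1) eqxx eqv_refl.
Qed.

Lemma bker_flip v x : (forall z, e z (v z)) -> v x = x \/ v x = mate x.
Proof. by move=> /(_ x); rewrite pair_relE => /orP[]/eqP; [left|right]. Qed.

(** Two flipped pairs are removed at a time; a single remaining one would make [v] odd. *)
Lemma even_flips (L : {group {perm T}}) v : (forall x y, ~~ e x y -> dflip x y \in L) ->
  (forall z, e z (v z)) -> ~~ odd_perm v -> v \in L.
Proof.
move=> hL; have [m] := ubnP #|[set x | v x != x]|; elim: m v => // m IH v lem ve vo.
have [->|/eqP v1] := altP (v =P 1); first exact: group1.
have vc := mate_comm (in_pres ee ve).
have [x vx] : exists x, v x != x.
  apply/existsP; apply: contra_notT v1; rewrite negb_exists => /forallP h.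
  by apply/permP=> x; rewrite perm1; apply/eqP; move: (h x); rewrite negbK.
have vpx : v x = mate x by case: (bker_flip x ve) => // h; rewrite h eqxx in vx.
have [/existsP[y /andP[xy vy]]|no] := boolP [exists y, ~~ e x y && (v y != y)]; last first.
  have vE : v = flip x.
    apply/permP=> z; rewrite flipE; have [xz|xz] := boolP (e x z).
      by move: xz; rewrite pair_relE => /orP[]/eqP-> //; rewrite vc vpx.
    by move: no; rewrite negb_exists => /forallP/(_ z); rewrite xz /= negbK => /eqP.
  by rewrite vE odd_flip in vo.
have vpy : v y = mate y by case: (bker_flip y ve) => // h; rewrite h eqxx in vy.
have dL := hL _ _ xy; rewrite -(groupMr _ dL).
have dE z : (v * dflip x y) z = if e x z || e y z then z else v z.
  rewrite permM /dflip permM !flipE.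
  have -> : e x (v z) = e x z by rewrite eqv_sym // -(eqv_congr ee (ve z)) eqv_sym.
  have [xz|xz] /= := boolP (e x z).
    have yz : ~~ e y z by apply: contra xy => yz; apply: (eqv_trans ee xz); rewrite eqv_sym.
    have vz : v z = mate z by move: xz; rewrite pair_relE => /orP[]/eqP->; rewrite ?vc vpx.
    by rewrite vz mateK (negPf yz).
  have -> : e y (v z) = e y z by rewrite eqv_sym // -(eqv_congr ee (ve z)) eqv_sym.
  case: ifP => // yz; move: yz; rewrite pair_relE => /orP[]/eqP->; rewrite ?vc vpy mateK //.
apply: IH.
- apply: leq_trans (_ : #|[set t | v t != t]| <= m) => //.
  apply: proper_card; apply/properP; split.
    by apply/subsetP=> z; rewrite !inE dE; case: ifP; rewrite ?eqxx.
  by exists x; rewrite inE // dE eqv_refl // eqxx.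
- by move=> z; rewrite dE; case: ifP; rewrite ?eqv_refl.
- by rewrite odd_permM odd_dflip addbF.
Qed.

Section Transposition_lifts.
Variable K0 : {group {perm T}}.
Hypotheses (K0e : forall k, k \in K0 -> forall x y, e (k x) (k y) = e x y)
  (K0o : forall k, k \in K0 -> ~~ odd_perm k)
  (K01 : forall k, k \in K0 -> (forall z, e z (k z)) -> k = 1)
  (K0s : forall x y, ~~ e x y -> exists2 k, k \in K0 & swaps k x y)
  (bodd : odd #|T|./2) (nall : exists x y, ~~ e x y).

(* A lift of a swap is an involution; as it is even and the number of classes is odd it fixes a point z0, and
   every swap avoiding the class of z0 then has a lift fixing z0. An element of K0 moving z0 inside its class
   could be multiplied by such lifts until it acts trivially on the classes, whence it is 1. *)
Lemma lifts_not_trans : ~ ptrans K0 setT.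
Proof.
move=> tK; have [x0 [y0 xy0]] := nall; have [t tK0 ts] := K0s xy0.
have [h1 h2 h3] := ts; have te := K0e tK0.
have et' x y z : e x y -> e x z -> e y z by move=> xy; rewrite (eqv_congr ee xy).
have tt z : e z (t (t z)).
  have [xz|xz] := boolP (e x0 z).
    have e1 : e y0 (t z) by apply: (eqv_trans ee h2); rewrite te.
    have e2 : e (t y0) (t (t z)) by rewrite te.
    by apply: (et' x0) => //; apply: (eqv_trans ee h3).
  have [yz|yz] := boolP (e y0 z).
    have e1 : e x0 (t z) by apply: (eqv_trans ee h3); rewrite te.
    have e2 : e (t x0) (t (t z)) by rewrite te.
    by apply: (et' y0) => //; apply: (eqv_trans ee h2).
  have e1 := h1 z xz yz; have e2 : e (t z) (t (t z)) by rewrite te.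
  exact: (eqv_trans ee e1).
have t2 : t * t = 1 by apply: K01; [rewrite groupM|move=> z; rewrite permM].
have ttz z : t (t z) = z by rewrite -permM t2 perm1.
have [/existsP[z0 /eqP tz0]|nof] := boolP [exists z, t z == z]; last first.
  have := K0o tK0; rewrite (odd_fpf_invol _ ttz) ?bodd // => x.
  by move: nof; rewrite negb_exists => /forallP.
have xz0 : ~~ e x0 z0.
  apply/negP=> xz; case/negP: xy0; have : e (t x0) (t z0) by rewrite te.
  by rewrite tz0 => h; apply: (eqv_trans ee xz); rewrite eqv_sym //; apply: (eqv_trans ee h2).
have yz0 : ~~ e y0 z0.
  apply/negP=> xz; case/negP: xy0; have : e (t y0) (t z0) by rewrite te.
  by rewrite tz0 => h; apply: (eqv_trans ee (eqv_trans ee h3 h)); rewrite eqv_sym.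
pose Q x y := exists2 k, k \in K0 & swaps k x y /\ k z0 = z0.
have Qs x y : Q x y -> Q y x by case=> k kK [ks kz]; exists k => //; split=> //; apply: swaps_sym.
have Qc x x' y : e x x' -> Q x y -> Q x' y.
  by move=> xx [k kK [ks kz]]; exists k => //; split=> //; apply: (swaps_cls (K0e kK) xx).
have Qstep x x' y : ~~ e x z0 -> ~~ e y z0 -> ~~ e x' z0 -> ~~ e x' y -> ~~ e x y -> Q x y -> Q x' y.
  move=> xz yz xz' xy' xy qxy; have [xx|xx] := boolP (e x x'); first exact: Qc qxy.
  have [k kK [k1 k2 k3]] := K0s xx; have ke := K0e kK; case: qxy => u uK [us uz].
  have ky : e y (k y) by apply: k1.
  have kz : e z0 (k z0) by apply: k1.
  exists (u ^ k); first exact: groupJ.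
  split.
    have := swapsJ ke us => s1; have uke := K0e (groupJ uK kK).
    apply: (swaps_cls uke (x := k x)); first by rewrite eqv_sym.
    apply/swaps_sym/(swaps_cls uke (x := k y)); first by rewrite eqv_sym.
    exact: swaps_sym.
  (* [k] may send [z0] to its mate, but a permutation preserving [e] and fixing one point of a pair
     fixes the other. *)
  have fixk : (u ^ k) (k z0) = k z0 by rewrite permJ uz.
  move: kz; rewrite pair_relE => /orP[/eqP kz|/eqP kz]; first by rewrite -{1}kz fixk.
  by rewrite kz (mate_comm (K0e (groupJ uK kK))) in fixk; move/(congr1 mate): fixk; rewrite !mateK.
have Q1 x : ~~ e x z0 -> ~~ e x y0 -> Q x y0.
  by move=> xz xy; apply: (Qstep x0) => //; exists t.
have Q2 x y : ~~ e x z0 -> ~~ e y z0 -> ~~ e x y -> Q x y.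
  move=> xz yz xy; have [yy|yy] := boolP (e y y0).
    by apply/Qs/(Qc y0); [rewrite eqv_sym|apply/Qs/Q1 => //; apply: contra xy => h; apply: (eqv_trans ee h); rewrite eqv_sym].
  apply: (Qstep y0) => //; first by rewrite eqv_sym.
  exact/Qs/Q1.
have no k : k \in K0 -> k z0 <> mate z0.
  have [m] := ubnP #|[set w | ~~ e w (k w)]|; elim: m k => // m IH k lem kK kz.
  have [/existsP[w ww]|no] := boolP [exists w, ~~ e w (k w)]; last first.
    have k1 : k = 1.
      by apply: K01 => // z; move: no; rewrite negb_exists => /forallP/(_ z); rewrite negbK.
    by move/eqP: kz; rewrite k1 perm1 eq_sym (negPf (mate_ne _)).
  have ke := K0e kK.
  have kzz : e z0 (k z0) by rewrite kz mate_rel.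
  have wz : ~~ e w z0.
    apply: contra ww => wz; apply: (eqv_trans ee wz); apply: (eqv_trans ee kzz); rewrite ke eqv_sym //.
  have kwz : ~~ e (k w) z0.
    by apply: contra wz => h; rewrite -(ke w z0); apply: (eqv_trans ee h).
  (* This lift brings the pair of [k w] back to that of [w] and fixes [z0], so fewer points change
     pair while [z0] is still sent to its mate. *)
  have [u uK [[u1 u2 u3] uz]] := Q2 (k w) w kwz wz (ltac:(by rewrite eqv_sym)).
  have ue := K0e uK.
  apply: (IH (k * u)); last 2 first.
  - exact: groupM.
  - by rewrite permM kz (mate_comm ue) uz.
  apply: leq_trans (_ : #|[set w | ~~ e w (k w)]| <= m) => //.
  apply: proper_card; apply/properP; split; last by exists w; rewrite inE ?ww // permM negbK.
  apply/subsetP=> s; rewrite !inE permM; apply: contra => sks.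
  have ws : ~~ e w s.
    apply: contra ww => ws; apply: (eqv_trans ee ws); apply: (eqv_trans ee sks); rewrite ke eqv_sym //.
  apply: (eqv_trans ee sks); apply: u1; first by rewrite ke.
  by apply: contra ws => wks; apply: (eqv_trans ee wks); rewrite eqv_sym.
have [k kK kz] := tK z0 (mate z0) (in_setT _) (in_setT _).
exact: (no k kK kz).
Qed.
End Transposition_lifts.
End Pairs.

Definition has_dflips (T : finType) (e : rel T) (L : {set {perm T}}) :=
  forall x y, ~~ e x y -> dflip e x y \in L.

(** * Maximal subgroups of the stabilizer of a pairing *)

Section PairMax.
Variables (T : finType) (alt : bool) (G : {group {perm T}}) (e : rel T).
Implicit Types (x y z : T) (g h k v : {perm T}).
Hypothesis hG : forall g, (g \in G) = ~~ (alt && odd_perm g).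
Hypothesis ee : equivalence_rel e.
Hypothesis c2 : forall x, #|cls e x| = 2.
Hypothesis nall : exists x y, ~~ e x y.
Hypothesis T6 : 6 <= #|T|.
Local Notation p := (mate e).
Local Notation M := (rstab_group G e).

Lemma pair_avoid (S : seq T) : size S < #|T| -> exists x, x \notin S.
Proof.
move=> h; have [/existsP[x xS]|no] := boolP [exists x, x \notin S]; first by exists x.
move: h; rewrite ltnNge -cardsT; have -> // : #|[set: T]| <= size S.
apply: leq_trans (card_size S); apply/subset_leq_card/subsetP=> x _.
by move: no; rewrite negb_exists => /forallP/(_ x); rewrite negbK.
Qed.

Lemma third x y : exists z, ~~ e x z /\ ~~ e y z.
Proof.
have [z] : exists z, z \notin [:: x; p x; y; p y] by apply: pair_avoid; apply: leq_trans T6.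
by rewrite !inE !negb_or => /and4P[h1 h2 h3 h4]; exists z; rewrite !(pair_relE ee c2) !negb_or h1 h2 h3.
Qed.

Definition evker := [set g in bker G e | ~~ odd_perm g].
Lemma evkerP g : reflect (~~ odd_perm g /\ forall x, e x (g x)) (g \in evker).
Proof.
rewrite [_ \in evker]in_set; apply: (iffP andP) => [[/(bkerP _ ee)[_ h] o]|[o h]]; first by split.
by split=> //; apply/(bkerP _ ee); split=> //; rewrite hG (negPf o) andbF.
Qed.
Lemma evker_group_set : group_set evker.
Proof.
apply/group_setP; split; first by apply/evkerP; rewrite odd_perm1; split=> // x; rewrite perm1 (eqv_refl ee).
move=> g h /evkerP[go gk] /evkerP[ho hk]; apply/evkerP; split.
  by rewrite odd_permM (negPf go) (negPf ho).
by move=> x; rewrite permM; apply: (eqv_trans ee (gk x) (hk _)).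
Qed.
Canonical evker_group := Group evker_group_set.

Lemma dflip_ev x y : dflip e x y \in evker.
Proof. by apply/evkerP; rewrite odd_dflip //; split=> // z; apply: dflip_e. Qed.

Lemma evker_norm (L : {group {perm T}}) : L \subset M -> L \subset 'N(evker).
Proof.
move=> /subsetP LM; apply/subsetP=> m mL; rewrite inE.
apply/subsetP=> _ /imsetP[g /evkerP[go gk] ->]; have /rstabP[_ me] := LM m mL.
apply/evkerP; rewrite odd_permJ; split=> // x.
by rewrite -{1}(permKV m x) -[X in (g ^ m) X](permKV m) permJ me.
Qed.

Lemma evkerM : evker \subset M.
Proof.
apply/subsetP=> g /evkerP[go gk]; apply/rstabP; split; first by rewrite hG (negPf go) andbF.
exact: in_pres.
Qed.

Lemma swpM x y : ~~ e x y -> swp e x y \in M.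
Proof. by move=> xy; apply/rstabP; rewrite hG (odd_swp ee c2 xy) andbF; split=> //; apply: swp_pres. Qed.

Lemma dflip_mul x y z : dflip e x y * dflip e y z = dflip e x z.
Proof. by rewrite /dflip mulgA -(mulgA (flip e x)) tperm2 mulg1. Qed.

Lemma dflip_ne x y : ~~ e x y -> dflip e x y x = p x.
Proof.
move=> xy; rewrite permM !(flipE ee c2) eqv_refl // (_ : e y (p x) = false) //.
by apply/negbTE; apply: contra xy => h; rewrite eqv_sym //; apply: (eqv_trans ee h); rewrite eqv_sym // mate_rel.
Qed.

Section Max.
Variable K : {group {perm T}}.
Hypotheses (KM : K \subset M) (tK : ptrans K setT).
Hypothesis mx : forall L : {group {perm T}}, K \subset L -> L \subset M -> L \subset K \/ M \subset L.
Let Ke k : k \in K -> forall x y, e (k x) (k y) = e x y.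
Proof. by move=> /(subsetP KM)/rstabP[]. Qed.

(** If [M] is the product, every exchange of two pairs has a lift [k] in [K]. A kernel element [v]
    flipping the pair of [x'] but not that of [y'] gives [v * v ^ k], which is [dflip e x' y'];
    products of such elements are all the double flips. *)
Lemma pair_cases : has_dflips e K \/
  [/\ forall m, m \in M -> exists2 k, k \in K & exists2 q, q \in evker & m = k * q &
      forall v, v \in K -> (forall z, e z (v z)) -> v = 1 \/ forall z, v z = p z].
Proof.
case: (mem_mulN KM mx evkerM (evker_norm KM)) => [sub|lift].
  by left=> x y xy; apply: (subsetP sub); apply: dflip_ev.
have [h|no] := boolP [forall x, forall y, ~~ e x y ==> (dflip e x y \in K)].
  by left=> x y xy; move/forallP/(_ x)/forallP/(_ y): h; rewrite xy.
right; split=> // v vK ve.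
pose f z := v z != z.
have vE z : v z = if f z then p z else z.
  rewrite /f; have [//|vz] := eqVneq (v z) z.
  by case: (bker_flip ee c2 z ve) => // h; rewrite h eqxx in vz.
have vc := mate_comm ee c2 (in_pres ee ve).
have fc z w : e z w -> f z = f w.
  rewrite (pair_relE ee c2) /f => /orP[]/eqP-> //; rewrite vc.
  by rewrite (inj_eq (can_inj (mateK ee c2))).
have [/existsP[x fx]|nox] := boolP [exists x, f x]; last first.
  left; apply/permP=> z; rewrite perm1 vE.
  by move: nox; rewrite negb_exists => /forallP/(_ z)/negPf->.
have [/existsP[y fy]|noy] := boolP [exists y, ~~ f y]; last first.
  right=> z; rewrite vE.
  by move: noy; rewrite negb_exists => /forallP/(_ z); rewrite negbK => ->.
case/negP: no.
have key x' y' : f x' -> ~~ f y' -> dflip e x' y' \in K.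
  move=> fx' fy'; have xy : ~~ e x' y' by apply/negP=> /fc; rewrite fx' (negPf fy').
  set s := swp e x' y'.
  have [k kK [q /evkerP[_ qk] sE]] := lift _ (swpM xy).
  have ks z : e (k z) (s z) by rewrite /s sE permM.
  have [s1 s2 s3] := swp_swaps ee c2 xy; have se := swp_pres ee c2 xy.
  rewrite -/s in s1 s2 s3 se; have ke := Ke kK.
  suff -> : dflip e x' y' = v * v ^ k by rewrite groupM ?groupJ.
  apply/permP=> z; set u := k^-1 (v z).
  have ku : k u = v z by rewrite permKV.
  have zu : e z (s u) by apply: (eqv_trans ee (ve z)); rewrite -ku.
  have -> : (v * v ^ k) z = if f u then p (v z) else v z.
    rewrite permM -{1}ku permJ vE; case: ifP => _ //.
    by rewrite (mate_comm ee c2 ke) ku.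
  have xu : e x' z = e y' u by rewrite eqv_sym // (eqv_congr ee zu) eqv_sym // (eqv_congr ee s3) se.
  have yu : e y' z = e x' u by rewrite eqv_sym // (eqv_congr ee zu) eqv_sym // (eqv_congr ee s2) se.
  rewrite permM !(flipE ee c2) xu.
  have [yu'|nyu] := boolP (e y' u).
    have xz : e x' z by rewrite xu.
    have -> : e y' (p z) = false.
      apply/negbTE; apply: contra xy => h; apply: (eqv_trans ee xz).
      by rewrite eqv_sym //; apply: (eqv_trans ee h); rewrite eqv_sym // mate_rel.
    by rewrite -(fc _ _ yu') (negPf fy') vE -(fc _ _ xz) fx'.
  rewrite yu; have [xu'|nxu] := boolP (e x' u).
    have yz : e y' z by rewrite yu.
    by rewrite -(fc _ _ xu') fx' vE -(fc _ _ yz) (negPf fy').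
  rewrite (fc u z); first by case fz: (f z); rewrite vE fz // mateK.
  by apply: (eqv_trans ee (s1 u nxu nyu)); rewrite eqv_sym.
have key' x' y' : ~~ f x' -> f y' -> dflip e x' y' \in K.
  by move=> h1 h2; rewrite -[dflip e x' y']invgK groupV invMg !tpermV; apply: key.
apply/forallP=> a; apply/forallP=> b; apply/implyP=> ab.
have [fa|fa] := boolP (f a); have [fb|fb] := boolP (f b).
- by rewrite -(dflip_mul a y b); apply: groupM; [apply: key|apply: key'].
- exact: key.
- exact: key'.
- by rewrite -(dflip_mul a x b); apply: groupM; [apply: key'|apply: key].
Qed.

(** The flip of all pairs at once, centralized by every permutation preserving [e]. *)
Definition cperm := perm (can_inj (mateK ee c2)).
Lemma cpermE z : cperm z = p z. Proof. by rewrite permE. Qed.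

Lemma odd_cperm : odd_perm cperm = odd #|T|./2.
Proof.
by apply: odd_fpf_invol => z; rewrite !cpermE ?mate_ne // mateK.
Qed.

Lemma lift_swaps : (forall m, m \in M -> exists2 k, k \in K & exists2 q, q \in evker & m = k * q) ->
  forall x y, ~~ e x y -> exists2 k, k \in K & swaps e k x y.
Proof.
move=> lift x y xy; have [k kK [q /evkerP[_ qk] sE]] := lift _ (swpM xy).
have ks z : e (swp e x y z) (k z) by rewrite sE permM eqv_sym.
have [h1 h2 h3] := swp_swaps ee c2 xy; exists k => //.
by split=> [z xz yz| |]; [apply: (eqv_trans ee (h1 z xz yz))|apply: (eqv_trans ee h2)|apply: (eqv_trans ee h3)]; apply: ks.
Qed.

(** Without [cperm], [K] meets the kernel trivially. If the number of pairs is odd,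
    [lifts_not_trans] contradicts transitivity. If it is even, [cperm] is in [M], and [M] would be
    [K] times a group of order two, so a double flip would be 1 or [cperm]; a third pair forbids
    this. *)
Lemma alt_pairs : alt -> ~ has_dflips e K -> ~~ odd #|T|./2 /\ cperm \in K.
Proof.
move=> altT nd; case: pair_cases => // -[lift k1].
have cK : cperm \in K.
  apply/negPn/negP => cK.
  have k1' k : k \in K -> (forall z, e z (k z)) -> k = 1.
    move=> kK ke; case: (k1 k kK ke) => // kp; case/negP: cK.
    by rewrite (_ : cperm = k) //; apply/permP=> z; rewrite cpermE kp.
  have Ko k : k \in K -> ~~ odd_perm k.
    by move=> /(subsetP KM)/rstabP[]; rewrite hG altT.
  have [bo|bo] := boolP (odd #|T|./2).
    exact: (lifts_not_trans ee c2 Ke Ko k1' (lift_swaps lift) bo nall tK).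
  have cM : cperm \in M.
    apply/rstabP; rewrite hG odd_cperm (negPf bo) andbF; split=> //.
    by apply: in_pres => // t; rewrite cpermE mate_rel.
  have cyE q : q \in <[cperm]> -> q = 1 \/ q = cperm.
    case/cycleP=> i ->; elim: i => [|i]; first by left.
    rewrite expgSr => -[->|->]; first by right; rewrite mul1g.
    by left; apply/permP=> z; rewrite permM !cpermE mateK // perm1.
  case: (mem_mulN (P := <[cperm]>%G) KM mx); first by rewrite /= cycle_subG.
  - apply/subsetP=> k kK; rewrite inE -cycleJ cycle_subG.
    suff -> : cperm ^ k = cperm by rewrite cycle_id.
    apply/permP=> z; rewrite -{1}(permKV k z) permJ !cpermE.
    by rewrite (mate_comm ee c2 (Ke kK)) permKV.
  - by rewrite /= cycle_subG (negPf cK).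
  move=> h; have [x [y xy]] := nall.
  have [k kK [q qc dE]] := h _ (subsetP evkerM _ (dflip_ev x y)).
  have qe z : e z (q z) by case: (cyE q qc) => ->; rewrite ?perm1 ?eqv_refl ?cpermE ?mate_rel.
  have kE : k = 1.
    apply: k1' => // z; have := dflip_e ee c2 x y z; rewrite dE permM => /(eqv_trans ee); apply.
    by rewrite eqv_sym.
  have [z [xz yz]] := third x y.
  have dz : dflip e x y z = z by rewrite permM !(flipE ee c2) (negPf xz) (negPf yz).
  move: dE; rewrite kE mul1g; case: (cyE q qc) => -> dE.
    by have := dflip_ne xy; rewrite dE perm1 => /eqP; rewrite eq_sym (negPf (mate_ne c2 _)).
  by move: dz; rewrite dE cpermE => /eqP; rewrite (negPf (mate_ne c2 _)).
split=> //; have := subsetP KM _ cK => /rstabP[]; rewrite hG altT odd_cperm //.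
Qed.

End Max.

Lemma prim_move (B : {group {perm T}}) : prim B -> exists2 g, g \in B & exists x, g (p x) != p (g x).
Proof.
move=> pB; have [/exists_inP[g gB /existsP[x gx]]|no] :=
  boolP [exists g in B, exists x, g (p x) != p (g x)]; first by exists g => //; exists x.
have Be : einv B e.
  move=> g gB x y; rewrite !(pair_relE ee c2) (inj_eq perm_inj).
  move: no; rewrite negb_exists_in => /forall_inP/(_ g gB); rewrite negb_exists => /forallP/(_ x).
  by rewrite negbK => /eqP <-; rewrite (inj_eq perm_inj).
have [x [y xy]] := nall.
case: (pB e ee Be) => h; last by rewrite h in xy.
by have /eqP := h _ _ (mate_rel c2 x); rewrite eq_sym (negPf (mate_ne c2 x)).
Qed.

(** Some [g] in [B] does not preserve the pairing, so [B] has the double flips of a second pairing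
    [q] as well. One double flip for each pairing, with only [x] in common, gives a 3-cycle by
    [comm_cyc3]. *)
Lemma prim_dfl (B : {group {perm T}}) : 10 <= #|T| -> prim B -> has_dflips e B -> has_cyc3 B.
Proof.
move=> T10 pB dB; have [g gB [x0 gx]] := prim_move pB.
pose q z := g (p (g^-1 z)); pose x := g x0.
have qx : q x != p x by rewrite /q permK.
have qne z : q z != z by rewrite /q -{2}(permKV g z) (inj_eq perm_inj) mate_ne.
have qK z : q (q z) = z by rewrite /q permK mateK // permKV.
have [y] := @pair_avoid [:: x; p x; q x; p (q x)] (leq_trans (isT : 4 < 10) T10).
rewrite !inE !negb_or => /and4P[y1 y2 y3 y4].
(* Neither [u] nor [q u] may be one of the four points moved by the first double flip: up to eight
   points are excluded, which explains the bound on the degree. *)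
have [u] := @pair_avoid [:: x; q x; p x; q (p x); y; q y; p y; q (p y)] (leq_trans (isT : 8 < 10) T10).
rewrite !inE !negb_or => /and4P[u1 u2 u3 /and5P[u4 u5 u6 u7 u8]].
have xy : ~~ e x y by rewrite (pair_relE ee c2) negb_or y1.
have UB := dB _ _ xy.
have xu : ~~ e (g^-1 x) (g^-1 u).
  rewrite (pair_relE ee c2) negb_or (inj_eq perm_inj) u1 /=.
  by apply: contra u2 => /eqP h; rewrite /q -h permKV.
have VB := groupJ (dB _ _ xu) gB.
have pq a b : (p a == b) = (a == p b) by apply/eqP/eqP => [<-|->]; rewrite mateK.
have qq a b : (q a == b) = (a == q b) by apply/eqP/eqP => [<-|->]; rewrite qK.
have VE : (dflip e (g^-1 x) (g^-1 u)) ^ g = tperm x (q x) * tperm u (q u).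
  by rewrite conjMg !tpermJ !permKV.
case: (@comm_cyc3 _ (dflip e x y) ((dflip e (g^-1 x) (g^-1 u)) ^ g) x).
- by rewrite dflip_ne // mate_ne.
- rewrite VE permM tpermL tpermD //.
  by rewrite qq qK.
- move=> z zx.
  have [ez|ez] := boolP (e x z || e y z); last first.
    by left; move: ez; rewrite negb_or permM !(flipE ee c2) => /andP[/negPf-> /negPf->].
  right; rewrite VE permM.
  have [zu zqu] : z != u /\ z != q u.
    case/orP: ez; rewrite (pair_relE ee c2) => /orP[]/eqP zE; rewrite zE.
    + by rewrite zE eqxx in zx.
    + by split; [rewrite eq_sym|rewrite -qq eq_sym].
    + by split; [rewrite eq_sym|rewrite -qq eq_sym].
    + by split; [rewrite eq_sym|rewrite -qq eq_sym].
  have zqx : z != q x.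
    case/orP: ez; rewrite (pair_relE ee c2) => /orP[]/eqP zE; rewrite zE.
    + by rewrite eq_sym.
    + by rewrite eq_sym.
    + by [].
    + by rewrite pq.
  rewrite (@tpermD _ x (q x) z); first by rewrite tpermD // eq_sym.
    by rewrite eq_sym.
  by rewrite eq_sym.
move=> a [b [xa xb ab cE]]; exists x, a, b; split=> //.
by rewrite -cE groupR.
Qed.

Lemma dflipE x y z : ~~ e x y -> dflip e x y z = if e x z || e y z then p z else z.
Proof.
move=> xy; rewrite permM !(flipE ee c2); case: (boolP (e x z)) => [xz|//] /=.
rewrite (_ : e y (p z) = false) //; apply/negbTE; apply: contra xy => h; apply: (eqv_trans ee xz).
by rewrite eqv_sym //; apply: (eqv_trans ee h); rewrite eqv_sym // mate_rel.
Qed.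

(** For [f]-related [x] and [s] in different pairs, a double flip moving [x] and not [s] makes the
    mate of [x] [f]-related to [s], hence to [x]. *)
Lemma pair_imprim (L : {group {perm T}}) (f : rel T) : proper_eq f -> einv L f ->
  (forall x y, e x y -> f x y -> x = y) -> ~ has_dflips e L.
Proof.
move=> [ff [x [s [xs fxs]]] _] Lf tr dL.
have exs : ~~ e x s by apply: contra xs => /tr->.
have [y [xy sy]] := third x s.
have := Lf _ (dL _ _ xy) x s; rewrite !dflipE // eqv_refl // (negPf exs) (eqv_sym ee y s) (negPf sy) fxs => h.
have fxp : f x (p x) by apply: (eqv_trans ff fxs); rewrite eqv_sym.
by have /eqP := tr _ _ (mate_rel c2 x) fxp; rewrite eq_sym (negPf (mate_ne c2 x)).
Qed.

(** * Pairings of six points in the alternating group *)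

Section Six.
Hypotheses (altT : alt) (T6' : #|T| = 6).

Lemma six_four x y z t : ~~ e x y -> ~~ e x z -> ~~ e y z -> [|| e x t, e y t | e z t].
Proof.
move=> xy xz yz; have := max_card [in [:: x; p x; y; p y; z; p z; t]].
rewrite T6' => h; apply: contraTT h; rewrite !negb_or !(pair_relE ee c2) !negb_or => /and3P[/andP[tx tpx] /andP[ty tpy] /andP[tz tpz]].
have [a1 a2 a3 a4] := mate_neq ee c2 xy; have [b1 b2 b5 b4] := mate_neq ee c2 xz.
have [d1 d2 d3 d4] := mate_neq ee c2 yz.
have := mate_ne c2 x; have := mate_ne c2 y; have := mate_ne c2 z => h1 h2 h3.
rewrite -ltnNge (card_uniqP _) //= !inE; rwneq; done.
Qed.

Lemma six_eq x y z g h : ~~ e x y -> ~~ e x z -> ~~ e y z ->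
  (forall x y, e (g x) (g y) = e x y) -> (forall x y, e (h x) (h y) = e x y) ->
  g x = h x -> g y = h y -> g z = h z -> g = h.
Proof.
move=> xy xz yz ge he gx gy gz; apply/permP=> t.
have gc := mate_comm ee c2 ge; have hc := mate_comm ee c2 he.
by case/or3P: (six_four t xy xz yz); rewrite (pair_relE ee c2) => /orP[]/eqP->; rewrite ?gc ?hc ?gx ?gy ?gz.
Qed.

(** An element [h] sending [x] to its mate preserves or exchanges the two other pairs. Being even,
    it is a double flip in the first case and has one as square in the second; transitivity yields
    the others. *)
Lemma six_dfl (H : {group {perm T}}) : H \subset M -> ptrans H setT -> has_dflips e H.
Proof.
move=> /subsetP HM tH.
have He h : h \in H -> forall x y, e (h x) (h y) = e x y by move=> /HM/rstabP[].
have Ho h : h \in H -> ~~ odd_perm h by move=> /HM/rstabP[]; rewrite hG altT.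
have fe x := flip_e ee c2 x; have pe x := in_pres ee (fe x).
have [/existsP[x /existsP[y /andP[xy dH]]]|no] := boolP [exists x, exists y, ~~ e x y && (dflip e x y \in H)].
  have [z [xz yz]] := third x y.
  move=> a b ab; have [w [aw bw]] := third a b.
  have [h hH hz] := tH z w (in_setT _) (in_setT _).
  have he := He h hH; have := groupJ dH hH; rewrite dflipJ //.
  suff -> : dflip e (h x) (h y) = dflip e a b by [].
  have hw u : e u z = e (h u) w by rewrite -hz he.
  apply: (six_eq ab aw bw); try by apply: in_pres => // t; apply: dflip_e.
  - rewrite !dflipE ?he // eqv_refl // orTb.
    have := six_four a (_ : ~~ e (h x) (h y)) (_ : ~~ e (h x) w) (_ : ~~ e (h y) w).
    rewrite he -!hw => /(_ xy xz yz); rewrite (eqv_sym ee w a) (negPf aw) orbF => -> //.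
  - rewrite !dflipE ?he // eqv_refl // orbT.
    have := six_four b (_ : ~~ e (h x) (h y)) (_ : ~~ e (h x) w) (_ : ~~ e (h y) w).
    rewrite he -!hw => /(_ xy xz yz); rewrite (eqv_sym ee w b) (negPf bw) orbF => -> //.
  - by rewrite !dflipE ?he // -!hw (negPf xz) (negPf yz) (negPf aw) (negPf bw).
have {}no x y : ~~ e x y -> dflip e x y \notin H.
  by move=> xy; move: no; rewrite negb_exists => /forallP/(_ x); rewrite negb_exists => /forallP/(_ y); rewrite xy.
have [x [y xy]] := nall; have [h hH hx] := tH x (p x) (in_setT _) (in_setT _).
have [z [xz yz]] := third x y.
have he := He h hH; have hc := mate_comm ee c2 he; have ho := Ho h hH.
have dp a b : forall x y, e (dflip e a b x) (dflip e a b y) = e x y.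
  by apply: in_pres => // t; apply: dflip_e.
have exx a : e x (h a) = e x a by rewrite -(he x a) hx (eqv_congr ee (mate_rel c2 x)).
have flipy a b : ~~ e a b -> flip e a b = b by move=> h1; rewrite (flipE ee c2) (negPf h1).
have flipx a : flip e a a = p a by rewrite (flipE ee c2) eqv_refl.
have yx : ~~ e y x by rewrite eqv_sym.
have zx : ~~ e z x by rewrite eqv_sym.
have zy : ~~ e z y by rewrite eqv_sym.
have ypx : ~~ e y (p x) by rewrite eqv_sym // -(eqv_congr ee (mate_rel c2 x)).
have zpx : ~~ e z (p x) by rewrite eqv_sym // -(eqv_congr ee (mate_rel c2 x)).
have zpy : ~~ e z (p y) by rewrite eqv_sym // -(eqv_congr ee (mate_rel c2 y)).
have [eyy|nyy] := boolP (e y (h y)).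
  have ezz : e z (h z).
    have := six_four (h z) xy xz yz; rewrite exx (negPf xz) /= => /orP[h1|//].
    by case/negP: yz; rewrite -he; rewrite -(eqv_congr ee eyy).
  have hy : h y = y \/ h y = p y by move: eyy; rewrite (pair_relE ee c2) => /orP[]/eqP; [left|right].
  have hz : h z = z \/ h z = p z by move: ezz; rewrite (pair_relE ee c2) => /orP[]/eqP; [left|right].
  case: hy hz => hy [] hz.
  - case/negP: ho; rewrite (_ : h = flip e x) ?(odd_flip c2) //.
    by apply: (six_eq xy xz yz he (pe x)); rewrite ?hx ?hy ?hz ?flipx ?flipy.
  - case/negP: (no x z xz); rewrite (_ : dflip e x z = h) //.
    by apply: (six_eq xy xz yz (dp _ _) he); rewrite ?hx ?hy ?hz dflipE // ?eqv_refl ?(negPf xy) ?(negPf zy) ?orbT.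
  - case/negP: (no x y xy); rewrite (_ : dflip e x y = h) //.
    by apply: (six_eq xy xz yz (dp _ _) he); rewrite ?hx ?hy ?hz dflipE // ?eqv_refl ?(negPf xz) ?(negPf yz) ?orbT.
  - case/negP: ho; rewrite (_ : h = dflip e x y * flip e z) ?odd_permM ?(odd_flip c2) ?odd_dflip //.
    apply: (six_eq xy xz yz he).
    + by move=> a b; rewrite permM (permM _ _ b) pe dp.
    + by rewrite hx permM dflipE // eqv_refl // flipy.
    + by rewrite hy permM dflipE // eqv_refl // orbT flipy.
    + by rewrite hz permM dflipE // (negPf xz) (negPf yz) flipx.
have xhy : ~~ e x (h y) by rewrite exx.
set z' := h y in nyy xhy.
have hz : e y (h z').
  have := six_four (h z') xy xhy nyy; rewrite exx (negPf xhy) /= => /orP[//|h1].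
  by case/negP: nyy; rewrite -he -/z'; exact: h1.
have zy' : ~~ e z' y by rewrite eqv_sym.
move: hz; rewrite (pair_relE ee c2) => /orP[]/eqP hz.
  case/negP: ho; rewrite (_ : h = flip e x * swp e y z').
    by rewrite odd_permM (odd_flip c2) (odd_swp ee c2 nyy).
  have sx : swp e y z' (p x) = p x.
    have [h1 h2 h3 h4] := mate_neq ee c2 (ltac:(by rewrite eqv_sym) : ~~ e x y).
    have [h5 h6 h7 h8] := mate_neq ee c2 xhy.
    by rewrite (swpE ee c2) //; rwneq.
  apply: (six_eq xy xhy nyy he).
  + by move=> a b; rewrite permM (permM _ _ b) (swp_pres ee c2) ?pe.
  + by rewrite hx permM flipx sx.
  + by rewrite permM flipy // (swpE ee c2) // eqxx.
  + have [h1 _ _ _] := mate_neq ee c2 nyy; rewrite hz permM flipy // (swpE ee c2) //.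
    by rwneq.
case/negP: (no y z' nyy); rewrite (_ : dflip e y z' = h * h) ?groupM //.
apply: (six_eq xy xhy nyy (dp _ _)).
+ by move=> a b; rewrite !permM !he.
+ by rewrite dflipE // (negPf yx) (eqv_sym ee z') (negPf xhy) permM hx hc hx mateK.
+ by rewrite dflipE // eqv_refl // permM -/z' hz.
+ by rewrite dflipE // eqv_refl // orbT permM hz hc.
Qed.

(** Transitivity and a double flip fixing [x] give [H] at least 12 elements, and two proper
    inclusions give [M] at least 48. But an element of [M] is determined by the images of [x] and
    [y], for which there are 6 times 4 choices. *)
Lemma six_absurd (H K : {group {perm T}}) : H \subset K -> K \subset M -> ~ K \subset H -> ~ M \subset K ->
  ptrans H setT -> False.
Proof.
move=> HK KM KH MK tH; have dH := six_dfl (subset_trans HK KM) tH.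
have [x [y xy]] := nall; have [z [xz yz]] := third x y.
have H12 : 12 <= #|H|.
  rewrite -(card_orbit_stab 'P H x).
  have -> : orbit 'P H x = setT.
    apply/setP=> t; rewrite inE; apply/orbitP; have [h hH ht] := tH x t (in_setT _) (in_setT _).
    by exists h.
  suff : 1 < #|'C_H[x | 'P]| by rewrite cardsT T6'; move: #|_| => c; clear; lia.
  apply: (@leq_trans #|[set 1; dflip e y z]|).
    rewrite cards2 (_ : 1 != _) //; apply/eqP=> h1; have := dflip_ne yz.
    by rewrite -h1 perm1 => /eqP; rewrite eq_sym (negPf (mate_ne c2 y)).
  apply/subset_leq_card/subsetP=> g; rewrite in_set2 => /orP[]/eqP->; apply/setIP; split.
  - exact: group1.
  - by apply/astab1P; rewrite /= /aperm perm1.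
  - exact: dH.
  by apply/astab1P; rewrite /= /aperm dflipE // !(eqv_sym ee _ x) (negPf xy) (negPf xz).
have K24 := double_card HK KH; have M48 := double_card KM MK.
suff : #|M| <= 24.
  apply/negP; rewrite -ltnNge; apply: leq_trans M48; apply: leq_trans (_ : 24.*2 <= _) => //.
  by rewrite leq_double; apply: leq_trans K24; rewrite (@leq_double 12).
have inj : {in M &, injective (fun m : {perm T} => (m x, m y))}.
  move=> m m' mM mM' [mx my]; have /rstabP[mo me] := mM; have /rstabP[mo' me'] := mM'.
  (* The images of [x] and [y] determine that of [z] up to its mate, and evenness decides which. *)
  have : e (m z) (m' z).
    have := six_four (m' z) (_ : ~~ e (m x) (m y)) (_ : ~~ e (m x) (m z)) (_ : ~~ e (m y) (m z)).
    by rewrite !me => /(_ xy xz yz); rewrite {1}mx {1}my !me' (negPf xz) (negPf yz).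
  rewrite (pair_relE ee c2) => /orP[]/eqP mz; first exact: (six_eq xy xz yz).
  have : m' = flip e z * m.
    apply: (six_eq xy xz yz) => //.
    - by move=> a b; rewrite !permM me (in_pres ee (flip_e ee c2 z)).
    - by rewrite permM (flipE ee c2) eqv_sym // (negPf xz).
    - by rewrite permM (flipE ee c2) eqv_sym // (negPf yz).
    - by rewrite permM (flipE ee c2) eqv_refl // (mate_comm ee c2 me).
  move=> mE; move: mo'; rewrite mE hG altT odd_permM (odd_flip c2) /= negbK.
  by move: mo; rewrite hG altT /= => /negPf->.
rewrite -(card_in_imset inj).
apply: (@leq_trans #|[set uv : T * T | ~~ e uv.1 uv.2]|).
  apply/subset_leq_card/subsetP=> _ /imsetP[m /rstabP[_ me] ->].
  by rewrite inE /= me.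
have -> : #|[set uv : T * T | ~~ e uv.1 uv.2]| = \sum_u \sum_(v | ~~ e u v) 1.
  by rewrite pair_big_dep -sum1_card; apply: eq_bigl => uv; rewrite inE.
rewrite (eq_bigr (fun _ => 4)) ?sum_nat_const ?T6' // => u _.
have := cardsC (cls e u); rewrite c2 T6' => h.
have <- : #|~: cls e u| = 4 by lia.
by rewrite -sum1_card; apply: eq_bigl => t; rewrite !inE.
Qed.
End Six.

End PairMax.

(** * Pairings in the symmetric group *)

Section PairB3.
Variables (T : finType) (G : {group {perm T}}) (e : rel T).
Implicit Types (x y z : T) (g h k v : {perm T}).
Hypothesis hG : forall g, (g \in G) = ~~ (false && odd_perm g).
Hypothesis pe : proper_eq e.
Hypothesis c2 : forall x, #|cls e x| = 2.
Hypothesis T6 : 6 <= #|T|.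
Let ee : equivalence_rel e. Proof. by case: pe. Qed.
Let nall : exists x y, ~~ e x y. Proof. by case: pe. Qed.
Local Notation A := (rstab_group G e).
Local Notation p := (mate e).
Variables B C : {group {perm T}}.
Hypothesis b : boolean_triple G A B C.

(** The pairs whose transposition lies in [L] form an invariant equivalence relation, so [L] has all
    the transpositions. *)
Lemma tperm_prim (L : {group {perm T}}) x y : prim L -> x != y -> tperm x y \in L -> has_cyc3 L.
Proof.
move=> pL xy tL; pose r a c := tperm a c \in L.
have rE : equivalence_rel r.
  apply: eqrelP; rewrite /r.
  - by move=> a; rewrite tperm1 group1.
  - by move=> a c; rewrite tpermC.
  - move=> c a d ac cd; have [->|ad] := eqVneq a d; first by rewrite tperm1 group1.
    have [cE|cd'] := eqVneq c d; first by rewrite -cE.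
    have [aE|ac'] := eqVneq a c; first by rewrite aE.
    by have := groupJ ac cd; rewrite tpermJ tpermL tpermD // eq_sym.
have [|h|h] := pL r rE.
- by move=> g gL a c; rewrite /r -tpermJ memJ_norm // (subsetP (normG L)).
- by move/eqP: (h _ _ tL); rewrite (negPf xy).
have [z] : exists z, z \notin [:: x; y] by apply: pair_avoid; apply: leq_trans T6.
rewrite !inE negb_or => /andP[zx zy]; exists x, y, z; split; rewrite // 1?eq_sym //.
by rewrite /cyc3 groupM; try exact: h.
Qed.

(** Otherwise the lift of one flip is an odd kernel element, hence the flip of all pairs, and the
    even part [K0] of [K] meets the kernel trivially. By [lifts_not_trans] it is intransitive. Its
    orbits form a [K]-invariant relation [f], whose stabilizer cannot lie in [A] or [B], nor be
    [G]. *)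
Lemma pair_sym_dfl : ptrans (A :&: B) setT -> bad e B -> has_dflips e (A :&: B).
Proof.
move=> tK bB; have KM : A :&: B \subset A by apply: subsetIl.
case: (pair_cases hG ee c2 (K := [group of A :&: B]) KM) => //=.
  by move=> L KL LM; apply: (triple_max b).
case=> lift k1; set K := A :&: B in tK KM lift k1 *.
have Ke k : k \in K -> forall x y, e (k x) (k y) = e x y.
  by move=> /(subsetP KM)/rstabP[].
have flM x : flip e x \in A.
  apply/rstabP; rewrite hG; split=> //; apply: in_pres => // t; exact: flip_e.
exfalso.
have [x0 [y0 xy0]] := nall.
have [k kK [q /(evkerP hG ee)[qo qk] fE]] := lift _ (flM x0).
have ke z : e z (k z).
  by have := flip_e ee c2 x0 z; rewrite fE permM => h; apply: (eqv_trans ee h); rewrite eqv_sym.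
have kodd : odd_perm k.
  have := odd_flip c2 x0; rewrite fE odd_permM (negPf qo) addbF //.
have kp z : k z = p z by case: (k1 k kK ke) => // k0; rewrite k0 odd_perm1 in kodd.
have bodd : odd #|T|./2.
  rewrite -(@odd_fpf_invol _ k) // => z; rewrite !kp; [exact: mate_ne|exact: mateK].
pose K0 := [group of (A :&: B) :&: 'Alt_T].
have K0P g : reflect (g \in K /\ ~~ odd_perm g) (g \in K0).
  by rewrite [_ \in K0]in_setI Alt_even; apply: (iffP andP).
have K0s x y : ~~ e x y -> exists2 k, k \in K0 & swaps e k x y.
  move=> xy; have [l lK ls] := lift_swaps hG ee c2 (K := [group of A :&: B]) lift xy.
  have [lo|lo] := boolP (odd_perm l); last by exists l => //; apply/K0P.
  exists (l * k).
    by apply/K0P; rewrite groupM // odd_permM lo kodd.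
  case: ls => h1 h2 h3; split=> [z xz yz| |]; rewrite permM; last 2 first.
  - exact: (eqv_trans ee h2).
  - exact: (eqv_trans ee h3).
  - exact: (eqv_trans ee (h1 z xz yz)).
have nt0 : ~ ptrans K0 setT.
  apply: (lifts_not_trans ee c2 (K0 := K0)) => //.
  - by move=> g /K0P[gK _]; apply: Ke.
  - by move=> g /K0P[].
  - move=> g /K0P[gK go] ge; case: (k1 g gK ge) => // gp.
    by case/negP: go; rewrite (_ : g = k) //; apply/permP=> z; rewrite gp kp.
pose f x y := [exists g in K0, g x == y].
have fP x y : reflect (exists2 g, g \in K0 & g x = y) (f x y).
  by apply: (iffP exists_inP) => -[g gK /eqP gx]; exists g => //; apply/eqP.
have ff : equivalence_rel f.
  apply: eqrelP.
  - by move=> x; apply/fP; exists 1; rewrite ?group1 ?perm1.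
  - suff h x y : f x y -> f y x by move=> x y; apply/idP/idP; apply: h.
    by move=> /fP[g gK <-]; apply/fP; exists g^-1; rewrite ?groupV ?permK.
  - move=> y x z /fP[g gK <-] /fP[h hK <-]; apply/fP; exists (g * h); rewrite ?groupM ?permM //.
have fi : einv K f.
  have h g x y : g \in K -> f x y -> f (g x) (g y).
    move=> gK /fP[u /K0P[uK uo] <-]; apply/fP; exists (u ^ g).
      by apply/K0P; rewrite groupJ // odd_permJ.
    by rewrite permJ.
  move=> g gK x y; apply/idP/idP; last exact: h.
  move=> /h -/(_ g^-1); rewrite !permK groupV; exact.
have [u uK0 [_ u2 _]] := K0s _ _ xy0.
have nxu : ~~ e x0 (u x0) by apply: contra xy0 => h; apply: (eqv_trans ee h); rewrite eqv_sym.
have fxu : f x0 (u x0) by apply/fP; exists u.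
have nfe : ~ forall x y, e x y = f x y by move=> h; rewrite h fxu in nxu.
have pf : proper_eq f.
  split=> //.
    by exists x0, (u x0); split=> //; apply: contraNneq nxu => <-; rewrite eqv_refl.
  have [/existsP[x /existsP[y xy]]|no] := boolP [exists x, exists y, ~~ f x y]; first by exists x, y.
  case: nt0 => x y _ _; apply/fP; move: no; rewrite negb_exists => /forallP/(_ x).
  by rewrite negb_exists => /forallP/(_ y); rewrite negbK.
have uf := uniform_inv tK fi.
have ue : uniform e by move=> x y; rewrite !c2.
have f3 x : 2 < #|cls f x|.
  rewrite (uf x x0).
  have [z [xz yz]] := third ee c2 T6 x0 (u x0).
  have [w wK0 [w1 w2 _]] := K0s _ _ xz.
  have nyw : ~~ e (u x0) (w x0).
    by apply: contra yz => h; apply: (eqv_trans ee h); rewrite eqv_sym.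
  have nxw : ~~ e x0 (w x0) by apply: contra xz => h; apply: (eqv_trans ee h); rewrite eqv_sym.
  have ne a c : ~~ e a c -> a != c by apply: contraNneq => ->; rewrite eqv_refl.
  apply: (@card_cls_ge _ _ x0 [:: x0; u x0; w x0]); rewrite /= ?inE.
    by rewrite !negb_or (ne _ _ nxu) (ne _ _ nxw) (ne _ _ nyw).
  by rewrite eqv_refl // fxu; apply/andP; split=> //; rewrite andbT; apply/fP; exists w.
have nG : ~ G \subset rstab G f.
  by move=> h; apply: nfe; apply: (rstab_inj hG T6 pe ue pf uf); apply: subset_trans (rstab_sub _ _) h.
case: (triple_above b (L := rstab_group G f)) => //=.
- by apply: sub_rstab => //; apply: subset_trans KM (rstab_sub _ _).
- exact: rstab_sub.
- by move=> h; apply: nfe => x y; rewrite (rstab_inj hG T6 pf uf pe ue h).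
move=> fB; case: bB => [[pB nB]|[f' [pf' iB tr]]].
  apply: nB; have [y xy yx] := @cls_avoid _ f x0 [:: x0] (ltnW (f3 x0)).
  rewrite inE eq_sym in yx; apply: (tperm_prim pB yx); apply: (subsetP fB).
  apply/rstabP; rewrite hG; split=> //; apply: in_pres => // t.
  by case: tpermP => [->|->|_ _]; rewrite ?eqv_refl // eqv_sym.
have uf' : uniform f' by apply: (uniform_inv tK) => g /setIP[_ gB]; apply: iB.
have f'f : forall x y, f x y = f' x y.
  apply: (rstab_inj hG T6 pf uf pf' uf'); apply: subset_trans fB _.
  by apply: sub_rstab => //; case: b => -[].
have BE : B \subset rstab G f.
  by apply: sub_rstab; [case: b => -[]|move=> g gB x y; rewrite !f'f iB].
(* With [f] in place of [e] and [A] in place of [B], [bad3] would force [G] to be alternating. *)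
suff : false /\ (forall x y z, ~~ f x y -> f x z || f y z) /\
  ((full G f [group of A :&: B] /\ (forall x u, u \in [group of A :&: B] -> perm_on (cls f x) u -> u = 1)) \/
   [/\ forall x, #|cls f x| = 4, prim A, ~ has_cyc3 A & forall x, nontriv f [group of A :&: B] x]) by case.
apply: (bad3 hG (e := f) (K := [group of A :&: B]) (B := A)) => //=.
- by apply: subset_trans BE; apply: subsetIr.
- move=> L KL LM; rewrite setIC; case: (triple_max (triple_swap b) (L := L)) => //.
  + by rewrite setIC.
  + exact: subset_trans LM fB.
  + by left.
  + by move=> h; right; apply: subset_trans fB h.
right; exists e; split=> //; first exact: einv_rstab.
by move=> x y; rewrite f'f => h1 h2; apply: tr.
Qed.

Lemma prim_flip (L : {group {perm T}}) x : prim L -> ~ has_cyc3 L -> flip e x \notin L.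
Proof. by move=> pL nL; apply/negP=> /(tperm_prim pL) h; apply: nL; apply: h; rewrite eq_sym mate_ne. Qed.

(** The join of the triple meet with the kernel contains single flips, so it is [A]. In a
    factorization of an element of [A :&: B] the kernel part must be even, since an odd one would
    give a flip in [B]; it is then a product of double flips, hence in [C]. *)
Lemma pair_sym_flips : (forall x, flip e x \notin B) -> (forall x, flip e x \notin C) ->
  has_dflips e B -> has_dflips e C -> False.
Proof.
move=> nB nC dB dC.
have flM x : flip e x \in bker G e.
  by apply/(bkerP _ ee); rewrite hG; split=> //; apply: flip_e.
have [x [y xy]] := nall.
have HA : A :&: B :&: C \subset A by rewrite -setIA subsetIl.
have nker : A :&: B :&: C \subset 'N(bker G e).
  apply/subsetP=> h /(subsetP HA) hA; rewrite inE; apply/subsetP=> _ /imsetP[g gk ->].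
  exact: bkerJ.
pose L := ((A :&: B :&: C) <*> bker_group G ee)%G.
have LA : L \subset A by rewrite join_subG HA; apply/subsetP=> g /(bkerP _ ee)[gG ge]; apply/rstabP; split=> //; apply: in_pres.
have flL z : flip e z \in L by apply: (subsetP (joing_subr _ _)); apply: flM.
case: (triple_below b (L := L) (joing_subl _ _) LA) => -[sub|sub|sub] _.
- by case/negP: (nB x); apply: (subsetP sub).
- by case/negP: (nC x); apply: (subsetP sub).
case: b => _ [n1 _ _] _; apply: n1; apply/subsetP=> k /setIP[kA kB].
have := subsetP sub _ kA; rewrite /= norm_joinEl // => /mulsgP[h v hH /(bkerP _ ee)[vG ve] kE].
have /setIP[/setIP[hA hB] hC] := hH.
have vB : v \in B by rewrite -(groupMl _ hB) -kE.
rewrite kE groupM //; have [vo|vo] := boolP (odd_perm v); last exact: (even_flips ee c2 dC ve vo).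
case/negP: (nB x); rewrite -(groupMl _ vB).
apply: (even_flips ee c2 dB).
  by move=> z; rewrite permM; apply: (eqv_trans ee (ve z)); apply: flip_e.
by rewrite odd_permM vo (odd_flip c2).
Qed.

End PairB3.

(** * Degrees other than eight *)

Lemma even_pairs (T : finType) (e : rel T) : equivalence_rel e -> (forall x, #|cls e x| = 2) -> ~~ odd #|T|.
Proof.
move=> ee c2; rewrite (@fpf_invol _ (cperm ee c2)) ?oddM ?andbF // => x; rewrite !cpermE ?mate_ne //.
exact: mateK.
Qed.

Lemma ptransS (T : finType) (H K : {set {perm T}}) X : H \subset K -> ptrans H X -> ptrans K X.
Proof. by move=> /subsetP sub tH x y xX yX; have [h /sub hK hx] := tH x y xX yX; exists h. Qed.

Section Assembly.
Variables (T : finType) (alt : bool) (G : {group {perm T}}).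
Implicit Types (x y z t : T) (g h k : {perm T}) (e f : rel T) (A B C : {group {perm T}}).
Hypothesis hG : forall g, (g \in G) = ~~ (alt && odd_perm g).
Hypothesis T6 : 6 <= #|T|.

(** The lemma [triple_kind] derives this alternative from the rank three interval, so that a group
    preserving a partition is its full stabilizer. *)
Definition kind B := prim B \/ exists2 f, proper_eq f & B = rstab_group G f.

Lemma prim_not_inv B f : prim B -> proper_eq f -> ~ einv B f.
Proof.
move=> pB [ff [x [y [xy fxy]]] [u [v nuv]]] iB.
by case: (pB f ff iB) => h; [rewrite (h _ _ fxy) eqxx in xy|rewrite h in nuv].
Qed.

Lemma proper_uniform_sub e f : proper_eq e -> uniform e -> uniform f -> equivalence_rel f ->
  (forall x y, e x y -> f x y) -> ~ (forall x y, f x y -> e x y) -> forall x, 2 < #|cls f x|.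
Proof.
move=> pe ue uf ff ef nfe x.
have [/existsP[a /existsP[b /andP[fab nab]]]|no] := boolP [exists a, exists b, f a b && ~~ e a b]; last first.
  case: nfe => a b fab; apply/negPn/negP => nab; case/negP: no.
  by apply/existsP; exists a; apply/existsP; exists b; rewrite fab.
have [c ac ca] := @cls_avoid _ e a [:: a] (card_cls2 pe ue a); rewrite inE in ca.
rewrite (uf x a); apply: (@card_cls_ge _ _ a [:: a; c; b]); rewrite /= ?inE.
  rewrite negb_or eq_sym ca andbT /=; apply/andP; split; apply: contraNneq nab => <- //.
  by case: pe => ee _ _; rewrite eqv_refl.
by rewrite eqv_refl // (ef _ _ ac) fab.
Qed.

Lemma bad_kind e B : ptrans B setT -> kind B -> bad e B -> (prim B /\ ~ has_cyc3 B) \/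
  exists f, [/\ proper_eq f, B = rstab_group G f & forall x y, e x y -> f x y -> x = y].
Proof.
move=> tB [pB|[f pf BE]] [[pB' nB]|[f0 [pf0 iB tr]]].
- by left.
- by case: (prim_not_inv pB pf0).
- by case: (prim_not_inv pB' pf); rewrite BE; apply: einv_rstab.
right; exists f; split=> //.
have h : forall x y, f x y = f0 x y.
  apply: (rstab_inj hG T6 pf _ pf0).
  - by apply: (uniform_inv tB); rewrite BE; apply: einv_rstab.
  - exact: (uniform_inv tB).
  by apply: sub_rstab; [exact: rstab_sub|move=> g gf; apply: iB; rewrite BE].
by move=> x y; rewrite h; apply: tr.
Qed.

Section Triple.
Variables (A B C : {group {perm T}}).
Hypotheses (b : boolean_triple G A B C) (tH : ptrans (A :&: B :&: C) setT).

Lemma triple_tAB : ptrans (A :&: B) setT. Proof. exact: ptransS (subsetIl _ _) tH. Qed.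
Lemma triple_tA : ptrans A setT. Proof. exact: ptransS (subsetIl _ _) triple_tAB. Qed.
Lemma triple_tB : ptrans B setT. Proof. exact: ptransS (subsetIr _ _) triple_tAB. Qed.

Lemma triple_alt : alt -> ~ 'Alt_T \subset A.
Proof.
move=> altT sub; apply: (triple_nsub (triple_swap b)); case: b => -[_ BG _] _ _.
apply: subset_trans BG _; apply: subset_trans sub; apply/subsetP=> g.
by rewrite hG altT Alt_even.
Qed.
End Triple.

Lemma two_rel e f C : proper_eq e -> proper_eq f -> boolean_triple G (rstab_group G e) (rstab_group G f) C ->
  ptrans (rstab_group G e :&: rstab_group G f :&: C) setT ->
  [\/ forall x y, e x y -> f x y, forall x y, f x y -> e x y | forall x y, e x y -> f x y -> x = y].
Proof. by move=> pe pf b tH; apply: (meet_triv hG T6 pe pf b); apply: triple_tAB tH. Qed.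

Lemma two_rel_ne e f C : boolean_triple G (rstab_group G e) (rstab_group G f) C -> ~ forall x y, e x y = f x y.
Proof.
move=> b h; apply: (triple_nsub b); apply/subsetP=> g /rstabP[gG ge]; apply/rstabP; split=> //.
by move=> x y; rewrite -!h.
Qed.

Definition comp e f := (forall x y, e x y -> f x y) \/ (forall x y, f x y -> e x y).

Lemma kind_cases e B C : proper_eq e -> boolean_triple G (rstab_group G e) B C ->
  ptrans (rstab_group G e :&: B :&: C) setT -> kind B ->
  [\/ 'Alt_T \subset B, bad e B | exists2 f, proper_eq f & B = rstab_group G f /\ comp e f].
Proof.
move=> pe b tH [pB|[f pf BE]].
  pose c := [exists x, exists y, exists z, [&& x != y, x != z, y != z & cyc3 x y z \in B]].
  have [/existsP[x /existsP[y /existsP[z /and4P[xy xz yz cB]]]]|no] := boolP c.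
    by constructor 1; apply: prim_cyc3 => //; exists x, y, z.
  constructor 2; left; split=> // -[x [y [z [xy xz yz cB]]]]; case/negP: no.
  by apply/existsP; exists x; apply/existsP; exists y; apply/existsP; exists z; apply/and4P.
rewrite BE in b tH; case: (two_rel pe pf b tH) => h.
- by constructor 3; exists f => //; split=> //; left.
- by constructor 3; exists f => //; split=> //; right.
- by constructor 2; right; exists f; split=> //; rewrite BE; apply: einv_rstab.
Qed.

End Assembly.

(** * Alternating groups of degree other than eight *)

Section AltNo8.
Variables (T : finType) (G : {group {perm T}}).
Implicit Types (x y z t : T) (g h k : {perm T}) (e f : rel T) (A B C : {group {perm T}}).
Hypothesis hG : forall g, (g \in G) = ~~ (true && odd_perm g).
Hypothesis T6 : 6 <= #|T|.
Hypothesis n8 : #|T| != 8.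

Lemma bad3_two e B C : proper_eq e -> (forall x, 2 < #|cls e x|) -> boolean_triple G (rstab_group G e) B C ->
  ptrans (rstab_group G e :&: B :&: C) setT -> bad e B ->
  [/\ (forall x y z, ~~ e x y -> e x z || e y z), full G e [group of rstab_group G e :&: B] &
   (forall x u, u \in rstab_group G e :&: B -> perm_on (cls e x) u -> u = 1)].
Proof.
move=> pe a3 b tH bB.
have [] := bad3_n8 hG (K := [group of rstab_group G e :&: B]) (B := B) pe (subsetIl _ _) (triple_tAB tH)
  (triple_max b) a3 (subsetIr _ _) bB n8.
by [].
Qed.

Lemma prim_alt A B C : boolean_triple G A B C -> prim A -> ~ has_cyc3 A.
Proof. by move=> b pA /(prim_cyc3 pA); apply: (triple_alt hG b). Qed.

(** [A :&: B] has no double flips, so [C] must supply them and is the stabilizer of a coarser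
    relation [f3]. [B] is bad for [f3], whose classes are large, so only 1 in the corresponding meet
    is supported on an [f3]-class. A product of two lifted exchanges, cycling three pairs in one
    [f3]-class, violates this. *)
Lemma pair_no_bad e B C : proper_eq e -> (forall x, #|cls e x| = 2) -> boolean_triple G (rstab_group G e) B C ->
  ptrans (rstab_group G e :&: B :&: C) setT -> kind G B -> kind G C -> bad e B -> False.
Proof.
move=> pe c2 b tH kB kC bB; have [ee _ nall] := pe; set A := rstab_group G e in b tH *.
have bs := triple_swap b; have br := triple_rot b; have bt := triple_rot br.
pose K := [group of A :&: B]; pose K' := [group of A :&: C].
have KA : K \subset rstab_group G e by apply: subsetIl.
have KA' : K' \subset rstab_group G e by apply: subsetIl.
have tK : ptrans K setT := triple_tAB tH.
have tK' : ptrans K' setT by apply: ptransS tH; rewrite /= setIAC subsetIl.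
have mx' (L : {group {perm T}}) : K' \subset L -> L \subset rstab_group G e -> L \subset K' \/ rstab_group G e \subset L.
  by apply: (triple_max (triple_swap bt)).
have ue : uniform e by move=> x y; rewrite !c2.
have Teven := even_pairs ee c2.
have tB : ptrans B setT := triple_tB tH.
have nK : ~ has_dflips e K.
  move=> dK; have dB : has_dflips e B by move=> x y xy; have /setIP[] := dK x y xy.
  case: bB => [[pB nB]|[f [pf iB tr]]]; last exact: (pair_imprim ee c2 T6 pf iB tr dB).
  have [T10|] := leqP 10 #|T|; first by apply: nB; apply: (prim_dfl (e := e)).
  move=> T9; have T6' : #|T| = 6 by move: T6 T9 n8 Teven; clear; case: #|T| => [|[|[|[|[|[|[|[|[|[|n]]]]]]]]]] //.
  apply: (six_absurd hG ee c2 nall T6 isT T6' (H := [group of A :&: B :&: C]) (K := K)) => //=.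
  - exact: subsetIl.
  - by move=> h; case: b => _ [n1 _ _] _; apply: n1; apply: subset_trans h (subsetIr _ _).
  - exact: triple_ne b.
have [bev cK] := alt_pairs hG ee c2 nall T6 KA tK (triple_max b) isT nK.
case: (pair_cases hG ee c2 KA (triple_max b)) => // -[lift k1].
have [x0 [y0 xy0]] := nall.
(* Otherwise the flip of all pairs lies in [C] too. The join of the triple meet with the even kernel
   would be [A], and the kernel part of an element of [A :&: B], being 1 or that flip, would lie in
   [C]. *)
have dK' : has_dflips e K'.
  have [h|no] := boolP [forall x, forall y, ~~ e x y ==> (dflip e x y \in K')].
    by move=> x y xy; move/forallP/(_ x)/forallP/(_ y): h; rewrite xy.
  have nK' : ~ has_dflips e K'.
    move=> h; case/negP: no; apply/forallP=> x; apply/forallP=> y; apply/implyP; exact: h.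
  have [_ cK'] := alt_pairs hG ee c2 nall T6 KA' tK' mx' isT nK'.
  have HA : A :&: B :&: C \subset rstab_group G e by rewrite -setIA subsetIl.
  have nE : A :&: B :&: C \subset 'N(evker_group hG ee).
    exact: (evker_norm hG ee (L := [group of A :&: B :&: C]) HA).
  pose L := ((A :&: B :&: C) <*> evker_group hG ee)%G.
  have EL : evker G e \subset L by apply: joing_subr.
  have LA : L \subset A by rewrite join_subG HA; exact: evkerM.
  have dL (D : {group {perm T}}) : L \subset D -> has_dflips e D.
    by move=> sub x y xy; apply: (subsetP sub); apply: (subsetP EL); apply: dflip_ev.
  case: (triple_below b (L := L) (joing_subl _ _) LA) => -[sub|sub|sub] _.
  - by case: nK => x y xy; apply/setIP; split; [apply: (subsetP LA); apply: dL xy|apply: dL xy].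
  - by case: nK' => x y xy; apply/setIP; split; [apply: (subsetP LA); apply: dL xy|apply: dL xy].
  exfalso; case: b => _ [n1 _ _] _; apply: n1; apply/subsetP=> k /setIP[kA kB2].
  have /mulsgP[h v hH vE kE] : k \in (A :&: B :&: C) * evker_group hG ee.
    by rewrite -(norm_joinEl nE); apply: (subsetP sub).
  have /setIP[/setIP[hA hB] hC] := hH.
  have /(evkerP hG ee)[vo ve] := vE.
  have vK : v \in K.
    by apply/setIP; split; [rewrite -(groupMl _ hA) -kE|rewrite -(groupMl _ hB) -kE].
  rewrite kE groupM //; case: (k1 v vK ve) => [->|vp]; first exact: group1.
  have -> : v = cperm ee c2 by apply/permP=> z; rewrite cpermE vp.
  by case/setIP: cK'.
have dC : has_dflips e C by move=> x y xy; have /setIP[] := dK' x y xy.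
(* The degree is a multiple of 4, at least 6 and not 8. *)
have T12 : 12 <= #|T|.
  move: T6 n8 Teven bev; clear; case: #|T| => [|[|[|[|[|[|[|[|[|[|[|[|n]]]]]]]]]]]] //.
case: kC => [pC|[f3 p3 CE]].
  by case: (prim_alt bt pC); apply: (prim_dfl ee c2 nall _ pC dC); apply: leq_trans T12.
have [ff3 _ nall3] := p3.
have uf3 : uniform f3.
  apply: (uniform_inv (K := C)); [exact: ptransS (subsetIr _ _) tK'|rewrite CE; exact: einv_rstab].
have b' : boolean_triple G (rstab_group G e) (rstab_group G f3) B by rewrite -CE; apply: triple_swap bt.
have tH' : ptrans (rstab_group G e :&: rstab_group G f3 :&: B) setT by rewrite -CE setIAC.
have ef3 : forall x y, e x y -> f3 x y.
  case: (two_rel hG T6 pe p3 b' tH') => // h.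
  - move=> x y exy; have sub : cls f3 x \subset cls e x by apply/subsetP=> t; rewrite !inE; apply: h.
    have /eqP E : cls f3 x == cls e x.
      by rewrite eqEcard sub c2 (card_cls2 p3 uf3).
    by move/setP/(_ y): E; rewrite !inE exy.
  - exfalso; apply: (pair_imprim ee c2 T6 p3 _ h dC); rewrite CE; exact: einv_rstab.
have f33 : forall x, 2 < #|cls f3 x|.
  apply: (proper_uniform_sub pe ue uf3 ff3 ef3) => h; apply: (two_rel_ne b') => x y.
  by apply/idP/idP; [apply: ef3|apply: h].
have e_sub x y z : f3 x y -> e y z -> f3 x z by move=> h1 h2; apply: (eqv_trans ff3 h1); apply: ef3.
have lift_swp x y : ~~ e x y -> exists2 k, k \in K & forall z, e (swp e x y z) (k z).
  move=> xy; have [k kK [q /(evkerP hG ee)[_ qk] sE]] := lift _ (swpM hG ee c2 xy).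
  by exists k => // z; rewrite sE permM eqv_sym.
(* For [B] the stabilizer of [f]: if [f] refined [f3], the lift of an exchange of the pair of [s]
   with one outside the [f3]-class would keep the pair of [x] and carry [s] away. And [f3] cannot
   refine [f], because [e] refines [f3] and meets [f] trivially. *)
have b3B : bad f3 B.
  case: (bad_kind hG T6 tB kB bB) => [h|[f [pf BE tr]]]; first by left.
  right; exists f; split=> //; first by rewrite BE; apply: einv_rstab.
  have b'' : boolean_triple G (rstab_group G f) (rstab_group G f3) A by rewrite -BE -CE.
  have tH'' : ptrans (rstab_group G f :&: rstab_group G f3 :&: A) setT by rewrite -BE -CE setIC setIA.
  have [ff [x [s [xs fxs]]] _] := pf.
  case: (two_rel hG T6 pf p3 b'' tH'') => h; last by move=> a c h1 h2; apply: h.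
    have [t xt] := other ff3 nall3 x.
    have xsf := h _ _ fxs.
    have nst : ~~ e s t by apply: contra xt; apply: e_sub.
    have [k kK ks] := lift_swp _ _ nst.
    have kf : f (k x) (k s) by have /setIP[_] := kK; rewrite BE => /rstabP[_ ->].
    have nxs : ~~ e x s by apply: contra xs => /tr/(_ fxs) ->.
    have nxt : ~~ e t x by apply: contra xt => h1; apply: ef3; rewrite eqv_sym.
    have [h1 h2 h3] := swp_swaps ee c2 nst.
    case/negP: xt.
    have k1' : f3 x (k x).
      apply: ef3; apply: (eqv_trans ee (h1 x _ nxt)); first by rewrite eqv_sym.
      exact: ks.
    apply: (e_sub _ (k s)); first by apply: (eqv_trans ff3 k1'); apply: h.
    rewrite eqv_sym //; apply: (eqv_trans ee h2); exact: ks.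
  move=> a c; have := h; have [a1 [c1 [ac1 eac1]]] : exists x y, x != y /\ e x y by case: pe.
  by move=> hh; move/eqP: (tr _ _ eac1 (hh _ _ (ef3 _ _ eac1))); rewrite (negPf ac1).
have b3' : boolean_triple G (rstab_group G f3) B A by rewrite -CE; apply: triple_swap.
have tH3 : ptrans (rstab_group G f3 :&: B :&: A) setT by rewrite -CE setIC setIA setIAC.
have [two3 _ N1] := bad3_two p3 f33 b3' tH3 b3B.
have [w xw] := other ff3 nall3 x0.
have hcard : 6 <= #|cls f3 x0|.
  have -> : #|cls f3 x0| = #|T|./2.
    rewrite -cardsT (_ : setT = cls f3 x0 :|: cls f3 w).
      have := cardsUI (cls f3 x0) (cls f3 w).
      have /eqP -> : cls f3 x0 :&: cls f3 w == set0 by rewrite setI_eq0 cls_disj.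
      by rewrite cards0 addn0 (uf3 w x0) => ->; rewrite addnn doubleK.
    by apply/setP=> z; rewrite !inE two3.
  by rewrite (half_leq T12).
have [y xy] := @cls_avoid _ f3 x0 [:: x0; mate e x0] (leq_trans (isT : 2 < 6) hcard).
have [z xz] := @cls_avoid _ f3 x0 [:: x0; mate e x0; y; mate e y] (leq_trans (isT : 4 < 6) hcard).
rewrite !inE !negb_or => /and4P[z1 z2 z3 z4] /andP[y1 y2].
have nxy : ~~ e x0 y by rewrite (pair_relE ee c2) negb_or y1.
have nxz : ~~ e x0 z by rewrite (pair_relE ee c2) negb_or z1.
have nyz : ~~ e y z by rewrite (pair_relE ee c2) negb_or z3.
have [k1' k1K k1s] := lift_swp _ _ nxy; have [k2' k2K k2s] := lift_swp _ _ nyz.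
have sw a c : f3 x0 a -> f3 x0 c -> ~~ e a c -> (forall t, f3 t (swp e a c t)) /\ (forall t, ~~ f3 x0 t -> swp e a c t = t).
  move=> xa xc nac; have fp t u : f3 x0 t -> f3 x0 u -> f3 t u by move=> h1 h2; apply: (eqv_trans ff3 _ h2); rewrite eqv_sym.
  have pa : f3 x0 (mate e a) by apply: e_sub xa _; apply: mate_rel.
  have pc : f3 x0 (mate e c) by apply: e_sub xc _; apply: mate_rel.
  split=> t; rewrite (swpE ee c2) //.
    have [->|_] := eqVneq t a; first exact: fp.
    have [->|_] := eqVneq t c; first exact: fp.
    have [->|_] := eqVneq t (mate e a); first exact: fp.
    have [->|_] := eqVneq t (mate e c); first exact: fp.
    by rewrite eqv_refl.
  move=> xt; have ne u : f3 x0 u -> (t == u) = false by move=> h; apply/negbTE; apply: contraNneq xt => ->.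
  by rewrite !ne.
have [s1 s1'] := sw _ _ (eqv_refl ff3 x0) xy nxy.
have [s2 s2'] := sw _ _ xy xz nyz.
pose k := k1' * k2'.
have kK : k \in K by apply: groupM.
have Ke : forall g, g \in K -> forall a c, e (g a) (g c) = e a c by move=> g /setIP[/rstabP[]].
have ks t : e (swp e y z (swp e x0 y t)) (k t).
  rewrite (permM k1' k2'); apply: (eqv_trans ee (k2s _)); rewrite Ke //; exact: k1s.
have kf t : f3 t (k t) by apply: (e_sub _ _ _ _ (ks t)); apply: (eqv_trans ff3 (s1 t)); exact: s2.
have kout t : ~~ f3 x0 t -> e t (k t).
  by move=> xt; have := ks t; rewrite s1' // s2'.
have kC : k \in rstab_group G f3.
  by apply/rstabP; split; [have /setIP[/rstabP[]] := kK|apply: in_pres].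
(* Outside the [f3]-class of [x0], [k] preserves each pair, so its square is supported on that
   class. Yet [k] permutes the pairs of [x0], [y] and [z] cyclically. *)
have : k * k = 1.
  apply: (N1 x0); first by apply: groupM; apply/setIP; split=> //; case/setIP: kK.
  apply/subsetP=> t; rewrite !inE; apply: contraR => xt; rewrite permM; apply/eqP.
  have := kout _ xt; rewrite (pair_relE ee c2) => /orP[]/eqP h; first by rewrite !h.
  by rewrite h (mate_comm ee c2 (Ke k kK)) h mateK.
move/permP/(_ x0); rewrite permM perm1 => kk.
have kx : e z (k x0).
  have := ks x0; rewrite (swpE ee c2 _ nxy) eqxx (swpE ee c2 _ nyz) eqxx; done.
have := Ke _ kK z (k x0); rewrite kx kk => kz.
have := ks z; rewrite (swpE ee c2 _ nxy) (negPf z1) (negPf z3) (negPf z2) (negPf z4).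
rewrite (swpE ee c2 _ nyz) (negPf z3) eqxx => h.
by case/negP: nxy; rewrite eqv_sym //; apply: (eqv_trans ee h).
Qed.

(** The graph case is refuted with the pieces [P] of the kernel part [D] of the triple meet: they
    contain some [u] other than 1 supported on a class. Hence the join [Q] is not in [B]. If it is
    in [C], then [C] stabilizes a relation strictly comparable with the two-class relation [e],
    which is impossible. If it is [A], then [A :&: B] lies in [C]. *)
Lemma no_bad e B C : proper_eq e -> boolean_triple G (rstab_group G e) B C ->
  ptrans (rstab_group G e :&: B :&: C) setT -> kind G B -> kind G C -> bad e B -> False.
Proof.
move=> pe b tH kB kC bB; have [ee _ nall] := pe; set A := rstab_group G e in b tH *.
have bs := triple_swap b; have br := triple_rot b; have bt := triple_rot br.
have tK : ptrans (A :&: B) setT := triple_tAB tH.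
have tA : ptrans A setT := triple_tA tH.
have tB : ptrans B setT := triple_tB tH.
have ue : uniform e by apply: (uniform_inv tA); apply: einv_rstab.
have [/forallP a2|] := boolP [forall x, #|cls e x| == 2].
  by apply: (pair_no_bad pe (fun x => eqP (a2 x)) b tH kB kC bB).
rewrite negb_forall => /existsP[x1 nx1].
have a3 x : 2 < #|cls e x|.
  by rewrite ltn_neqAle (card_cls2 pe ue) andbT eq_sym (ue x x1).
have [two fl N1] := bad3_two pe a3 b tH bB.
have [x0 [y0 xy0]] := nall.
pose D := [group of (A :&: B :&: C) :&: bker_group G ee].
have HA : A :&: B :&: C \subset A by rewrite -setIA subsetIl.
have Dk : D \subset bker G e by apply: subsetIr.
have DH : D \subset A :&: B :&: C by apply: subsetIl.
have nD : A :&: B :&: C \subset 'N(D).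
  apply/subsetP=> h hH; rewrite inE; apply/subsetP=> _ /imsetP[d /setIP[dH dk] ->].
  by apply/setIP; split; [apply: groupJ|apply: bkerJ => //; apply: (subsetP HA)].
have Hk h x : h \in A :&: B :&: C -> e x (h x) -> h \in D.
  move=> hH ex; apply/setIP; split=> //; have /rstabP[hG' he] := subsetP HA _ hH.
  apply/(bkerP _ ee); split=> // t; have [xt|xt] := boolP (e x t).
    by apply: (eqv_trans ee (_ : e t x)); [rewrite eqv_sym|apply: (eqv_trans ee ex); rewrite he].
  have := two x t (h t) xt; case/orP=> // xht; case/negP: xt.
  by rewrite -he -(eqv_congr ee ex).
pose P := pieces_group G ee D.
have nP : A :&: B :&: C \subset 'N(P) by apply: pieces_norm nD.
pose Q := ((A :&: B :&: C) <*> P)%G.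
have PA : P \subset A.
  by apply/subsetP=> g /piecesP[/(bkerP _ ee)[gG ge] _]; apply/rstabP; split=> //; apply: in_pres.
have QA : Q \subset A by rewrite join_subG HA.
(* [D] is transitive on a class of at least three points. Of two elements sending [x0] to different
   new points, one of them or their quotient is even on the class. *)
have [u uP [u1 ux]] : exists2 u, u \in P & u != 1 /\ perm_on (cls e x0) u.
  have trD y : e x0 y -> exists2 d, d \in D & d x0 = y.
    move=> xy; have [d dH dx] := tH x0 y (in_setT _) (in_setT _); exists d => //.
    by apply: (Hk d x0) => //; rewrite dx.
  have rP d : d \in D -> ~~ odd_perm (restr_perm (cls e x0) d) -> restr_perm (cls e x0) d \in P.
    by move=> dD od; apply: (rs_pieces ee) => //; rewrite hG od.
  have rne d t : d \in D -> e x0 t -> d t != t -> restr_perm (cls e x0) d != 1.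
    move=> dD xt; apply: contraNneq => /rs_eq1P h; apply/eqP; apply: h; last by rewrite inE.
    by apply: (bker_st ee); apply: (subsetP Dk).
  have [y xy yx] := @cls_avoid _ e x0 [:: x0] (ltnW (a3 x0)).
  have [z xz zx] := @cls_avoid _ e x0 [:: x0; y] (a3 x0).
  rewrite !inE in yx zx; move: zx; rewrite negb_or => /andP[zx zy].
  have [d dD dx] := trD y xy; have [d' d'D d'x] := trD z xz.
  have st g : g \in D -> g @: cls e x0 = cls e x0 by move=> gD; apply: (bker_st ee); apply: (subsetP Dk).
  have [od|od] := boolP (odd_perm (restr_perm (cls e x0) d)); last first.
    by exists (restr_perm (cls e x0) d); [apply: rP|split; [apply: (rne d x0) => //; rewrite ?eqv_refl ?dx|apply: rs_on]].
  have [od'|od'] := boolP (odd_perm (restr_perm (cls e x0) d')); last first.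
    by exists (restr_perm (cls e x0) d'); [apply: rP|split; [apply: (rne d' x0) => //; rewrite ?eqv_refl ?d'x|apply: rs_on]].
  exists (restr_perm (cls e x0) (d^-1 * d')).
    by apply: rP; rewrite ?groupM ?groupV // rsM ?st ?groupV // rsV ?st // odd_permM odd_permV od od'.
  split; last exact: rs_on.
  by apply: (rne _ y); rewrite ?groupM ?groupV // permM -dx permK d'x dx.
have uQ : u \in Q by apply: (subsetP (joing_subr _ _)).
case: (triple_below b (L := Q) (joing_subl _ _) QA) => -[sub|sub|sub] _.
- have := N1 x0 u; rewrite in_setI (subsetP QA) // (subsetP sub) // => /(_ isT ux)/eqP.
  by rewrite (negPf u1).
- have NC : ~ bad e C.
    move=> bC; have bts := triple_swap bt.
    have tH' : ptrans (rstab_group G e :&: C :&: B) setT by rewrite setIAC.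
    have [_ _ N1'] := bad3_two pe a3 bts tH' bC.
    have := N1' x0 u; rewrite in_setI (subsetP QA) // (subsetP sub) // => /(_ isT ux)/eqP.
    by rewrite (negPf u1).
  case: kC => [pC|[f3 p3 CE]]; first by apply: NC; left; split=> //; apply: (prim_alt bt).
  have [ff3 _ nall3] := p3.
  have uf3 : uniform f3.
    apply: (uniform_inv (K := C)); [exact: ptransS (subsetIr _ _) tH|rewrite CE; exact: einv_rstab].
  have b' : boolean_triple G (rstab_group G e) (rstab_group G f3) B by rewrite -CE; apply: triple_swap bt.
  have tH' : ptrans (rstab_group G e :&: rstab_group G f3 :&: B) setT by rewrite -CE setIAC.
  have fne := two_rel_ne b'.
  case: (two_rel hG T6 pe p3 b' tH') => h; last first.
  + by apply: NC; right; exists f3; split=> //; rewrite CE; apply: einv_rstab.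
  + have b3B : bad f3 B.
      case: bB => [hB|[f [pf iB tr]]]; [by left|right; exists f; split=> //].
      by move=> a c /h; apply: tr.
    have b3' : boolean_triple G (rstab_group G f3) B (rstab_group G e) by rewrite -CE; apply: triple_swap.
    have tH3 : ptrans (rstab_group G f3 :&: B :&: rstab_group G e) setT.
      by rewrite -CE setIC setIA setIAC.
    have kA : kind G (rstab_group G e) by right; exists e.
    have [/forallP a2|] := boolP [forall x, #|cls f3 x| == 2].
      exact: (pair_no_bad p3 (fun x => eqP (a2 x)) b3' tH3 kB kA b3B).
    rewrite negb_forall => /existsP[x2 nx2].
    have f33 x : 2 < #|cls f3 x|.
      by rewrite ltn_neqAle (card_cls2 p3 uf3) andbT eq_sym (uf3 x x2).
    have [two3 _ _] := bad3_two p3 f33 b3' tH3 b3B.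
    apply: fne => x y; apply/idP/idP; last exact: h.
    move=> exy; apply/negPn/negP => nxy.
    have [w xw] := other ee nall x.
    have := two3 x y w nxy; case/orP=> /h hw; first by rewrite hw in xw.
    by case/negP: xw; apply: (eqv_trans ee exy).
  apply: fne => x y; apply/idP/idP; first exact: h.
  move=> fxy; apply/negPn/negP => nxy.
  have [w xw] := other ff3 nall3 x.
  have := two x y w nxy; case/orP=> /h hw; first by rewrite hw in xw.
  by case/negP: xw; apply: (eqv_trans ff3 fxy).
(* The [P]-part [q] of an element of [A :&: B] agrees on one class with some [d] in [D]; then
   [d^-1 * q] is supported on the other class, hence is 1. *)
case: b => _ [n1 _ _] _; apply: n1; apply/subsetP=> k kK; have /setIP[kA kB'] := kK.
suff : k \in A :&: B :&: C by case/setIP.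
have := subsetP sub _ kA; rewrite /= norm_joinEl // => /mulsgP[h q hH qP kE].
have hK : h \in A :&: B by case/setIP: hH.
have qK : q \in A :&: B by rewrite -(groupMl _ hK) -kE.
have /piecesP[qk qd] := qP; have [d dD qE] := qd x0.
rewrite kE groupM //; suff -> : q = d by apply: (subsetP DH).
have dK : d \in A :&: B by have := subsetP DH _ dD; case/setIP.
apply/eqP; rewrite -(inj_eq (mulgI d^-1)) mulVg; apply/eqP.
apply: (N1 y0); first by rewrite groupM ?groupV.
apply/subsetP=> t; rewrite !inE; apply: contraR => yt.
have xt : e x0 t by have := two x0 y0 t xy0; rewrite (negPf yt) orbF.
rewrite permM qE ?permKV //.
have /(bkerP _ ee)[_ ] := subsetP Dk _ (groupVr dD) => /(_ t) h'.
exact: (eqv_trans ee xt).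
Qed.

End AltNo8.

Lemma comp_pairs (T : finType) (e f : rel T) : proper_eq e -> proper_eq f ->
  (forall x, #|cls e x| = 2) -> (forall x, #|cls f x| = 2) -> comp e f -> forall x y, e x y = f x y.
Proof.
move=> pe pf e2 f2.
have h (a c : rel T) : (forall x, #|cls a x| = 2) -> (forall x, #|cls c x| = 2) ->
  (forall x y, a x y -> c x y) -> forall x y, a x y = c x y.
  move=> a2 c2 ac x y; have /eqP/setP/(_ y) : cls a x == cls c x.
    by rewrite eqEcard a2 c2 leqnn andbT; apply/subsetP=> t; rewrite !inE; apply: ac.
  by rewrite !inE.
by case=> hh x y; [apply: h|rewrite (h f e)].
Qed.

(** * The symmetric group *)

Section Sym.
Variables (T : finType) (G : {group {perm T}}).
Implicit Types (x y z t : T) (g h k : {perm T}) (e f : rel T) (A B C : {group {perm T}}).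
Hypothesis hG : forall g, (g \in G) = ~~ (false && odd_perm g).
Hypothesis T6 : 6 <= #|T|.

(** Larger classes would force an alternating group by [bad3]. For pairs, [pair_sym_dfl] gives
    double flips, which an imprimitive bad group cannot have. *)
Lemma sym_bad e B C : proper_eq e -> boolean_triple G (rstab_group G e) B C ->
  ptrans (rstab_group G e :&: B :&: C) setT -> bad e B ->
  [/\ forall x, #|cls e x| = 2, prim B, ~ has_cyc3 B & has_dflips e B].
Proof.
move=> pe b tH bB; have [ee _ nall] := pe.
have tK := triple_tAB tH.
have ue : uniform e by apply: (uniform_inv (triple_tA tH)); apply: einv_rstab.
have [/forallP a2|] := boolP [forall x, #|cls e x| == 2]; last first.
  rewrite negb_forall => /existsP[x1 nx1].
  have a3 x : 2 < #|cls e x| by rewrite ltn_neqAle (card_cls2 pe ue) andbT eq_sym (ue x x1).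
  by have [] := bad3 hG (K := [group of rstab_group G e :&: B]) (B := B) pe (subsetIl _ _) tK
    (triple_max b) a3 (subsetIr _ _) bB.
have c2 x := eqP (a2 x).
have dK := pair_sym_dfl hG pe c2 T6 b tK bB.
have dB : has_dflips e B by move=> x y xy; have /setIP[] := dK x y xy.
by case: bB => [[pB nB]|[f [pf iB tr]]]; [split|case: (pair_imprim ee c2 T6 pf iB tr dB)].
Qed.

Lemma sym_alt B : ~ G \subset B -> 'Alt_T \subset B -> B = 'Alt_T%G.
Proof.
move=> nB sub; apply/val_inj/eqP; rewrite eqEsubset /= sub andbT; apply/subsetP=> g gB.
rewrite Alt_even; apply/negP=> go; apply: nB; apply/subsetP=> h _.
have [ho|ho] := boolP (odd_perm h); last by apply: (subsetP sub); rewrite Alt_even.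
by rewrite -(groupMr _ gB); apply: (subsetP sub); rewrite Alt_even odd_permM ho go.
Qed.

Lemma sym_main e B C : proper_eq e -> boolean_triple G (rstab_group G e) B C ->
  ptrans (rstab_group G e :&: B :&: C) setT -> kind G B -> kind G C ->
  [\/ B = 'Alt_T%G /\ exists2 f, proper_eq f & C = rstab_group G f /\ comp e f,
     C = 'Alt_T%G /\ exists2 f, proper_eq f & B = rstab_group G f /\ comp e f |
     exists f f', [/\ proper_eq f /\ proper_eq f', B = rstab_group G f, C = rstab_group G f' &
       [/\ comp e f, comp e f' & comp f f']]].
Proof.
move=> pe b tH kB kC.
have b' := triple_swap (triple_rot (triple_rot b)).
have tH' : ptrans (rstab_group G e :&: C :&: B) setT by rewrite setIAC.
have nG : ~ G \subset B.
  by move=> h; apply: (triple_nsub b); apply: subset_trans (rstab_sub _ _) h.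
have nG' : ~ G \subset C.
  by move=> h; apply: (triple_nsub b'); apply: subset_trans (rstab_sub _ _) h.
have flip_alt (c2 : forall x, #|cls e x| = 2) x : flip e x \notin 'Alt_T by rewrite Alt_even odd_flip.
have dfl_alt (c2 : forall x, #|cls e x| = 2) : has_dflips e 'Alt_T by move=> x y _; rewrite Alt_even odd_dflip.
(* Being primitive, [D] is also bad for [f], so both relations have classes of two points, and
   comparable ones coincide. *)
have key D D' : boolean_triple G (rstab_group G e) D D' -> ptrans (rstab_group G e :&: D :&: D') setT ->
  bad e D -> (exists2 f, proper_eq f & D' = rstab_group G f /\ comp e f) -> False.
  move=> bD tD /(sym_bad pe bD tD)[c2 pD nD dD] [f pf [D'E cf]].
  have bD' : boolean_triple G (rstab_group G f) D (rstab_group G e) by rewrite -D'E; apply: triple_swap; apply: triple_rot.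
  have tD' : ptrans (rstab_group G f :&: D :&: rstab_group G e) setT by rewrite -D'E setIC setIA setIAC.
  have [|f2 _ _ _] := sym_bad pf bD' tD'; first by left.
  have bff : boolean_triple G (rstab_group G e) (rstab_group G f) D by rewrite -D'E; apply: triple_swap; apply: triple_rot; apply: triple_rot.
  exact: (two_rel_ne bff (comp_pairs pe pf c2 f2 cf)).
(* Neither the alternating group nor a primitive [D'] without 3-cycles contains a single flip, while
   both contain the double flips: this is the situation excluded by [pair_sym_flips]. *)
have key2 D D' : boolean_triple G (rstab_group G e) D D' -> ptrans (rstab_group G e :&: D :&: D') setT ->
  D = 'Alt_T%G -> bad e D' -> False.
  move=> bD tD DE bD'.
  have bD2 := triple_swap (triple_rot (triple_rot bD)).
  have tD2 : ptrans (rstab_group G e :&: D' :&: D) setT by rewrite setIAC.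
  have [c2 pD nD dD] := sym_bad pe bD2 tD2 bD'.
  apply: (pair_sym_flips hG pe c2 bD _ _ _ dD); rewrite ?DE.
  - exact: flip_alt.
  - by move=> x; apply: (prim_flip c2 T6).
  - exact: dfl_alt.
case: (kind_cases hG T6 pe b tH kB) => [/(sym_alt nG) BE|bB|[f pf [BE cf]]];
case: (kind_cases hG T6 pe b' tH' kC) => [/(sym_alt nG') CE|bC|[f' pf' [CE cf']]].
- by case: (triple_nsub (triple_rot b)); rewrite BE CE.
- by case: (key2 _ _ b tH BE bC).
- by constructor 1; split=> //; exists f'.
- by case: (key2 _ _ b' tH' CE bB).
- have [c2 pB nB dB] := sym_bad pe b tH bB; have [_ pC nC dC] := sym_bad pe b' tH' bC.
  exfalso; apply: (pair_sym_flips hG pe c2 b _ _ dB dC) => x; exact: (prim_flip c2 T6).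
- by case: (key _ _ b tH bB); exists f'.
- by constructor 2; split=> //; exists f.
- by case: (key _ _ b' tH' bC); exists f.
constructor 3; exists f, f'; split=> //; split=> //.
have br : boolean_triple G (rstab_group G f) (rstab_group G f') (rstab_group G e) by rewrite -BE -CE; apply: triple_rot.
have tr' : ptrans (rstab_group G f :&: rstab_group G f' :&: rstab_group G e) setT.
  by rewrite -BE -CE setIC setIA.
case: (two_rel hG T6 pf pf' br tr') => h; [by left|by right|].
have [|_ pC _ _] := sym_bad pf br tr'.
  by right; exists f'; split=> //; apply: einv_rstab.
by case: (prim_not_inv pC pf'); apply: einv_rstab.
Qed.
End Sym.

Section AltMain.
Variables (T : finType) (G : {group {perm T}}).
Implicit Types (x y z t : T) (g h k : {perm T}) (e f : rel T) (A B C : {group {perm T}}).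
Hypothesis hG : forall g, (g \in G) = ~~ (true && odd_perm g).
Hypothesis T6 : 6 <= #|T|.
Hypothesis n8 : #|T| != 8.

Lemma alt_main e B C : proper_eq e -> boolean_triple G (rstab_group G e) B C ->
  ptrans (rstab_group G e :&: B :&: C) setT -> kind G B -> kind G C ->
     exists f f', [/\ proper_eq f /\ proper_eq f', B = rstab_group G f, C = rstab_group G f' &
       [/\ comp e f, comp e f' & comp f f']].
Proof.
move=> pe b tH kB kC.
have b' := triple_swap (triple_rot (triple_rot b)).
have tH' : ptrans (rstab_group G e :&: C :&: B) setT by rewrite setIAC.
case: (kind_cases hG T6 pe b tH kB) => [/(triple_alt hG (triple_swap b) isT)//|bB|[f pf [BE cf]]].
  by case: (no_bad hG T6 n8 pe b tH kB kC bB).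
case: (kind_cases hG T6 pe b' tH' kC) => [/(triple_alt hG (triple_swap b') isT)//|bC|[f' pf' [CE cf']]].
  by case: (no_bad hG T6 n8 pe b' tH' kC kB bC).
exists f, f'; split=> //; split=> //.
have br : boolean_triple G (rstab_group G f) (rstab_group G f') (rstab_group G e) by rewrite -BE -CE; apply: triple_rot.
have tr' : ptrans (rstab_group G f :&: rstab_group G f' :&: rstab_group G e) setT.
  by rewrite -BE -CE setIC setIA.
case: (two_rel hG T6 pf pf' br tr') => h; [by left|by right|].
case: (no_bad hG T6 n8 pf br tr'); [by right; exists f'|by right; exists e|].
by right; exists f'; split=> //; apply: einv_rstab.
Qed.
End AltMain.

(** * Affine permutations of the three-dimensional cube *)

Section Parity.
Variable T : eqType.
Definition swapf (u v x : T) := if x == u then v else if x == v then u else x.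
(* parity of the bijection sending each member of [ps] to the entry of [vs] at the same place *)
Fixpoint par (vs ps : seq T) : bool :=
  if (vs, ps) is (v :: vs', p :: ps') then (v != p) (+) par (map (swapf v p) vs') ps' else false.
End Parity.

Lemma par_map (T U : eqType) (h : T -> U) vs ps : injective h -> par (map h vs) (map h ps) = par vs ps.
Proof.
move=> hi; elim: ps vs => [|p ps IH] [|v vs] //=.
rewrite (inj_eq hi) -IH -!map_comp; congr (_ (+) par _ _); apply: eq_map => x /=.
by rewrite /swapf !(inj_eq hi); do 2 case: ifP => _ //.
Qed.

(** Multiplying [g] by [tperm (g p) p] makes it fix [p] and changes the sign exactly when [g] moves
    [p]; [par] does this on lists. *)
Lemma odd_par (T : finType) (g : {perm T}) ps : uniq ps -> (forall x, x \notin ps -> g x = x) ->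
  odd_perm g = par (map g ps) ps.
Proof.
elim: ps g => [|p ps IH] g /=.
  by move=> _ h; rewrite (_ : g = 1) ?odd_perm1 //; apply/permP=> x; rewrite h ?perm1.
move=> /andP[pps ups] h; pose g' := g * tperm (g p) p.
have -> : odd_perm g = (g p != p) (+) odd_perm g'.
  by rewrite odd_permM odd_tperm addbCA addbb addbF.
congr (_ (+) _); rewrite IH //.
  congr (par _ _); rewrite -map_comp; apply/eq_in_map => x _; rewrite /= /swapf permM.
  case: tpermP => [->|->|/eqP/negPf-> /eqP/negPf->]; rewrite ?eqxx //.
  by case: eqP.
move=> x xps; rewrite permM; have [->|xp] := eqVneq x p; first by rewrite tpermL.
have gx : g x = x by apply: h; rewrite inE negb_or xp.
by rewrite tpermD ?gx // eq_sym // -gx (inj_eq perm_inj).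
Qed.

(** Vectors of the three-dimensional space over the field with two elements, kept as booleans so
    that finite checks can be evaluated; [ex] is their sum. *)
Definition E := (bool * bool * bool)%type.
Definition ex (x y : E) : E := (x.1.1 (+) y.1.1, x.1.2 (+) y.1.2, x.2 (+) y.2).
Definition allE : seq E :=
  [:: (false, false, false); (false, false, true); (false, true, false); (false, true, true);
      (true, false, false); (true, false, true); (true, true, false); (true, true, true)].
Definition e0 : E := (false, false, false).

Lemma exC x y : ex x y = ex y x. Proof. by case: x y => [[a b] c] [[a' b'] c']; rewrite /ex /= !(addbC a') ?(addbC b') ?(addbC c'). Qed.
Lemma exA x y z : ex x (ex y z) = ex (ex x y) z. Proof. by rewrite /ex /= !addbA. Qed.
Lemma exx x : ex x x = e0. Proof. by rewrite /ex !addbb. Qed.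
Lemma ex0 x : ex x e0 = x. Proof. by case: x => [[a b] c]; rewrite /ex /= !addbF. Qed.
Lemma exK x y : ex (ex x y) y = x. Proof. by rewrite -exA exx ex0. Qed.
Lemma ex_aff w x y z : ex (ex (ex w x) (ex w y)) (ex w z) = ex (ex (ex w x) y) z.
Proof.
have h (a b c d : bool) : (a (+) b) (+) (a (+) c) (+) (a (+) d) = a (+) b (+) c (+) d.
  by case: a b c d => [] [] [] [].
by rewrite /ex /= !h.
Qed.
Lemma mem_allE x : x \in allE. Proof. by case: x => [[[] []] []]. Qed.
Lemma allEP (P : pred E) : all P allE -> forall x, P x.
Proof. by move=> h x; apply: (allP h); apply: mem_allE. Qed.

(** Over two elements, respecting sums of three vectors characterizes affine maps. *)
Definition affine (F : E -> E) := forall x y z, F (ex (ex x y) z) = ex (ex (F x) (F y)) (F z).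
(** The affine map with given values at the origin and at the three unit vectors, so that all affine
    maps are covered by 8^4 candidates. *)
Definition aff4 (v0 v1 v2 v3 : E) (x : E) : E :=
  let d v (b : bool) := if b then ex v v0 else e0 in ex (ex (ex v0 (d v1 x.1.1)) (d v2 x.1.2)) (d v3 x.2).

Lemma affine4 F : affine F -> F =1 aff4 (F e0) (F (true, false, false)) (F (false, true, false)) (F (false, false, true)).
Proof.
move=> h; have h2 x y : F (ex x y) = ex (ex (F x) (F y)) (F e0).
  by rewrite -h ex0.
case=> [[a b] c].
have abc : (a, b, c) = ex (ex (a, false, false) (false, b, false)) (false, false, c).
  by rewrite /ex /= ?addbF ?addFb.
rewrite {1}abc h {abc} /aff4 /=; have k v (d : bool) : F (if d then v else e0) = ex (F e0) (if d then ex (F v) (F e0) else e0).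
  by case: d; rewrite ?ex0 // exC exK.
rewrite (_ : (a, false, false) = if a then (true, false, false) else e0) ?k; last by case: a.
rewrite (_ : (false, b, false) = if b then (false, true, false) else e0) ?k; last by case: b.
rewrite (_ : (false, false, c) = if c then (false, false, true) else e0) ?k; last by case: c.
by rewrite ex_aff.
Qed.

Lemma aff_even_b : all (fun v0 => all (fun v1 => all (fun v2 => all (fun v3 =>
  uniq (map (aff4 v0 v1 v2 v3) allE) ==> ~~ par (map (aff4 v0 v1 v2 v3) allE) allE) allE) allE) allE) allE.
Proof. by vm_compute. Qed.

Lemma affine_even F : injective F -> affine F -> ~~ par (map F allE) allE.
Proof.
move=> Fi /affine4 h; rewrite (eq_map h).
have := allEP (allEP (allEP (allEP aff_even_b (F e0)) (F (true, false, false))) (F (false, true, false))) (F (false, false, true)).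
move/implyP; apply; rewrite -(eq_map h) map_inj_uniq //.
Qed.

(** A bijection compatible with the pairs of vectors differing in the last coordinate only is
    determined by its values at the four vectors where that coordinate is 0. *)
Definition e3fun (v0 v1 v2 v3 : E) (x : E) : E :=
  let v := if x.1.1 then (if x.1.2 then v3 else v2) else (if x.1.2 then v1 else v0) in
  (v.1, v.2 (+) x.2).

Definition affb (F : E -> E) := all (fun x => all (fun y => all (fun z =>
  F (ex (ex x y) z) == ex (ex (F x) (F y)) (F z)) allE) allE) allE.
Lemma affbP F : affb F -> affine F.
Proof. by move=> h x y z; apply/eqP; apply: (allEP (allEP (allEP h x) y) z). Qed.

Lemma e3_affine_b : all (fun v0 => all (fun v1 => all (fun v2 => all (fun v3 =>
  if uniq [:: v0.1; v1.1; v2.1; v3.1] then par (map (e3fun v0 v1 v2 v3) allE) allE || affb (e3fun v0 v1 v2 v3) else true) allE) allE) allE) allE.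
Proof. by vm_compute. Qed.

(** The exceptional fact of degree eight: the even stabilizer of a pairing sits inside AGL_3(2). It
    is checked over all choices of four values. *)
Lemma e3_affine F : injective F -> (forall x y, ((F x).1 == (F y).1) = (x.1 == y.1)) ->
  ~~ par (map F allE) allE -> affine F.
Proof.
move=> Fi Fe.
pose v0 := F (false, false, false); pose v1 := F (false, true, false).
pose v2 := F (true, false, false); pose v3 := F (true, true, false).
have h : F =1 e3fun v0 v1 v2 v3.
  case=> [[a b] c]; rewrite /e3fun /=.
  have -> : (if a then if b then v3 else v2 else if b then v1 else v0) = F (a, b, false) by case: a; case: b.
  case: c; last by rewrite addbF; case: (F _).
  have /eqP := Fe (a, b, true) (a, b, false); rewrite eqxx => /eqP/eqP f1.
  have : F (a, b, true) != F (a, b, false) by rewrite (inj_eq Fi) xpair_eqE andbF.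
  move: f1; case: (F (a, b, true)) (F (a, b, false)) => [u s] [u' s'] /= ->.
  by case: s s' => [] [] //=; rewrite eqxx.
rewrite (eq_map h) => /negPf ev x y z.
have := allEP (allEP (allEP (allEP e3_affine_b v0) v1) v2) v3.
rewrite ev /= !inE !Fe /= => /affbP aff; rewrite !h; exact: aff.
Qed.

Section RowVectors.
Import GRing.Theory.
Local Open Scope ring_scope.

Lemma F2_case (c : 'F_2) : c = 0 \/ c = 1.
Proof. by case: c => [[|[|k]] i] //; [left|right]; apply: val_inj. Qed.

Definition bits (v : E) (j : 'I_3) : bool := nth false [:: v.1.1; v.1.2; v.2] j.
Definition toV (v : E) : 'rV['F_2]_3 := \row_j (bits v j)%:R.

Lemma toV_ex x y : toV (ex x y) = toV x + toV y.
Proof.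
apply/rowP=> j; rewrite !mxE /bits /ex /=; have h (a b : bool) : (a (+) b)%:R = a%:R + b%:R :> 'F_2.
  by case: a b => [] []; apply: val_inj.
by case: j => [[|[|[|k]]] i] //=; rewrite h.
Qed.

Lemma toV_inj : injective toV.
Proof.
have h (a b : bool) : a%:R = b%:R :> 'F_2 -> a = b by case: a b => [] [].
move=> [[a b] c] [[a' b'] c'] /rowP v.
have := v (@Ordinal 3 0 isT); have := v (@Ordinal 3 1 isT); have := v (@Ordinal 3 2 isT).
by rewrite !mxE /bits /= => /h -> /h -> /h ->.
Qed.

Lemma toV_bij : bijective toV.
Proof.
apply: (inj_card_bij toV_inj); rewrite card_mx card_Fp // !card_prod card_bool //.
Qed.

Lemma additive_scale (L : 'rV['F_2]_3 -> 'rV['F_2]_3) : (forall x y, L (x + y) = L x + L y) ->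
  forall (c : 'F_2) x, L (c *: x) = c *: L x.
Proof.
move=> h c x; have L0 : L 0 = 0 by apply: (addrI (L 0)); rewrite -h !addr0.
by case: (F2_case c) => ->; rewrite ?scale0r ?scale1r.
Qed.

Lemma F2_addvv (v : 'rV['F_2]_3) : v + v = 0.
Proof. by apply/rowP=> j; rewrite !mxE; case: (F2_case (v 0 j)) => ->; apply: val_inj. Qed.

(** Additive maps are linear over the field with two elements, and the linear part of a permutation
    is injective, hence has an invertible matrix. *)
Lemma AGLP (p : {perm 'rV['F_2]_3}) :
  reflect (forall x y z, p (x + y + z) = p x + p y + p z) (p \in AGL3_2).
Proof.
rewrite inE; apply: (iffP existsP) => [[A /existsP[b /andP[_ /forallP h]]] x y z|h].
  rewrite !(eqP (h _)) !mulmxDl -!addrA; congr (_ + _).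
  rewrite [in RHS]addrCA; congr (_ + _); rewrite (addrCA b) addrA.
  by rewrite F2_addvv add0r.
pose L v := p v - p 0.
have LD x y : L (x + y) = L x + L y.
  by rewrite /L -{1}(addr0 (x + y)) h addrK addrACA -opprD F2_addvv oppr0 addr0.
have LZ := additive_scale LD.
have L0 : L 0 = 0 by rewrite /L subrr.
pose A : 'M['F_2]_3 := \matrix_i L (delta_mx 0 i).
have LE v : L v = v *m A.
  rewrite mulmx_sum_row {1}(row_sum_delta v) (big_morph L LD L0).
  by apply: eq_bigr => i _; rewrite LZ rowK.
exists A; apply/existsP; exists (p 0); apply/andP; split.
  rewrite -row_free_unit; apply: inj_row_free => v; rewrite -LE /L => /eqP.
  by rewrite subr_eq0 (inj_eq perm_inj) => /eqP.
by apply/forallP=> v; rewrite -LE /L subrK.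
Qed.
End RowVectors.

Section Affine.
Variables (T : finType) (psi : E -> T) (f : T -> E).
Hypotheses (psiK : cancel psi f) (fK : cancel f psi).
Implicit Types (g h : {perm T}) (x y : T) (u v w : E).

Definition gE g v := f (g (psi v)).
Lemma gEf g x : gE g (f x) = f (g x). Proof. by rewrite /gE fK. Qed.
Lemma gEM g h v : gE (g * h) v = gE h (gE g v). Proof. by rewrite /gE permM fK. Qed.
Lemma gE1 v : gE 1 v = v. Proof. by rewrite /gE perm1 psiK. Qed.
Lemma gE_inj g : injective (gE g).
Proof. by move=> u v /(can_inj fK)/perm_inj/(can_inj psiK). Qed.
Lemma gE_eq g h : (forall v, gE g v = gE h v) -> g = h.
Proof. by move=> e; apply/permP=> x; apply: (can_inj fK); rewrite -!gEf. Qed.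

Lemma odd_gE g : odd_perm g = par (map (gE g) allE) allE.
Proof.
rewrite (odd_par (g := g) (ps := map psi allE)).
- rewrite -(par_map _ _ (can_inj psiK)) -!map_comp; congr (par _ _).
  by apply: eq_map => v; rewrite /= /gE fK.
- by rewrite map_inj_uniq //; apply: can_inj psiK.
- by move=> x; rewrite -(fK x) map_f // mem_allE.
Qed.

(** The copy of AGL_3(2) among the permutations of [T] defined by the labelling [psi]; it depends on
    the labelling. *)
Definition Aff := [set g | affb (gE g)].
Lemma AffP g : reflect (affine (gE g)) (g \in Aff).
Proof.
rewrite inE; apply: (iffP idP) => [/affbP//|h].
by apply/allP=> x _; apply/allP=> y _; apply/allP=> z _; apply/eqP/h.
Qed.
Lemma Aff_group_set : group_set Aff.
Proof.
apply/group_setP; split; first by apply/AffP=> x y z; rewrite !gE1.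
by move=> g h /AffP ag /AffP ah; apply/AffP=> x y z; rewrite !gEM ag ah.
Qed.
Canonical Aff_group := Group Aff_group_set.

Lemma Aff_even g : g \in Aff -> ~~ odd_perm g.
Proof. by move=> /AffP ag; rewrite odd_gE; apply: affine_even => //; apply: gE_inj. Qed.

Lemma e3_Aff g : (forall x y, ((f (g x)).1 == (f (g y)).1) = ((f x).1 == (f y).1)) ->
  ~~ odd_perm g -> g \in Aff.
Proof.
move=> h ev; apply/AffP; apply: e3_affine; [exact: gE_inj| |by rewrite -odd_gE].
by move=> u v; rewrite /gE h !psiK.
Qed.

Section Lift.
Variables (F : E -> E) (Fi : injective F).
Lemma lift_inj : injective (fun x => psi (F (f x))).
Proof. by move=> x y /(can_inj psiK)/Fi/(can_inj fK). Qed.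
Definition plift := perm lift_inj.
Lemma gE_plift v : gE plift v = F v. Proof. by rewrite /gE permE !psiK. Qed.
Lemma plift_f x : f (plift x) = F (f x). Proof. by rewrite permE psiK. Qed.
Lemma plift_Aff : affine F -> plift \in Aff.
Proof. by move=> aF; apply/AffP=> x y z; rewrite !gE_plift. Qed.
End Lift.

Lemma Aff_isog : Aff \isog AGL3_2.
Proof.
have [k tK kK] := toV_bij; pose phi x := toV (f x).
have phiK : cancel phi (fun r => psi (k r)) by move=> x; rewrite /phi tK fK.
have Kphi : cancel (fun r => psi (k r)) phi by move=> r; rewrite /phi psiK kK.
have thi g : injective (fun r => phi (g (psi (k r)))).
  by move=> r s /(can_inj phiK)/perm_inj/(can_inj Kphi).
pose th g := perm (thi g).
have thE g x : th g (phi x) = phi (g x) by rewrite permE (phiK x).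
have phis r : exists x, r = phi x by exists (psi (k r)); rewrite Kphi.
have thM : {in setT &, {morph th : g h / g * h}}.
  by move=> g h _ _; apply/permP=> r; have [x ->] := phis r; rewrite permM !thE permM.
have injth : 'injm (Morphism thM).
  apply/injmP=> g h _ _ /= e; apply/permP=> x; apply: (can_inj phiK).
  by rewrite -!thE e.
have -> : AGL3_2 = Morphism thM @* Aff.
  have phiD a b c : phi (psi (ex (ex (f a) (f b)) (f c))) = (phi a + phi b + phi c)%R.
    by rewrite /phi psiK !toV_ex.
  have ag g : reflect (forall a b c, th g (phi a + phi b + phi c)%R = (th g (phi a) + th g (phi b) + th g (phi c))%R) (g \in Aff).
    apply: (iffP (AffP g)) => h.
      move=> a b c; rewrite -phiD !thE -phiD; congr phi; apply: (can_inj fK).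
      by rewrite -(gEf g) !psiK h !gEf.
    move=> u v w; rewrite -(psiK u) -(psiK v) -(psiK w) !gEf.
    have := h (psi u) (psi v) (psi w); rewrite -phiD !thE -phiD => /(can_inj phiK)/(congr1 f).
    by rewrite {1}/gE => ->; rewrite psiK.
  apply/setP=> p; rewrite morphimEsub ?subsetT //; apply/AGLP/imsetP.
    move=> h.
    have gi : injective (fun x => psi (k (p (phi x)))).
      by move=> x y /(can_inj Kphi)/perm_inj/(can_inj phiK).
    have pE : p = th (perm gi).
      by apply/permP=> r; have [x ->] := phis r; rewrite thE permE Kphi.
    by exists (perm gi) => //; apply/ag=> a b c; rewrite -pE h.
  case=> g /ag h -> x y z /=.
  by have [a ->] := phis x; have [b ->] := phis y; have [c ->] := phis z.
by apply: sub_isog; rewrite ?subsetT.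
Qed.

End Affine.

(** A numbering of the plane where the first coordinate is 1; [codeE] forgets that coordinate. *)
Definition ordE (i : 'I_4) : E := (true, 1 < i, odd i).
Definition codeE (v : E) : 'I_4 :=
  if v.1.2 then (if v.2 then @Ordinal 4 3 isT else @Ordinal 4 2 isT)
  else (if v.2 then @Ordinal 4 1 isT else @Ordinal 4 0 isT).
Lemma ordEK : cancel ordE codeE.
Proof. by case=> [[|[|[|[|k]]]] i] //; apply: val_inj. Qed.
Lemma codeEK (v : E) : v.1.1 -> ordE (codeE v) = v.
Proof. by case: v => [[[] []] []]. Qed.

(* the linear extension of a permutation of the affine plane of points with first coordinate 1 *)
Definition linE (s : 'I_4 -> 'I_4) (v : E) : E :=
  let w := ordE (s (codeE v)) in if v.1.1 then w else ex w (ordE (s ord0)).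

Definition lin4 (d0 d1 d2 d3 : E) (v : E) : E :=
  let w := if v.1.2 then (if v.2 then d3 else d2) else (if v.2 then d1 else d0) in
  if v.1.1 then w else ex w d0.
Definition halfE : seq E := [:: (true, false, false); (true, false, true); (true, true, false); (true, true, true)].

Lemma lin4_b : all (fun d0 => all (fun d1 => all (fun d2 => all (fun d3 =>
  uniq [:: d0; d1; d2; d3] ==> [&& affb (lin4 d0 d1 d2 d3), uniq (map (lin4 d0 d1 d2 d3) allE) &
    all (fun v => (lin4 d0 d1 d2 d3 v).1.1 == v.1.1) allE]) halfE) halfE) halfE) halfE.
Proof. by vm_compute. Qed.

(** AGL_2(2) is the full symmetric group of the four points of the plane, and this plane misses the
    origin, so each of its permutations extends linearly to the space. *)
Lemma linE_props (s : {perm 'I_4}) : [/\ affine (linE s), injective (linE s) & forall v, (linE s v).1.1 = v.1.1].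
Proof.
pose d i := ordE (s i).
have h v : linE s v = lin4 (d (@Ordinal 4 0 isT)) (d (@Ordinal 4 1 isT)) (d (@Ordinal 4 2 isT)) (d (@Ordinal 4 3 isT)) v.
  have o : ord0 = @Ordinal 4 0 isT by apply: val_inj.
  by rewrite /linE o; case: v => [[[] []] []].
have m i : d i \in halfE by rewrite /d /ordE; case: (1 < _); case: (odd _).
have := allP (allP (allP (allP lin4_b _ (m (@Ordinal 4 0 isT))) _ (m (@Ordinal 4 1 isT))) _ (m (@Ordinal 4 2 isT))) _ (m (@Ordinal 4 3 isT)).
have -> : uniq [:: d (@Ordinal 4 0 isT); d (@Ordinal 4 1 isT); d (@Ordinal 4 2 isT); d (@Ordinal 4 3 isT)].
  rewrite (map_inj_uniq (f := d) (_ : injective d) [:: @Ordinal 4 0 isT; @Ordinal 4 1 isT; @Ordinal 4 2 isT; @Ordinal 4 3 isT]) //.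
  by apply: inj_comp perm_inj; apply: can_inj ordEK.
rewrite implyTb => /and3P[/affbP a u c]; split.
- by move=> x y z; rewrite !h; apply: a.
- move=> x y; rewrite !h => e.
  set L := lin4 _ _ _ _ in u e; have := mem_allE x; have := mem_allE y => yA xA.
  have ix : index x allE < size allE by rewrite index_mem.
  have iy : index y allE < size allE by rewrite index_mem.
  rewrite -(nth_index e0 xA) -(nth_index e0 yA); congr (nth _ _ _).
  by apply/eqP; rewrite -(nth_uniq e0 (s := map L allE)) ?size_map // !(nth_map e0) // !nth_index // e.
- by move=> v; rewrite h; apply/eqP/(allEP c).
Qed.

(** * The affine stabilizer of a pair of parallel planes *)

Section Cube.
Variables (T : finType) (psi : E -> T) (f : T -> E).
Hypotheses (psiK : cancel psi f) (fK : cancel f psi).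
Implicit Types (g h : {perm T}) (x y : T) (u v w : E).
Local Notation gE := (gE psi f).

Lemma ex_inj w : injective (fun v => ex v w).
Proof. by move=> u v /(congr1 (fun t => ex t w)); rewrite !exK. Qed.
Definition transl w := plift psiK fK (@ex_inj w).
Lemma translE w v : gE (transl w) v = ex v w. Proof. exact: gE_plift. Qed.
Lemma translM u w : transl u * transl w = transl (ex u w).
Proof. by apply: (gE_eq fK) => v; rewrite (gEM fK) !translE exA. Qed.
Lemma transl_inj : injective transl.
Proof.
move=> u w e; have : gE (transl u) e0 = gE (transl w) e0 by rewrite e.
by rewrite !translE !(exC e0) !ex0.
Qed.
Definition translations := transl @: [set: E].
Lemma translations_group_set : group_set translations.
Proof.
apply/group_setP; split.
  apply/imsetP; exists e0 => //; apply: (gE_eq fK) => v.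
  by rewrite translE gE1 // ex0.
by move=> _ _ /imsetP[u _ ->] /imsetP[w _ ->]; rewrite translM imset_f.
Qed.
Canonical translations_group := Group translations_group_set.

Lemma translations_abelem : 2.-abelem translations /\ #|translations| = 8.
Proof.
split; last by rewrite card_imset ?cardsT ?card_prod ?card_bool //; apply: transl_inj.
apply/abelemP => //; split.
  by apply/centsP=> _ /imsetP[u _ ->] _ /imsetP[w _ ->]; rewrite /commute !translM exC.
move=> _ /imsetP[u _ ->]; rewrite expgS expg1 translM exx.
by apply: (gE_eq fK) => v; rewrite translE gE1 // ex0.
Qed.

Variable L : {group {perm T}}.
Hypothesis LP : forall g, reflect (g \in Aff psi f /\ forall x y, ((f (g x)).1.1 == (f (g y)).1.1) = ((f x).1.1 == (f y).1.1)) (g \in L).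

Let LA g : g \in L -> affine (gE g). Proof. by case/LP=> /AffP. Qed.
Let L1 g u v : g \in L -> ((gE g u).1.1 == (gE g v).1.1) = (u.1.1 == v.1.1).
Proof. by case/LP=> _ h; rewrite h !psiK. Qed.

Lemma transl_L w : transl w \in L.
Proof.
apply/LP; split; first by apply: plift_Aff => x y z; rewrite !(exC _ w) ex_aff !exA.
by move=> x y; rewrite -!(gEf fK) !translE /=; case: (f x).1.1 (f y).1.1 w.1.1 => [] [] [].
Qed.

(** [L] stabilizes two parallel planes in the affine group. The translations are the normal subgroup
    of order 8; the elements fixing the origin act on the plane missing it as Sym(4). *)
Lemma cube_sdprod : is_2cube_sdprod_S4 L.
Proof.
pose S := [set g in L | gE g e0 == e0].
have SP g : reflect (g \in L /\ gE g e0 = e0) (g \in S) by rewrite inE; apply: (iffP andP) => -[h /eqP].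
have Sg : group_set S.
  apply/group_setP; split; first by apply/SP; rewrite group1 gE1.
  by move=> g h /SP[gL g0] /SP[hL h0]; apply/SP; rewrite groupM // (gEM fK) g0.
have [Nab N8] := translations_abelem.
exists translations_group, (Group Sg); split=> //.
  pose th (s : {perm 'I_4}) := plift psiK fK (let: And3 _ i _ := linE_props s in i).
  have thE s v : gE (th s) v = linE s v by apply: gE_plift.
  have l0 (s : {perm 'I_4}) : linE s e0 = e0 by rewrite /linE /= (_ : codeE e0 = ord0) ?exx //; apply: val_inj.
  have ordE1 i : (ordE i).1.1 by [].
  have thM : {in setT &, {morph th : g h / g * h}}.
    move=> s t _ _; apply: (gE_eq fK) => v; rewrite (gEM fK) !thE.
    have [ta ti t1] := linE_props t.
    have lt i : linE t (ordE i) = ordE (t i) by rewrite /linE ordE1 ordEK.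
    have [v1|v1] := boolP v.1.1.
      have -> : linE s v = ordE (s (codeE v)) by rewrite /linE v1.
      by rewrite lt /linE v1 permM.
    have -> : linE s v = ex (ordE (s (codeE v))) (ordE (s ord0)) by rewrite /linE (negPf v1).
    by rewrite -[X in linE t X]ex0 ta !lt l0 ex0 /linE (negPf v1) !permM.
  have injth : 'injm (Morphism thM).
    apply/injmP=> s t _ _ /= e; apply/permP=> i; apply: (can_inj ordEK).
    have : gE (th s) (ordE i) = gE (th t) (ordE i) by rewrite e.
    by rewrite !thE /linE ordE1 ordEK.
  suff -> : gval (Group Sg) = Morphism thM @* 'Sym_('I_4).
    by rewrite isog_sym; apply: sub_isog; rewrite ?subsetT.
  rewrite [gval _]/=.
  apply/setP=> g; rewrite morphimEsub ?subsetT //; apply/SP/imsetP.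
    case=> gL g0; have gY v : (gE g v).1.1 = v.1.1.
      have := L1 v e0 gL; rewrite g0 /=; case: (gE g v).1.1; case: v.1.1 => //.
    have ci : injective (fun i => codeE (gE g (ordE i))).
      move=> i j /(congr1 ordE); rewrite !codeEK ?gY // => /(gE_inj psiK fK)/(can_inj ordEK) //.
    exists (perm ci); first by rewrite inE.
    apply: (gE_eq fK) => v; rewrite /= thE /linE !permE.
    have cg i : ordE (codeE (gE g (ordE i))) = gE g (ordE i) by rewrite codeEK ?gY.
    rewrite !cg; case: ifP => v1; first by rewrite codeEK.
    have gD u w : gE g (ex u w) = ex (gE g u) (gE g w).
      by rewrite -{1}(ex0 (ex u w)) (LA gL) g0 ex0.
    rewrite -gD; congr (gE g _).
    by case: v v1 => [[[] []] []].
  case=> s _ -> /=; have [sa si s1] := linE_props s.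
  split; last by rewrite thE.
  apply/LP; split; first exact: plift_Aff.
  by move=> x y; rewrite -!(gEf fK) !thE !s1.
have nN : S \subset 'N(translations).
  apply/subsetP=> g /SP[gL g0]; rewrite inE; apply/subsetP=> _ /imsetP[_ /imsetP[w _ ->] ->].
  apply/imsetP; exists (gE g w) => //; apply: (gE_eq fK) => v; rewrite translE.
  have vE : gE g (gE g^-1 v) = v by rewrite -(gEM fK) mulVg gE1.
  by rewrite !(gEM fK) translE -[ex _ w]ex0 (LA gL) g0 ex0 vE.
rewrite sdprodE //=; last first.
  apply/eqP; rewrite eqEsubset sub1set inE (group1 translations_group) (group1 (Group Sg)) !andbT.
  apply/subsetP=> _ /setIP[/imsetP[w _ ->] /SP[_]]; rewrite translE exC ex0 => ->.
  by apply/set1P/(gE_eq fK) => v; rewrite translE gE1 // ex0.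
apply/setP=> g; apply/mulsgP/idP.
  by case=> _ k /imsetP[w _ ->] /SP[kL _] ->; rewrite groupM // transl_L.
move=> gL; pose w := gE g^-1 e0.
exists (transl w) (transl w * g).
- by rewrite imset_f.
- by apply/SP; rewrite groupM ?transl_L // (gEM fK) translE exC ex0 /w -(gEM fK) mulVg gE1.
by rewrite mulgA translM exx; apply: (gE_eq fK) => v; rewrite (gEM fK) translE ex0.
Qed.
End Cube.

(** * Degree eight *)

Lemma perm_neq (T : finType) (g : {perm T}) a b c : g a = b -> c != a -> g c != b.
Proof. by move=> <-; rewrite (inj_eq perm_inj). Qed.

Section FourPoints.
Variables (T : finType) (X : {set T}).
Hypothesis X4 : #|X| = 4.
Implicit Types (x y z t : T) (s g : {perm T}).

Lemma four_points x y : x \in X -> y \in X -> x != y ->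
  exists z w, [/\ z \in X, w \in X, uniq [:: x; y; z; w] & forall t, t \in X -> [|| t == x, t == y, t == z | t == w]].
Proof.
move=> xX yX xy.
have : #|X :\ x :\ y| == 2.
  by have := cardsD1 x X; have := cardsD1 y (X :\ x); rewrite X4 xX !inE eq_sym xy yX /= => -> -[->].
case/cards2P=> z [w [zw E]].
have zE : z \in X :\ x :\ y by rewrite E !inE eqxx.
have wE : w \in X :\ x :\ y by rewrite E !inE eqxx orbT.
move: zE wE; rewrite !inE => /and3P[zy zx zX] /and3P[wy wx wX].
exists z, w; split=> //; first by rewrite /= !inE; rwneq.
move=> t tX; have /setP/(_ t) := E; rewrite !inE tX andbT.
by case: (t == x); case: (t == y).
Qed.

End FourPoints.

Lemma even_fix2 (T : finType) (X : {set T}) (q : {perm T}) x y : #|X| = 4 -> perm_on X q ->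
  x \in X -> y \in X -> x != y -> q x = x -> q y = y -> ~~ odd_perm q -> q = 1.
Proof.
move=> X4 qX xX yX xy qx qy; apply: contraNeq => q1.
have [z [w [zX wX]]] := four_points X4 xX yX xy.
rewrite /= !inE !negb_or => /and4P[/and3P[_ xz xw] /andP[yz yw] zw _] all4.
have [qz|qz] := eqVneq (q z) z.
  case/eqP: q1; apply/permP=> t; rewrite perm1; have [tX|/(out_perm qX)//] := boolP (t \in X).
  have qw : q w = w.
    have := all4 (q w); rewrite (perm_closed _ qX) => /(_ wX).
    have n1 : q w != x by apply: perm_neq qx _; rewrite eq_sym.
    have n2 : q w != y by apply: perm_neq qy _; rewrite eq_sym.
    have n3 : q w != z by apply: perm_neq qz _; rewrite eq_sym.
    by rewrite (negPf n1) (negPf n2) (negPf n3) => /eqP.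
  by case/or4P: (all4 t tX) => /eqP->.
have qzw : q z = w.
  have := all4 (q z); rewrite (perm_closed _ qX) => /(_ zX).
  have n1 : q z != x by apply: perm_neq qx _; rewrite eq_sym.
  have n2 : q z != y by apply: perm_neq qy _; rewrite eq_sym.
  by rewrite (negPf n1) (negPf n2) (negPf qz) => /eqP.
have qwz : q w = z.
  have := all4 (q w); rewrite (perm_closed _ qX) => /(_ wX).
  have n1 : q w != x by apply: perm_neq qx _; rewrite eq_sym.
  have n2 : q w != y by apply: perm_neq qy _; rewrite eq_sym.
  have n3 : q w != w by apply: perm_neq qzw _; rewrite eq_sym.
  by rewrite (negPf n1) (negPf n2) (negPf n3) orbF => /eqP.
suff -> : q = tperm z w by rewrite odd_tperm zw.
apply/permP=> t; have [tX|tX] := boolP (t \in X); last first.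
  by rewrite (out_perm qX tX) tpermD //; apply: contraNneq tX => <-.
case/or4P: (all4 t tX) => /eqP->; rewrite ?qx ?qy ?qzw ?qwz ?tpermL ?tpermR // tpermD //; by rewrite eq_sym.
Qed.

Section FourPerm.
Variables (T : finType) (X : {set T}).
Hypothesis X4 : #|X| = 4.
Implicit Types (x y z t : T).

Section Perm.
Variable s : {perm T}.
Hypotheses (sX : perm_on X s).
Let cl t : (s t \in X) = (t \in X). Proof. exact: perm_closed. Qed.

(** The other permutations of four points without fixed points are the 4-cycles, which are odd. *)
Lemma dt_sq : ~~ odd_perm s -> (forall t, t \in X -> s t != t) -> forall t, t \in X -> s (s t) = t.
Proof.
move=> ev_s fs x xX; apply/eqP/negPn/negP => n; set y := s x in n; set z := s y in n.
have yX : y \in X by rewrite cl.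
have zX : z \in X by rewrite cl.
have yx : y != x by apply: fs.
have zy : z != y by apply: fs.
have [a [w [aX wX]]] := four_points X4 xX yX (ltac:(by rewrite eq_sym)).
rewrite /= !inE !negb_or => /and4P[/and3P[xy xa xw] /andP[ya yw] aw _] all4.
wlog az : a w aX wX xa xw ya yw aw all4 / a = z.
  move=> W; have := all4 z zX; rewrite (negPf n) (negPf zy) /= => /orP[/eqP az|/eqP wz].
    exact: (W a w).
  apply: (W w a) => //; first by rewrite eq_sym.
  by move=> t tX; have := all4 t tX; rewrite (orbC (t == a)).
rewrite az in xa ya aw all4.
have szX : s z \in X by rewrite cl.
have swX : s w \in X by rewrite cl.
have szy : s z != y by apply: (perm_neq (erefl (s x)) n).
have szw : s z = w.
  have := all4 _ szX; rewrite (negPf szy) (negPf (fs z zX)) /= => /orP[/eqP szx|/eqP //].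
  have := all4 _ swX; rewrite (negPf (fs w wX)).
  have n1 : s w != x by apply: perm_neq szx _; rewrite eq_sym.
  have n2 : s w != y by apply: (perm_neq (erefl (s x))); rewrite eq_sym.
  have n3 : s w != z by apply: (perm_neq (erefl (s y))); rewrite eq_sym.
  by rewrite (negPf n1) (negPf n2) (negPf n3).
have swx : s w = x.
  have := all4 _ swX; rewrite (negPf (fs w wX)).
  have n2 : s w != y by apply: (perm_neq (erefl (s x))); rewrite eq_sym.
  have n3 : s w != z by apply: (perm_neq (erefl (s y))); rewrite eq_sym.
  by rewrite (negPf n2) (negPf n3) !orbF => /eqP.
case/negP: ev_s; rewrite (odd_par (ps := [:: x; y; z; w])).
- rewrite /= -/y -/z szw swx /swapf; rwneq; rewrite /=; rwneq; done.
- by rewrite /= !inE; rwneq.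
- move=> t; rewrite !inE => h; apply: (out_perm sX); apply: contra h; exact: all4.
Qed.

(** The odd permutations of four points are transpositions and 4-cycles, and the latter fix
    nothing. *)
Lemma odd_fix x : x \in X -> s x = x -> odd_perm s ->
  exists a b, [/\ a \in X, b \in X, a != b & s = tperm a b].
Proof.
move=> xX sx os.
have s1 : s != 1 by apply: contraTneq os => ->; rewrite odd_perm1.
have [y sy] : exists y, s y != y.
  apply/existsP; apply: contraNT s1; rewrite negb_exists => /forallP h.
  by apply/eqP/permP=> t; rewrite perm1; apply/eqP; move: (h t); rewrite negbK.
have yX : y \in X by apply: contraR sy => /(out_perm sX)->.
have xy : x != y by apply: contraNneq sy => <-; rewrite sx.
pose z := s y; have zX : z \in X by rewrite cl.
have xz : x != z by rewrite -{1}sx (inj_eq perm_inj).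
pose q := s * tperm z y.
have qX : perm_on X q by apply: perm_onM => //; apply: tperm_on.
have qx : q x = x by rewrite permM sx tpermD // eq_sym.
have qy : q y = y by rewrite permM -/z tpermL.
have q1 : q = 1.
  have eq : ~~ odd_perm q by rewrite odd_permM os odd_tperm eq_sym -/z eq_sym sy.
  exact: (even_fix2 X4 qX xX yX xy qx qy eq).
exists z, y; split=> //.
by rewrite -[s]mulg1 -(tperm2 z y) mulgA -/q q1 mul1g.
Qed.
Lemma inv_fix x : x \in X -> s x = x -> ~~ odd_perm s -> (forall t, s (s t) = t) -> s = 1.
Proof.
move=> xX sx eqv_sym s2; have [//|s1] := eqVneq s 1.
have [y sy] : exists y, s y != y.
  apply/existsP; apply: contraNT s1; rewrite negb_exists => /forallP h.
  by apply/eqP/permP=> t; rewrite perm1; apply/eqP; move: (h t); rewrite negbK.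
have yX : y \in X by apply: contraR sy => /(out_perm sX)->.
have xy : x != y by apply: contraNneq sy => <-; rewrite sx.
have syX : s y \in X by rewrite cl.
have nyx : x != s y by rewrite -{1}sx (inj_eq perm_inj).
have ysy : y != s y by rewrite eq_sym.
have q1 (w : T) : w \in X -> w != x -> w != y -> w != s y -> s w = w.
  move=> wX wx wy wsy; have [z [u [zX uX]]] := four_points X4 xX yX xy.
  rewrite /= !inE !negb_or => /and4P[/and3P[_ xz xu] /andP[yz yu] zu _] all4.
  have n1 : s w != x by apply: perm_neq sx _.
  have n2 : s w != y by apply: perm_neq (s2 y) _.
  have n3 : s w != s y by rewrite (inj_eq perm_inj).
  have swX : s w \in X by rewrite cl.
  have := all4 _ swX; have := all4 _ wX; have := all4 _ syX.
  rewrite (negPf sy) (eq_sym (s y) x) (negPf nyx) (negPf n1) (negPf n2) (negPf wx) (negPf wy) /=.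
  case/orP=> /eqP E; rewrite -E ?(negPf wsy) ?(negPf n3) ?orbF /= => /eqP wE /eqP; first by rewrite -wE.
  by rewrite -wE.
case/negP: eqv_sym; rewrite (_ : s = tperm y (s y)) ?odd_tperm //.
apply/permP=> t; case: tpermP => [->|->|]; rewrite ?s2 // => /eqP ty /eqP tsy.
have [tX|/(out_perm sX)//] := boolP (t \in X).
by have [->//|tx] := eqVneq t x; apply: q1.
Qed.
End Perm.

(** Both are double transpositions, and the Klein four-group is regular. *)
Lemma dt_eq s s' x : perm_on X s -> perm_on X s' -> ~~ odd_perm s -> ~~ odd_perm s' ->
  (forall t, t \in X -> s t != t) -> (forall t, t \in X -> s' t != t) -> x \in X -> s x = s' x -> s = s'.
Proof.
move=> sX sX' ev_s es' fs fs' xX sx.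
have sq := dt_sq sX ev_s fs; have sq' := dt_sq sX' es' fs'.
pose y := s x; have yX : y \in X by rewrite (perm_closed _ sX).
have xy : x != y by rewrite eq_sym fs.
have [z [w [zX wX]]] := four_points X4 xX yX xy.
rewrite /= !inE !negb_or => /and4P[/and3P[_ xz xw] /andP[yz yw] zw _] all4.
have oth (g : {perm T}) : perm_on X g -> (forall t, t \in X -> g t != t) -> g x = y -> g y = x -> g z = w /\ g w = z.
  move=> gX fg gx gy.
  have gzX : g z \in X by rewrite (perm_closed _ gX).
  have gwX : g w \in X by rewrite (perm_closed _ gX).
  have n1 : g z != x by apply: perm_neq gy _; rewrite eq_sym.
  have n2 : g z != y by apply: perm_neq gx _; rewrite eq_sym.
  have n3 : g w != x by apply: perm_neq gy _; rewrite eq_sym.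
  have n4 : g w != y by apply: perm_neq gx _; rewrite eq_sym.
  split.
    by have := all4 _ gzX; rewrite (negPf n1) (negPf n2) (negPf (fg z zX)) => /eqP.
  by have := all4 _ gwX; rewrite (negPf n3) (negPf n4) (negPf (fg w wX)) orbF => /eqP.
have sy : s y = x := sq x xX.
have sy' : s' y = x by rewrite /y sx sq'.
have [h1 h2] := oth s sX fs erefl sy.
have [h3 h4] := oth s' sX' fs' (esym sx) sy'.
apply/permP=> t; have [tX|tX] := boolP (t \in X); last by rewrite !(out_perm _ tX).
by case/or4P: (all4 t tX) => /eqP->; rewrite ?sx ?sy ?sy' ?h1 ?h2 ?h3 ?h4.
Qed.
End FourPerm.

Section Eight.
Variables (T : finType) (G : {group {perm T}}).
Implicit Types (x y z t u v : T) (g h k m : {perm T}).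
Hypothesis hG : forall g, (g \in G) = ~~ (true && odd_perm g).
Hypothesis T8 : #|T| = 8.

Section Rel.
Variable e : rel T.
Hypothesis ee : equivalence_rel e.
Hypothesis a4 : forall x, #|cls e x| = 4.
Local Notation M := (rstab_group G e).

Lemma two_classes x y z : ~~ e x y -> e x z || e y z.
Proof.
move=> xy; have := cardsUI (cls e x) (cls e y).
have /eqP -> : cls e x :&: cls e y == set0 by rewrite setI_eq0 cls_disj.
rewrite cards0 addn0 !a4 => h; have /eqP/setP/(_ z) : cls e x :|: cls e y == setT.
  by rewrite eqEcard subsetT cardsT T8 h.
by rewrite !inE.
Qed.

Lemma nall4 : exists x y, ~~ e x y.
Proof.
have [/existsP[x /existsP[y xy]]|no] := boolP [exists x, exists y, ~~ e x y]; first by exists x, y.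
have /card_gt0P[x _] : 0 < #|T| by rewrite T8.
have : #|[set: T]| <= #|cls e x|; last by rewrite cardsT T8 a4.
apply/subset_leq_card/subsetP=> y _; rewrite inE; move: no; rewrite negb_exists => /forallP/(_ x).
by rewrite negb_exists => /forallP/(_ y); rewrite negbK.
Qed.

Let a3 x : 2 < #|cls e x|. Proof. by rewrite a4. Qed.

(** The product of the Klein four-groups of the two classes: an involution even on four points is a
    double transposition. *)
Definition dtB := [set g in evB G e | [forall x, g (g x) == x]].
Lemma dtBP g : reflect (g \in evB G e /\ forall x, g (g x) = x) (g \in dtB).
Proof. by rewrite [_ \in dtB]in_set; apply: (iffP andP) => -[gB h]; split=> //; [move=> x; apply/eqP/(forallP h)|apply/forallP=> x; apply/eqP]. Qed.

Lemma dtB_group_set : group_set dtB.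
Proof.
apply/group_setP; split; first by apply/dtBP; split; [exact: (group1 (evB_group G ee))|move=> x; rewrite !perm1].
move=> g h /dtBP[gE g2] /dtBP[hE h2]; apply/dtBP; split; first exact: (groupM (G := evB_group G ee)).
have /evBP[gk gs] := gE; have /evBP[hk hs] := hE => x.
pose X := cls e x; pose s := restr_perm X g; pose t := restr_perm X h.
have stg := bker_st ee x gk; have sth := bker_st ee x hk.
have xX : x \in X by rewrite inE eqv_refl.
have sX : perm_on X s := rs_on X g; have tX : perm_on X t := rs_on X h.
have sE y : y \in X -> s y = g y by move=> yX; apply: rsE.
have tE y : y \in X -> t y = h y by move=> yX; apply: rsE.
have sc y : (s y \in X) = (y \in X) by apply: perm_closed.
have tc y : (t y \in X) = (y \in X) by apply: perm_closed.
have sq (q : {perm T}) r : perm_on X q -> (forall y, y \in X -> q y = r y) -> (forall y, r (r y) = y) -> forall y, q (q y) = y.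
  move=> qX qr r2 y; have [yX|yX] := boolP (y \in X); last by rewrite !(out_perm qX).
  by rewrite qr ?(perm_closed _ qX) // qr // r2.
have s2 := sq s g sX sE g2; have t2 := sq t h tX tE h2.
have ev_s : ~~ odd_perm s by rewrite -[odd_perm s]/(sgn e x g) gs.
have ev_t : ~~ odd_perm t by rewrite -[odd_perm t]/(sgn e x h) hs.
have rE y : y \in X -> (s * t) y = (g * h) y.
  by move=> yX; rewrite !permM -sE // tE // sc.
have rX : perm_on X (s * t) by apply: perm_onM.
suff r2 : (s * t) ((s * t) x) = x by rewrite -(rE x xX) -rE ?r2 // (perm_closed _ rX).
have fpf (q : {perm T}) z : perm_on X q -> ~~ odd_perm q -> (forall y, q (q y) = y) -> q z != z -> forall y, y \in X -> q y != y.
  move=> qX eq q2 qz y yX; apply: contraNneq qz => qy.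
  by rewrite (inv_fix (a4 x) qX yX qy eq q2) perm1.
have [/exists_inP[z zX /eqP rz]|no] := boolP [exists z in X, (s * t) z == z]; last first.
  apply: (dt_sq (a4 x) rX) => //; first by rewrite odd_permM (negPf ev_s).
  by move=> y yX; move: no; rewrite negb_exists_in => /forall_inP/(_ y yX).
have sz : s z = t z by rewrite -{2}rz permM t2.
have [sz1|sz1] := eqVneq (s z) z.
  have -> : s = 1 by apply: (inv_fix (a4 x) sX zX).
  have -> : t = 1 by apply: (inv_fix (a4 x) tX zX); rewrite // -sz.
  by rewrite !permM !perm1.
have -> : t = s.
  apply: (dt_eq (a4 x) tX sX ev_t ev_s _ _ zX) => //; last exact: (fpf s z).
  by apply: (fpf t z) => //; rewrite -sz.
by rewrite !permM !s2.
Qed.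
Canonical dtB_group := Group dtB_group_set.

Lemma dtBM : dtB \subset M.
Proof. by apply/subsetP=> g /dtBP[gE _]; apply: (subsetP (evBM G ee)). Qed.

Lemma dtBJ g k : g \in dtB -> k \in M -> g ^ k \in dtB.
Proof.
move=> /dtBP[gE g2] kM; apply/dtBP; split.
  have nk := subsetP (evB_norm (G := G) (K := M) ee (subxx M)) _ kM.
  by rewrite (memJ_norm _ nk).
by move=> x; rewrite -{1}(permKV k x) !permJ g2 permKV.
Qed.

Section NoN1.
Variable K : {group {perm T}}.
Hypothesis KM : K \subset M.
Hypothesis mx : forall L : {group {perm T}}, K \subset L -> L \subset M -> L \subset K \/ M \subset L.

(** The graph case cannot occur here. [dtB] has double transpositions supported on a class, so [M]
    is [K] times [dtB]. Write a 3-cycle [m] as [k * v]: off the class [k] agrees with [v], so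
    [k * k] is 1 and [m * m] is in [dtB], giving [m] order dividing 4. *)
Lemma no_N1 : ~ (forall x (u : {perm T}), u \in K -> perm_on (cls e x) u -> u = 1).
Proof.
move=> N1; have [x _] := nall4.
have xX : x \in cls e x by rewrite inE eqv_refl.
have [y xy yx] := @cls_avoid _ e x [:: x] (ltnW (a3 x)); rewrite inE in yx.
have yX : y \in cls e x by rewrite inE.
have nxy : x != y by rewrite eq_sym.
have [z [w [zX wX]]] := four_points (a4 x) xX yX nxy.
rewrite /= !inE !negb_or => /and4P[/and3P[_ xz xw] /andP[yz yw] zw _] all4.
have nK : K \subset 'N(dtB).
  by apply/subsetP=> k kK; rewrite inE; apply/subsetP=> _ /imsetP[g gV ->]; apply: dtBJ => //; apply: (subsetP KM).
have evBcls g : perm_on (cls e x) g -> ~~ odd_perm g -> g \in evB G e.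
  move=> gX go; have gG : g \in G by rewrite hG.
  apply/evBP; split; first exact: (on_bker ee gX).
  move=> t; have [xt|xt] := boolP (e x t).
    by rewrite /sgn -(cls_eq ee xt) rs_id // (negPf go).
  by apply: (sgn_off ee (y := x)) => //; rewrite eqv_sym.
pose d := tperm x y * tperm z w.
have dX : perm_on (cls e x) d by apply: perm_onM; apply: tperm_on.
have dV : d \in dtB.
  apply/dtBP; split; first by apply: evBcls; rewrite // odd_permM !odd_tperm nxy zw.
  move=> t; have com : tperm x y * tperm z w = tperm z w * tperm x y.
    apply/commgP/conjg_fixP; rewrite tpermJ !tpermD //; rwneq; done.
  by rewrite -permM /d {2}com mulgA -(mulgA (tperm x y)) tperm2 mulg1 tperm2 perm1.
case: (mem_mulN (P := dtB_group) KM mx dtBM nK) => [sub|lift].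
  have := N1 x d (subsetP sub _ dV) dX => /permP/(_ x).
  rewrite permM tpermL perm1 tpermD 1?eq_sym // => h.
  by rewrite h eqxx in yx.
pose m := cyc3 x y z.
have mX : perm_on (cls e x) m by apply: cyc3_on.
have mM : m \in M by apply: (subsetP (evBM G ee)); apply: evBcls; rewrite // odd_cyc3.
have [k kK [v vV mE]] := lift m mM.
have /dtBP[vE v2] := vV.
have vv : v * v = 1 by apply/permP=> t; rewrite permM v2 perm1.
have mk : m \in bker G e by apply: (on_bker ee mX); rewrite hG odd_cyc3.
have kk : k \in bker G e.
  by rewrite -[bker G e]/(gval (bker_group G ee)) -(groupMr k (_ : v \in bker_group G ee)) -?mE //; case/evBP: vE.
have k2 : k * k = 1.
  apply: (N1 x); first exact: groupM.
  apply/subsetP=> t; rewrite !inE; apply: contraR => xt.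
  have kt s : ~~ e x s -> k s = v s.
    move=> xs; have ms : m s = s by apply: (out_perm mX); rewrite inE.
    by rewrite -{2}ms mE permM v2.
  rewrite permM kt // kt ?v2 //.
  apply: contra xt => h; have /evBP[/(bkerP _ ee)[_ ve] _] := vE.
  by apply: (eqv_trans ee h); rewrite eqv_sym.
have m2V : m * m \in dtB.
  have -> : m * m = v ^ k * v.
    have kV : k^-1 = k by rewrite -[k^-1]mulg1 -k2 mulKg.
    by rewrite mE conjgE kV !mulgA.
  by rewrite (groupM (G := dtB_group)) // dtBJ // (subsetP KM).
have /dtBP[_ m4] := m2V.
have [e1 e2 e3] : [/\ m x = y, m y = z & m z = x] by split; rewrite /m cyc3E //; rwneq.
have := m4 x; rewrite (permM m m x) e1 e2 (permM m m z) e3 e1 => h.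
by rewrite h eqxx in yx.
Qed.
End NoN1.
End Rel.

Lemma label8 (l : seq T) (x0 : T) : uniq l -> size l = 8 -> exists (psi : E -> T) f,
  [/\ cancel psi f, cancel f psi & forall v : E, psi v = nth x0 l (v.1.1 * 4 + v.1.2 * 2 + v.2)%N].
Proof.
move=> ul sl; pose psi (v : E) := nth x0 l (v.1.1 * 4 + v.1.2 * 2 + v.2)%N.
have lt (v : E) : (v.1.1 * 4 + v.1.2 * 2 + v.2 < 8)%N by case: v => [[[] []] []].
have inj : injective psi.
  move=> u v /eqP; rewrite nth_uniq ?sl //.
  by case: u v => [[[] []] []] [[[] []] []].
have [f fK psiK] : bijective psi.
  by apply: inj_card_bij => //; rewrite T8 !card_prod card_bool.
by exists psi, f.
Qed.

(** Chosen representatives of the four pairs, indexed by the first two coordinates; the last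
    coordinate is left to select a point in the pair. *)
Definition base4 (x0 y0 z0 w0 : T) (v : E) :=
  if v.1.1 then (if v.1.2 then w0 else z0) else (if v.1.2 then y0 else x0).

Lemma pair_label (e : rel T) x0 y0 z0 w0 : equivalence_rel e -> (forall x, #|cls e x| = 2) ->
  pairwise (fun x y => ~~ e x y) [:: x0; y0; z0; w0] ->
  exists (psi : E -> T) f, [/\ cancel psi f, cancel f psi, forall x y, e x y = ((f x).1 == (f y).1) &
    forall v : E, e (base4 x0 y0 z0 w0 v) (psi v)].
Proof.
move=> ee c2 /=; rewrite !andbT => /and3P[/and3P[xy xz xw] /andP[yz yw] zw].
have [a1 a2 a3 a4] := mate_neq ee c2 xy; have [b1 b2 b5 b4] := mate_neq ee c2 xz.
have [d1 d2 d3 d4] := mate_neq ee c2 xw; have [f1 f2 f3 f4] := mate_neq ee c2 yz.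
have [g1 g2 g3 g4] := mate_neq ee c2 yw; have [h1 h2 h3 h4] := mate_neq ee c2 zw.
have p1 := mate_ne c2 x0; have p2 := mate_ne c2 y0; have p3 := mate_ne c2 z0; have p4 := mate_ne c2 w0.
pose l := [:: x0; mate e x0; y0; mate e y0; z0; mate e z0; w0; mate e w0].
have [|//|psi [f [psiK fK psiE]]] := @label8 l x0.
  by rewrite /= !inE; rwneq.
have be (v : E) : e (base4 x0 y0 z0 w0 v) (psi v).
  by rewrite psiE /base4; case: v => [[[] []] []] /=; rewrite ?eqv_refl ?mate_rel.
exists psi, f; split=> // x y; rewrite -{1}(fK x) -{1}(fK y).
rewrite -(eqv_congr ee (be (f x))) eqv_sym // -(eqv_congr ee (be (f y))) eqv_sym // /base4.
have nE a b : ~~ e a b -> e a b = false /\ e b a = false by rewrite (eqv_sym ee b a) => /negPf.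
have [m1 m1'] := nE _ _ xy; have [m2 m2'] := nE _ _ xz; have [m3 m3'] := nE _ _ xw.
have [m4 m4'] := nE _ _ yz; have [m5 m5'] := nE _ _ yw; have [m6 m6'] := nE _ _ zw.
case: (f x) (f y) => [[[] []] c] [[[] []] c'] /=.
all: by rewrite ?(eqv_refl ee) ?m1 ?m1' ?m2 ?m2' ?m3 ?m3' ?m4 ?m4' ?m5 ?m5' ?m6 ?m6'.
Qed.

Definition eqpart (e : rel T) : {set {set T}} := [set cls e x | x : T].
Lemma eqpart_partition (e : rel T) : equivalence_rel e -> partition (eqpart e) setT.
Proof.
move=> ee; have -> : eqpart e = equivalence_partition e setT.
  apply/setP=> A; apply/imsetP/imsetP => -[x _ ->]; exists x => //.
    by apply/setP=> y; rewrite !inE.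
  by apply/setP=> y; rewrite !inE.
by apply: equivalence_partitionP => x y z _ _ _; apply: ee.
Qed.

Lemma sizes8 (e : rel T) : proper_eq e -> uniform e -> (forall x, #|cls e x| = 2) \/ (forall x, #|cls e x| = 4).
Proof.
move=> pe ue; have [ee _ [x [y xy]]] := pe.
have dv : #|cls e x| %| 8.
  rewrite -T8 -cardsT (card_uniform_partition (n := #|cls e x|) _ (eqpart_partition ee)) ?dvdn_mull //.
  by move=> A /imsetP[z _ ->]; apply: ue.
have gt1 := card_cls2 pe ue x.
have lt8 : #|cls e x| < 8.
  rewrite -T8 -cardsT; apply: proper_card; rewrite properT; apply: contraNneq xy => h.
  by have := in_setT y; rewrite -h inE.
suff : #|cls e x| = 2 \/ #|cls e x| = 4 by case=> h; [left|right] => z; rewrite -h; apply: ue.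
by move: dv gt1 lt8; case: #|_| => [|[|[|[|[|[|[|[|n]]]]]]]] //; [left|right].
Qed.

(** Affine test maps: [F13] breaks both the pairing along the last coordinate and the two planes of
    the first; [F23] preserves these planes and breaks the pairing. *)
Definition F13 (v : E) : E := (v.2, v.1.2, v.1.1).
Definition F23 (v : E) : E := (v.1.1, v.2, v.1.2).
Lemma F13_inj : injective F13. Proof. by move=> [[a b] c] [[a' b'] c'] [-> -> ->]. Qed.
Lemma F23_inj : injective F23. Proof. by move=> [[a b] c] [[a' b'] c'] [-> -> ->]. Qed.
Lemma F13_aff : affine F13. Proof. by []. Qed.
Lemma F23_aff : affine F23. Proof. by []. Qed.

Let T6 : 6 <= #|T|. Proof. by rewrite T8. Qed.

Section Labels.
Variables (psi : E -> T) (f : T -> E).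
Hypotheses (psiK : cancel psi f) (fK : cancel f psi).

Lemma Aff_sub : Aff psi f \subset G.
Proof. by apply/subsetP=> g /(Aff_even psiK fK); rewrite hG. Qed.

Lemma Aff_nG : ~ G \subset Aff psi f.
Proof.
move=> /subsetP sub.
pose a := psi (false, false, false); pose b := psi (false, false, true); pose c := psi (false, true, false).
have ne (u v : E) : u != v -> psi u != psi v by rewrite (inj_eq (can_inj psiK)).
have ab : a != b by apply: ne. have ac : a != c by apply: ne. have bc : b != c by apply: ne.
have /sub/AffP h : cyc3 a b c \in G by rewrite hG odd_cyc3.
have := h (false, false, true) (true, false, false) (true, false, true).
by rewrite /gE !cyc3E // !(inj_eq (can_inj psiK)) /= !psiK.
Qed.

Lemma Aff_rstab (e : rel T) : (forall x y, e x y = ((f x).1 == (f y).1)) -> rstab G e \subset Aff psi f.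
Proof.
move=> eE; apply/subsetP=> g /rstabP[gG ge]; apply: e3_Aff => //.
  by move=> x y; rewrite -!eE ge.
by move: gG; rewrite hG.
Qed.

Lemma Aff_nrstab (e : rel T) : (forall x y, e x y = ((f x).1 == (f y).1)) -> ~ Aff psi f \subset rstab G e.
Proof.
move=> eE /subsetP/(_ _ (plift_Aff psiK fK F13_inj F13_aff))/rstabP[_ h].
have := h (psi (false, false, false)) (psi (false, false, true)).
by rewrite !eE !plift_f !psiK.
Qed.
End Labels.

(** The stabilizer of a pairing is proper in a copy of AGL_3(2), which is proper in Alt(8), so it is
    not maximal. *)
Lemma pairs8_absurd (e : rel T) (B C : {group {perm T}}) : proper_eq e -> (forall x, #|cls e x| = 2) ->
  boolean_triple G (rstab_group G e) B C -> False.
Proof.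
move=> pe c2 b; have [ee _ nall] := pe; have [x0 [y0 xy]] := nall.
have [z0] := @pair_avoid _ [:: x0; mate e x0; y0; mate e y0] (leq_trans (isT : 4 < 6) T6).
rewrite !inE !negb_or => /and4P[z1 z2 z3 z4].
have [w0] := @pair_avoid _ [:: x0; mate e x0; y0; mate e y0; z0; mate e z0] (ltac:(by rewrite T8)).
rewrite !inE !negb_or => /and4P[w1 w2 w3 /and3P[w4 w5 w6]].
have [|psi [f [psiK fK eE _]]] := pair_label (x0 := x0) (y0 := y0) (z0 := z0) (w0 := w0) ee c2.
  by rewrite /= xy !(pair_relE ee c2) !negb_or z1 z2 z3 z4 w1 w2 w3 w4 w5 w6.
have sub := Aff_rstab psiK fK eE.
case: (triple_above b (L := Aff_group psiK fK) _ (Aff_sub psiK fK)) => /=.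
- by apply: subset_trans sub; apply: subsetIl.
- exact: Aff_nrstab.
- by move=> h; apply: (triple_nsub b); apply: subset_trans sub h.
- exact: Aff_nG.
Qed.

(** By [sizes8] and [pairs8_absurd] every partition involved has classes of four points. For two of
    them with trivial meet, three points of one class would lie in three different classes of the
    other, which has only two. *)
Lemma kind_prim8 (e : rel T) (B C : {group {perm T}}) : proper_eq e -> boolean_triple G (rstab_group G e) B C ->
  ptrans (rstab_group G e :&: B :&: C) setT -> kind G B -> [/\ forall x, #|cls e x| = 4, prim B & ~ has_cyc3 B].
Proof.
move=> pe b tH kB.
have four (e' : rel T) B' C' : proper_eq e' -> boolean_triple G (rstab_group G e') B' C' ->
    ptrans (rstab_group G e' :&: B' :&: C') setT -> forall x, #|cls e' x| = 4.
  move=> pe' b' tH'; have ue : uniform e' by apply: (uniform_inv (triple_tA tH')); apply: einv_rstab.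
  by case: (sizes8 pe' ue) => // h; case: (pairs8_absurd pe' h b').
have a4 := four _ _ _ pe b tH.
have pB : prim B.
  case: kB => // -[f pf BE]; exfalso.
  have b' : boolean_triple G (rstab_group G f) (rstab_group G e) C by rewrite -BE; apply: triple_swap.
  have f4 : forall x, #|cls f x| = 4 by apply: (four _ _ _ pf b'); rewrite -BE (setIC B).
  have eq (c d : rel T) : (forall x, #|cls c x| = 4) -> (forall x, #|cls d x| = 4) ->
      (forall x y, c x y -> d x y) -> forall x y, c x y = d x y.
    move=> c4 d4 cd x y; have /eqP/setP/(_ y) : cls c x == cls d x.
      by rewrite eqEcard c4 d4 leqnn andbT; apply/subsetP=> t; rewrite !inE; apply: cd.
    by rewrite !inE.
  have [ee _ [x [w xw]]] := pe; have [ff _ _] := pf.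
  have tH' : ptrans (rstab_group G f :&: rstab_group G e :&: C) setT by rewrite -BE (setIC B).
  case: (two_rel hG T6 pf pe b' tH') => h.
  - exact: (two_rel_ne b' (eq _ _ f4 a4 h)).
  - by apply: (two_rel_ne b') => u v; rewrite (eq _ _ a4 f4 h).
  have [y xy] := @cls_avoid _ f x [:: x] (leq_trans (isT : 1 < 4) (eq_leq (esym (f4 x)))).
  have [z xz] := @cls_avoid _ f x [:: x; y] (leq_trans (isT : 2 < 4) (eq_leq (esym (f4 x)))).
  rewrite !inE !negb_or => /andP[zx zy] yx.
  have nxy : ~~ e x y by apply: contra yx => exy; rewrite (h _ _ xy exy).
  have nxz : ~~ e x z by apply: contra zx => exz; rewrite (h _ _ xz exz).
  have := two_classes ee a4 z nxy; rewrite (negPf nxz) /= => yz.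
  have fyz : f y z by rewrite -(eqv_congr ff xy).
  by rewrite (h _ _ fyz yz) eqxx in zy.
by split=> //; apply: (prim_alt hG (triple_swap b)).
Qed.

(** * The pairing determined by H in degree eight *)

Section Pairing.
Variables (e : rel T) (B C : {group {perm T}}).
Hypothesis pe : proper_eq e.
Hypothesis a4 : forall x, #|cls e x| = 4.
Local Notation A := (rstab_group G e).
Hypothesis b : boolean_triple G A B C.
Hypothesis tH : ptrans (A :&: B :&: C) setT.
Hypotheses (pB : prim B) (nB : ~ has_cyc3 B) (pC : prim C) (nC : ~ has_cyc3 C).
Local Notation H := (A :&: B :&: C).

Let ee : equivalence_rel e. Proof. by case: pe. Qed.
Let nall : exists x y, ~~ e x y. Proof. by case: pe. Qed.
Let a3 x : 2 < #|cls e x|. Proof. by rewrite a4. Qed.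

Section Meet.
Variables (D D' : {group {perm T}}).
Hypotheses (bD : boolean_triple G A D D') (tD : ptrans (A :&: D :&: D') setT) (pD : prim D) (nD : ~ has_cyc3 D).
Let KM : A :&: D \subset A. Proof. exact: subsetIl. Qed.
Let mx (L : {group {perm T}}) : A :&: D \subset L -> L \subset A -> L \subset A :&: D \/ A \subset L.
Proof. exact: (triple_max bD). Qed.

Lemma meet_nontriv x : nontriv e (A :&: D) x.
Proof.
have noc : ~ has_cyc3 (A :&: D).
  by case=> [u [v [w [uv uw vw /setIP[_ c]]]]]; apply: nD; exists u, v, w.
case: (nontriv_or hG ee (K := [group of A :&: D]) KM (triple_tAB tD) mx a3 nall noc) => [nt|[_ _ _ N1]]; first exact: nt.
by case: (no_N1 ee a4 (K := [group of A :&: D]) KM mx N1).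
Qed.

Lemma meet_semireg x s t : s \in A :&: D -> perm_on (cls e x) s -> e x t -> s t = t -> s = 1.
Proof.
apply: (prim_semireg hG ee (K := [group of A :&: D]) KM (triple_tAB tD) mx a3 nall (P := D)) => //.
  exact: subsetIr.
exact: meet_nontriv.
Qed.

Lemma meet_trans x u v : e x u -> e x v ->
  exists2 k, k \in A :&: D & perm_on (cls e x) k /\ k u = v.
Proof. exact: (local_trans hG ee (K := [group of A :&: D]) KM (triple_tAB tD) mx meet_nontriv). Qed.
End Meet.

Let bC : boolean_triple G A C B. Proof. exact: triple_swap (triple_rot (triple_rot b)). Qed.
Let tC : ptrans (A :&: C :&: B) setT. Proof. by rewrite setIAC. Qed.

(** Elements of [A :&: B] and of [A :&: C] supported on the class and sending [u] to [v] are even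
    and without fixed points on four points, so [dt_eq] makes them equal. *)
Lemma H_trans x u v : e x u -> e x v -> exists2 h, h \in H & perm_on (cls e x) h /\ h u = v.
Proof.
move=> xu xv; have [<-|uv] := eqVneq u v.
  by exists 1; rewrite ?group1 // perm1; split=> //; apply/subsetP=> t; rewrite !inE perm1 eqxx.
have [s sK [sX su]] := meet_trans b tH nB xu xv.
have [s' sK' [sX' su']] := meet_trans bC tC nC xu xv.
have n1 (q : {perm T}) : q u = v -> q <> 1 by move=> qu q1; rewrite q1 perm1 in qu; rewrite qu eqxx in uv.
have ev (q : {perm T}) : q \in A -> ~~ odd_perm q by move=> /rstabP[]; rewrite hG.
have fs t : t \in cls e x -> s t != t.
  by rewrite inE => xt; apply/eqP=> st; apply: (n1 s su); apply: (meet_semireg b tH pB nB sK sX xt).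
have fs' t : t \in cls e x -> s' t != t.
  by rewrite inE => xt; apply/eqP=> st; apply: (n1 s' su'); apply: (meet_semireg bC tC pC nC sK' sX' xt).
have ss : s = s'.
  apply: (dt_eq (a4 x) sX sX' _ _ fs fs' (x := u)).
  - by apply: ev; case/setIP: sK.
  - by apply: ev; case/setIP: sK'.
  - by rewrite inE.
  - by rewrite su su'.
exists s => //; rewrite in_setI sK ss; by case/setIP: sK'.
Qed.

(** [H] has an element supported on the class with the same value at [x]; semiregularity makes the
    two equal. *)
Lemma K_piece x (u : {perm T}) : u \in A :&: B -> perm_on (cls e x) u -> u \in H.
Proof.
move=> uK uX; have xux := perm_on_in ee x uX.
have [h hH [hX hx]] := H_trans (eqv_refl ee x) xux.
have hK : h \in A :&: B by case/setIP: hH.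
have : u * h^-1 = 1.
  apply: (meet_semireg b tH pB nB (x := x) (t := x)).
  - by rewrite groupM ?groupV.
  - by apply: perm_onM => //; apply: perm_onV.
  - exact: eqv_refl.
  - by rewrite permM -hx permK.
by move/(congr1 (mulg^~ h)); rewrite mulgKV mul1g => ->.
Qed.

Definition Hker := [group of (A :&: B :&: C) :&: bker_group G ee].
Lemma HkerP g : reflect (g \in H /\ g \in bker G e) (g \in Hker).
Proof. exact: setIP. Qed.
Let HA : H \subset A. Proof. by rewrite -setIA subsetIl. Qed.
Let Fk : Hker \subset bker G e. Proof. exact: subsetIr. Qed.
Lemma HkerJ d h : d \in Hker -> h \in H -> d ^ h \in Hker.
Proof.
move=> /HkerP[dH dk] hH; apply/HkerP; split; first by rewrite groupJ.
by apply: bkerJ => //; apply: (subsetP HA).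
Qed.

(** The join of [H] with [evB] has 3-cycles, so it is in neither [B] nor [C] and is [A]. The
    [H]-part of a product of two transpositions, one in each class, is then odd on a class. *)
Lemma odd_Hker : exists d x, d \in Hker /\ sgn e x d.
Proof.
have [x [y xy]] := nall.
pose L := (H <*> evB_group G ee)%G.
have nH : H \subset 'N(evB_group G ee) by apply: (evB_norm (K := [group of H])).
have LA : L \subset A by rewrite join_subG HA; apply: evBM.
have [u [v [xu xv [xnu xnv unv]]]] := ex3 a3 x.
have cL : cyc3 x u v \in L.
  apply: (subsetP (joing_subr _ _)); apply: (cyc3_evB hG ee (x := x)) => //; by rewrite inE ?eqv_refl.
case: (triple_below b (L := L) (joing_subl _ _) LA) => -[sub|sub|sub] _.
- by case: nB; exists x, u, v; split=> //; apply: (subsetP sub).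
- by case: nC; exists x, u, v; split=> //; apply: (subsetP sub).
have [y' yy' yny] := @cls_avoid _ e y [:: y] (ltnW (a3 y)); rewrite inE eq_sym in yny.
pose m := tperm x u * tperm y y'.
have mk : m \in bker G e by apply: dt_bker.
have mM : m \in A by case/(bkerP _ ee): mk => mG me; apply/rstabP; split=> //; apply: in_pres.
have /mulsgP[h w hH wE mE] : m \in H * evB_group G ee.
  by rewrite -(norm_joinEl nH); apply: (subsetP sub).
have /evBP[wk ws] := wE.
have hk : h \in bker G e.
  by rewrite -[bker G e]/(gval (bker_group G ee)) -(groupMr h (_ : w \in bker_group G ee)) -?mE.
exists h, x; split; first exact/HkerP.
have : sgn e x m.
  have tX : perm_on (cls e x) (tperm x u) by apply: tperm_on; rewrite inE ?eqv_refl.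
  have tY : perm_on (cls e y) (tperm y y') by apply: tperm_on; rewrite inE ?eqv_refl.
  have fixY t : t \in cls e x -> tperm y y' t = t.
    by move=> tx; apply: (out_perm tY); rewrite (disjointFr (cls_disj ee xy)).
  rewrite /sgn (rsM (im_perm_on tX) (im_fix fixY)) (rs_id tX) (rs_eq1 fixY) mulg1.
  by rewrite odd_tperm.
by rewrite mE (sgnM (G := G) ee) // ws addbF.
Qed.

(** Such a 3-cycle would be a piece of [Hker], so the join of [H] with the pieces would be [A]; by
    [K_piece] this puts [A :&: B] inside [C]. *)
Lemma Hker_no3 d x a c a' : d \in Hker -> a \in cls e x -> c \in cls e x -> a' \in cls e x ->
  a != c -> a != a' -> c != a' -> restr_perm (cls e x) d != cyc3 a c a'.
Proof.
move=> dF aX cX a'X ac aa ca; apply/eqP=> rd.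
pose P := pieces_group G ee Hker.
have nP : H \subset 'N(P).
  apply: (pieces_norm (L := [group of H]) ee) => //=; apply/subsetP=> h hH; rewrite inE.
  by apply/subsetP=> _ /imsetP[g gF ->]; apply: HkerJ.
pose Q := (H <*> P)%G.
have PA : P \subset A.
  by apply/subsetP=> g /piecesP[/(bkerP _ ee)[gG ge] _]; apply/rstabP; split=> //; apply: in_pres.
have QA : Q \subset A by rewrite join_subG HA.
have cQ : cyc3 a c a' \in Q.
  apply: (subsetP (joing_subr _ _)); rewrite -rd; apply: (rs_pieces ee Fk dF).
  by rewrite rd hG odd_cyc3.
case: (triple_below b (L := Q) (joing_subl _ _) QA) => -[sub|sub|sub] _.
- by apply: nB; exists a, c, a'; split=> //; apply: (subsetP sub).
- by apply: nC; exists a, c, a'; split=> //; apply: (subsetP sub).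
case: b => _ [n1 _ _] _; apply: n1; apply/subsetP=> k kK; have /setIP[kA kB] := kK.
suff : k \in H by case/setIP.
have /mulsgP[h q hH qP kE] : k \in H * P by rewrite -(norm_joinEl nP); apply: (subsetP sub).
have hK : h \in A :&: B by case/setIP: hH.
have qK : q \in A :&: B by rewrite -(groupMl _ hK) -kE.
have /piecesP[qk qd] := qP; have [d' d'F qE] := qd x.
have /HkerP[d'H d'k] := d'F.
rewrite kE groupM // -(groupMl _ (groupVr d'H)).
have d'K : d' \in A :&: B by case/setIP: d'H.
have [y xy] := other ee nall x.
apply: (K_piece (x := y)); first by rewrite groupM ?groupV.
apply/subsetP=> t; rewrite !inE; apply: contraR => yt.
have xt : e x t by have := two_classes ee a4 t xy; rewrite (negPf yt) orbF.
rewrite permM qE ?permKV //.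
have /(bkerP _ ee)[_ /(_ t)] := subsetP Fk _ (groupVr d'F).
exact: (eqv_trans ee xt).
Qed.

(* The kernel of H acts on each class of four points as a dihedral group of order 8; its transpositions give
   the pairing. *)
Definition flip_rel x y := (x == y) || [exists d in Hker, restr_perm (cls e x) d == tperm x y].

Lemma flip_relP x y : x != y -> reflect (exists2 d, d \in Hker & restr_perm (cls e x) d = tperm x y) (flip_rel x y).
Proof.
move=> xy; rewrite /flip_rel (negPf xy); apply: (iffP exists_inP) => -[d dF /eqP h]; exists d => //; exact/eqP.
Qed.

Lemma flip_rel_sub x y : flip_rel x y -> e x y.
Proof.
have [->|xy] := eqVneq x y; first by rewrite (eqv_refl ee).
case/(flip_relP xy)=> d dF rd.
have := rs_on (cls e x) d; rewrite rd => on; have := perm_closed x on.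
by rewrite tpermL !inE eqv_refl.
Qed.

Lemma flip_relJ h x y : h \in H -> flip_rel x y -> flip_rel (h x) (h y).
Proof.
move=> hH; have [->|xy] := eqVneq x y; first by rewrite /flip_rel !eqxx.
case/(flip_relP xy)=> d dF rd; apply/flip_relP; first by rewrite (inj_eq perm_inj).
exists (d ^ h); first exact: HkerJ.
have hM := subsetP HA _ hH; have /rstabP[_ he] := hM.
have dk := subsetP Fk _ dF.
rewrite -tpermJ -rd; apply/permP=> t.
have st : (d ^ h) @: cls e (h x) = cls e (h x) := bker_st ee _ (bkerJ ee dk hM).
have st' := bker_st ee x dk.
rewrite -(permKV h t) permJ; set u := h^-1 t.
have [xu|xu] := boolP (u \in cls e x).
  by rewrite !rsE ?permJ // inE he; move: xu; rewrite inE.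
by rewrite (out_perm (rs_on (cls e x) d) xu) (out_perm (rs_on _ _)) // inE he; move: xu; rewrite inE.
Qed.

Lemma flip_rel_sym x y : flip_rel x y -> flip_rel y x.
Proof.
have [->//|xy] := eqVneq x y; move=> h; have exy := flip_rel_sub h.
case/(flip_relP xy): h => d dF rd; apply/flip_relP; first by rewrite eq_sym.
by exists d; rewrite // tpermC -rd (cls_eq ee exy).
Qed.

(** Two transpositions with one common point multiply to a 3-cycle, against [Hker_no3]. *)
Lemma flip_rel_uniq x y z : flip_rel x y -> flip_rel x z -> x != y -> x != z -> y = z.
Proof.
move=> pxy pxz xy xz; apply/eqP/negPn/negP => yz.
have exy := flip_rel_sub pxy; have exz := flip_rel_sub pxz.
case/(flip_relP xy): pxy => d dF rd; case/(flip_relP xz): pxz => d' d'F rd'.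
have := @Hker_no3 (d * d') x x y z; rewrite groupM // !inE eqv_refl // exy exz => /(_ isT isT isT isT xy xz yz).
have st g : g \in Hker -> g @: cls e x = cls e x by move=> gF; apply: (bker_st ee); apply: (subsetP Fk).
by rewrite (rsM (st _ dF) (st _ d'F)) rd rd' eqxx.
Qed.

Lemma flip_rel_eqv : equivalence_rel flip_rel.
Proof.
apply: eqrelP.
- by move=> x; rewrite /flip_rel eqxx.
- by move=> x y; apply/idP/idP; apply: flip_rel_sym.
move=> y x z xy yz; have [<-|nxz] := eqVneq x z; first by rewrite /flip_rel eqxx.
have [xyE|nxy] := eqVneq x y; first by rewrite xyE.
have [yzE|nyz] := eqVneq y z; first by rewrite -yzE.
by have := flip_rel_uniq (flip_rel_sym xy) yz; rewrite eq_sym => /(_ nxy nyz) xzE; rewrite xzE eqxx in nxz.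
Qed.

(** An element odd on a class is multiplied by an even one, supported on the class, that returns a
    point to its place; [odd_fix] then yields a transposition. *)
Lemma flip_rel_pair : exists x y, x != y /\ flip_rel x y.
Proof.
have [d [x [dF ds]]] := odd_Hker; have dk := subsetP Fk _ dF.
have /(bkerP _ ee)[_ de] := dk.
have xdx : e x (d x) by [].
have [h hH [hX hx]] := H_trans xdx (eqv_refl ee x).
have hM := subsetP HA _ hH; have /rstabP[hG' _] := hM.
have hk : h \in bker G e by apply: (on_bker ee hX).
have dhF : d * h \in Hker by rewrite groupM //; apply/HkerP.
have os : odd_perm (restr_perm (cls e x) (d * h)).
  rewrite -[odd_perm _]/(sgn e x (d * h)) (sgnM (G := G) ee) // ds (sgn_on hX).
  by move: hG'; rewrite hG => /= ->.
have xX : x \in cls e x by rewrite inE eqv_refl.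
have fx : restr_perm (cls e x) (d * h) x = x.
  by rewrite (rsE (bker_st ee x (subsetP Fk _ dhF)) xX) permM hx.
have [a [c [aX cX ac rE]]] := odd_fix (a4 x) (rs_on _ _) xX fx os.
exists a, c; split=> //; apply/flip_relP => //; exists (d * h) => //.
by rewrite inE in aX; rewrite -(cls_eq ee aX).
Qed.

Lemma card_flip_rel x : #|cls flip_rel x| = 2.
Proof.
have [a [c [ac pac]]] := flip_rel_pair; have [h hH hx] := tH (in_setT a) (in_setT x).
have := flip_relJ hH pac; rewrite hx => pxc.
have xc : x != h c by rewrite -hx (inj_eq perm_inj).
have -> : cls flip_rel x = [set x; h c].
  apply/setP=> t; rewrite in_set2 inE; apply/idP/orP => [pxt|[/eqP->|/eqP->//]]; last by rewrite /flip_rel eqxx.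
  have [->|tx] := eqVneq t x; [by left|right].
  by apply/eqP/(flip_rel_uniq pxt pxc); rewrite // eq_sym.
by rewrite cards2 xc.
Qed.

Lemma flip_rel_inv : einv H flip_rel.
Proof.
move=> h hH x y; apply/idP/idP; last exact: flip_relJ.
by move/(flip_relJ (groupVr hH)); rewrite !permK.
Qed.
End Pairing.
End Eight.

(** * Identification of the two affine groups *)

Section EightMain.
Variables (T : finType) (G : {group {perm T}}).
Implicit Types (x y z t : T) (g h k m : {perm T}).
Hypothesis hG : forall g, (g \in G) = ~~ (true && odd_perm g).
Hypothesis T8 : #|T| = 8.
Let T6 : 6 <= #|T|. Proof. by rewrite T8. Qed.
Variables (e e3 : rel T) (B C : {group {perm T}}).
Local Notation A := (rstab_group G e).
Hypotheses (pe : proper_eq e) (a4 : forall x, #|cls e x| = 4).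
Hypotheses (pe3 : proper_eq e3) (c2 : forall x, #|cls e3 x| = 2) (sub3 : forall x y, e3 x y -> e x y).
Hypothesis b : boolean_triple G A B C.
Hypotheses (pB : prim B) (H3 : einv (A :&: B :&: C) e3).

Section Member.
Variables (psi : E -> T) (f : T -> E).
Hypotheses (psiK : cancel psi f) (fK : cancel f psi).
Hypotheses (e3E : forall x y, e3 x y = ((f x).1 == (f y).1)) (eE : forall x y, e x y = ((f x).1.1 == (f y).1.1)).

(** The affine group lies above [H], is not in [A] and is not [G]. Were it in both [B] and [C], the
    map [F23], which preserves [e], would lie in [H] and break [e3]; so it equals one of them. *)
Lemma Aff_member : Aff_group psiK fK = B \/ Aff_group psiK fK = C.
Proof.
set L := Aff_group psiK fK.
have LG : L \subset G := Aff_sub hG psiK fK.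
have SL : rstab G e3 \subset L := Aff_rstab hG psiK fK e3E.
have HS : A :&: B :&: C \subset rstab G e3.
  apply: (sub_rstab (K := [group of A :&: B :&: C])) => //=.
  by apply: subset_trans (rstab_sub G e); rewrite -setIA subsetIl.
have nA : (L \subset A) = false.
  apply/negP=> /subsetP/(_ _ (plift_Aff psiK fK F13_inj F13_aff))/rstabP[_ h].
  have := h (psi (false, false, false)) (psi (false, false, true)).
  by rewrite !eE !plift_f !psiK.
case: b => _ _ /(_ L (subset_trans HS SL) LG); rewrite nA.
case: (boolP (L \subset B)) => LB; case: (boolP (L \subset C)) => LC.
- move=> sub; pose g := plift psiK fK F23_inj.
  have gL : g \in L := plift_Aff psiK fK F23_inj F23_aff.
  have gA : g \in A.
    apply/rstabP; split; first exact: (subsetP LG).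
    by move=> x y; rewrite !eE !plift_f.
  have : g \in rstab G e3.
    by apply: (subsetP HS); rewrite !in_setI gA (subsetP LB) // (subsetP LC).
  case/rstabP=> _ h; have := h (psi (false, false, false)) (psi (false, false, true)).
  by rewrite !e3E !plift_f !psiK.
- move=> sub; left; apply/val_inj/eqP; rewrite eqEsubset /= LB andTb.
  apply: subset_trans sub; rewrite !subsetI subxx andbT; case: b => -[_ BG _] _ _.
  by rewrite BG.
- move=> sub; right; apply/val_inj/eqP; rewrite eqEsubset /= LC andTb.
  by apply: subset_trans sub; rewrite !subsetI subxx andbT; case: b => -[_ _ CG] _ _; rewrite CG.
by rewrite !setIid => /(Aff_nG hG psiK).
Qed.

Lemma Aff_meet_cube (D : {group {perm T}}) : Aff_group psiK fK = D -> is_2cube_sdprod_S4 (A :&: D).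
Proof.
move=> <-; apply: (cube_sdprod psiK fK (L := [group of A :&: Aff_group psiK fK])) => g.
apply: (iffP setIP) => [[/rstabP[_ h] gF]|[gF h]]; split=> //.
  by move=> x y; rewrite -!eE h.
by apply/rstabP; split; [apply: (subsetP (Aff_sub hG psiK fK))|move=> x y; rewrite !eE h].
Qed.
End Member.

Lemma eight_labels : exists (psi : E -> T) f, [/\ cancel psi f, cancel f psi,
  forall x y, e3 x y = ((f x).1 == (f y).1) & forall x y, e x y = ((f x).1.1 == (f y).1.1)].
Proof.
have [ee _ nall] := pe; have [ee3 _ _] := pe3.
have [x0 [z0 xz]] := nall.
have lt2 x : size [:: x; mate e3 x] < #|cls e x| by rewrite a4.
have [y0 xy yn] := cls_avoid (lt2 x0); have [w0 zw wn] := cls_avoid (lt2 z0).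
rewrite !inE !negb_or in yn wn; case/andP: yn => y1 y2; case/andP: wn => w1 w2.
have n3 u v : ~~ e u v -> ~~ e3 u v by apply: contra; apply: sub3.
have xw : ~~ e x0 w0 by apply: contra xz => h; apply: (eqv_trans ee h); rewrite eqv_sym.
have yz : ~~ e y0 z0 by rewrite -(eqv_congr ee xy).
have yw : ~~ e y0 w0 by rewrite -(eqv_congr ee xy).
have [|psi [f [psiK fK e3E be]]] := pair_label T8 (x0 := x0) (y0 := y0) (z0 := z0) (w0 := w0) ee3 c2.
  rewrite /= (n3 _ _ xz) (n3 _ _ xw) (n3 _ _ yz) (n3 _ _ yw) !(pair_relE ee3 c2) !negb_or.
  by rewrite y1 y2 w1 w2.
exists psi, f; split=> // x y; rewrite -{1}(fK x) -{1}(fK y).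
have be' v := sub3 (be v).
rewrite -(eqv_congr ee (be' (f x))) eqv_sym // -(eqv_congr ee (be' (f y))) eqv_sym // /base4.
have nE u v : ~~ e u v -> e u v = false /\ e v u = false by rewrite (eqv_sym ee v u) => /negPf.
have [m2 m2'] := nE _ _ xz; have [m3 m3'] := nE _ _ xw.
have [m4 m4'] := nE _ _ yz; have [m5 m5'] := nE _ _ yw.
have yx : e y0 x0 by rewrite eqv_sym. have wz : e w0 z0 by rewrite eqv_sym.
case: (f x) (f y) => [[[] []] c] [[[] []] c'] /=.
all: by rewrite ?(eqv_refl ee) ?xy ?zw ?yx ?wz ?m2 ?m2' ?m3 ?m3' ?m4 ?m4' ?m5 ?m5'.
Qed.

Lemma eight_groups : [/\ rstab G e3 = B :&: C, B \isog AGL3_2 /\ C \isog AGL3_2,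
  is_2cube_sdprod_S4 (A :&: B) & is_2cube_sdprod_S4 (A :&: C)].
Proof.
have [ee _ nall] := pe; have [ee3 _ nall3] := pe3.
have [psi [f [psiK fK e3E eE]]] := eight_labels.
(* Relabelling by the transposition of one pair keeps both relations but is odd, so it is not
   affine; the two labellings give two different affine groups, one for [B] and one for [C]. *)
pose o := psi e0; pose u := psi (false, false, true).
have ou : o != u by rewrite (inj_eq (can_inj psiK)).
have e3ou : e3 o u by rewrite e3E !psiK.
pose s := tperm o u.
have s3 x : e3 x (s x) by rewrite /s; case: tpermP => [->|->|_ _]; rewrite ?(eqv_refl ee3) // eqv_sym.
have fs1 x : (f (s x)).1 = (f x).1 by apply/esym/eqP; rewrite -e3E.
pose psi' v := s (psi v); pose f' x := f (s x).
have psiK' : cancel psi' f' by move=> v; rewrite /psi' /f' tpermK psiK.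
have fK' : cancel f' psi' by move=> x; rewrite /psi' /f' fK tpermK.
have e3E' x y : e3 x y = ((f' x).1 == (f' y).1) by rewrite e3E /f' !fs1.
have eE' x y : e x y = ((f' x).1.1 == (f' y).1.1) by rewrite eE /f' !fs1.
pose L := Aff_group psiK fK; pose L' := Aff_group psiK' fK'.
have LL' : L <> L'.
  move=> LE; pose g := plift psiK fK F13_inj.
  have : g \in L' by rewrite -LE; apply: plift_Aff.
  move/AffP=> /(_ e0 (true, false, false) (false, true, false)).
  have gv v : gE psi' f' g v = f (s (psi (F13 (f (s (psi v)))))).
    have gx x : g x = psi (F13 (f x)) by rewrite /g /plift permE.
    by rewrite /gE /f' /psi' gx.
  have sv v : f (s (psi v)) = if v == e0 then (false, false, true) else if v == (false, false, true) then e0 else v.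
    rewrite /s; case: tpermP => [/(can_inj psiK)->|/(can_inj psiK)->|/eqP h1 /eqP h2]; rewrite ?psiK //.
    by move: h1 h2; rewrite !(inj_eq (can_inj psiK)) => /negPf-> /negPf->.
  by rewrite !gv !sv.
have SL : rstab G e3 \subset L := Aff_rstab hG psiK fK e3E.
have SL' : rstab G e3 \subset L' := Aff_rstab hG psiK' fK' e3E'.
have cube D : L = D \/ L' = D -> is_2cube_sdprod_S4 (A :&: D).
  by case=> h; [apply: (Aff_meet_cube eE h)|apply: (Aff_meet_cube eE' h)].
have agl D : L = D \/ L' = D -> D \isog AGL3_2.
  by case=> <-; [apply: (Aff_isog psiK fK)|apply: (Aff_isog psiK' fK')].
have [LB LC] : (L = B \/ L' = B) /\ (L = C \/ L' = C).
  have [h|h] := Aff_member psiK fK e3E eE; have [h'|h'] := Aff_member psiK' fK' e3E' eE'.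
  - by case: LL'; rewrite /L /L' h h'.
  - by split; [left|right].
  - by split; [right|left].
  - by case: LL'; rewrite /L /L' h h'.
split; [|by split; apply: agl|exact: cube|exact: cube].
have SB : rstab G e3 \subset B by case: LB => <-.
have SC : rstab G e3 \subset C by case: LC => <-.
apply/eqP; rewrite eqEsubset subsetI SB SC /=.
have HS : B :&: C :&: A \subset rstab_group G e3.
  rewrite setIC setIA; apply: (sub_rstab (K := [group of A :&: B :&: C])) => //=.
  by apply: subset_trans (rstab_sub G e); rewrite -setIA subsetIl.
have uu (r : rel T) n : (forall x, #|cls r x| = n) -> uniform r by move=> h x y; rewrite !h.
(* Besides the wanted inclusion, the stabilizer of the pairing could lie in [A], which would
   identify [e3] with [e], or contain [B], which is primitive. *)
case: (triple_below (triple_rot b) HS SB) => _ [//|SA|BS].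
  have := rstab_inj hG T6 pe3 (uu _ _ c2) pe (uu _ _ a4) SA.
  have [x _] := nall; move=> h; have : #|cls e3 x| = #|cls e x|.
    by congr #|pred_of_set _|; apply/setP=> y; rewrite !inE h.
  by rewrite c2 a4.
by case: (prim_not_inv pB pe3) => g /(subsetP BS)/rstabP[].
Qed.
End EightMain.

(** * The Boolean lattice and partitions *)

Section Lattice.
Variable gT : finGroupType.
Implicit Types (G H A B C L : {group gT}).

Lemma overgroupsP G H (K : {set gT}) :
  reflect (exists L, [/\ K = L, H \subset L & L \subset G]) (K \in overgroups G H).
Proof.
rewrite inE; apply: (iffP and3P) => [[gK HK KG]|[L [-> HL LG]]]; last by rewrite groupP.
by exists (Group gK).
Qed.

(** The coatoms are the images of the complements of points, and each subset of ['I_3] is the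
    intersection of such complements containing it. *)
Lemma boolean3_b3 G H (Gs : 'I_3 -> {group gT}) : H :=: Gs i0 :&: Gs i1 :&: Gs i2 -> H \subset G ->
  boolean3 (overgroups G H) ->
  coatoms G H = [set (Gs i0 : {set gT}); (Gs i1 : {set gT}); (Gs i2 : {set gT})] ->
  boolean_triple G (Gs i0) (Gs i1) (Gs i2).
Proof.
move=> HE HG [f [fP fs]] co.
have finj X Y : f X = f Y -> X = Y.
  by move=> e; apply/eqP; rewrite eqEsubset -!fs e subxx.
have fo X : f X \in overgroups G H by apply/fP; exists X.
have fT : f setT = G.
  have /fP[X GX] : (G : {set gT}) \in overgroups G H by apply/overgroupsP; exists G.
  apply/eqP; rewrite eqEsubset; apply/andP; split; first by have /overgroupsP[L [-> _]] := fo setT.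
  by rewrite GX fs subsetT.
have sT (X : {set 'I_3}) j : j \notin X -> X \subset ~: [set j].
  by move=> jX; apply/subsetP=> t tX; rewrite !inE; apply: contraNneq jX => <-.
have cG j : f (~: [set j]) != G :> {set gT}.
  by rewrite -fT; apply/eqP=> /finj/setP/(_ j); rewrite !inE eqxx.
have co_c (K : {set gT}) : K \in coatoms G H -> exists j, K = f (~: [set j]).
  rewrite inE => /andP[/setD1P[KG /fP[X KX]] /forall_inP mx].
  have [j jX] : exists j, j \notin X.
    apply/existsP; rewrite -negb_forall; apply: contra KG => /forallP h.
    by rewrite KX -fT; apply/eqP; congr f; apply/setP=> t; rewrite h inE.
  exists j; have /mx/implyP : f (~: [set j]) \in overgroups G H :\ (G : {set gT}).
    by apply/setD1P.
  by rewrite KX fs => /(_ (sT _ _ jX))/eqP.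
have c_co j : f (~: [set j]) \in coatoms G H.
  rewrite inE in_setD1 cG fo /=; apply/forall_inP=> K' /setD1P[K'G /fP[X K'X]].
  apply/implyP; rewrite K'X fs => sub; apply/eqP; congr f; apply/eqP.
  rewrite eqEsubset sub andbT; apply: sT; apply: contra K'G => jX.
  rewrite K'X -fT; apply/eqP; congr f; apply/setP=> t; rewrite inE.
  by have [->//|tj] := eqVneq t j; apply: (subsetP sub); rewrite !inE.
have mem k : (Gs k : {set gT}) \in coatoms G H.
  rewrite co; case: k => [[|[|[|k]]] lt] //; rewrite !inE.
  - by rewrite (_ : Ordinal lt = i0) ?eqxx //; apply: val_inj.
  - by rewrite (_ : Ordinal lt = i1) ?eqxx ?orbT //; apply: val_inj.
  - by rewrite (_ : Ordinal lt = i2) ?eqxx ?orbT //; apply: val_inj.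
have [j0 E0] := co_c _ (mem i0); have [j1 E1] := co_c _ (mem i1); have [j2 E2] := co_c _ (mem i2).
have all3 k : k \in [set j0; j1; j2].
  have := c_co k; rewrite co E0 E1 E2 !inE.
  have h j : (f (~: [set k]) == f (~: [set j])) = (k == j).
    by apply/eqP/eqP => [/finj/setC_inj/set1_inj|->].
  by rewrite !h.
have /and3P[j01 j02 j12] : [&& j0 != j1, j0 != j2 & j1 != j2].
  have : 3 <= #|[set j0; j1; j2]|.
    apply: (@leq_trans #|[set: 'I_3]|); first by rewrite cardsT card_ord.
    by apply/subset_leq_card/subsetP=> k _; apply: all3.
  rewrite setUC cardsU1 cards2 !inE (eq_sym j2 j0) (eq_sym j2 j1).
  by case: eqP; case: eqP; case: eqP.
have one j j' : j != j' -> f [set j] \subset f (~: [set j']).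
  by move=> jj; rewrite fs; apply: sT; rewrite inE eq_sym.
have none j : ~ f [set j] \subset f (~: [set j]) by rewrite fs sub1set !inE eqxx.
have subG k : Gs k \subset G by have := mem k; rewrite inE => /andP[/setD1P[_ /overgroupsP[L [-> _]]]].
split=> //.
  split=> sub.
  - by apply: (none j2); rewrite -E2; apply: subset_trans sub; rewrite subsetI E0 E1 !one // eq_sym.
  - by apply: (none j1); rewrite -E1; apply: subset_trans sub; rewrite subsetI E0 E2 !one // eq_sym.
  - by apply: (none j0); rewrite -E0; apply: subset_trans sub; rewrite subsetI E1 E2 !one.
move=> L HL LG; set I := _ :&: _ :&: _.
have ifg (c : bool) (K : {group gT}) : exists K' : {group gT}, (if c then (K : {set gT}) else G) = K'.
  by case: c; [exists K|exists G].
have HG3 k : H \subset Gs k.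
  rewrite HE; case: k => [[|[|[|k]]] lt] //.
  - by rewrite (_ : Ordinal lt = i0) -?setIA ?subsetIl //; apply: val_inj.
  - by rewrite (_ : Ordinal lt = i1) 1?setIAC ?subsetIr //; apply: val_inj.
  - by rewrite (_ : Ordinal lt = i2) ?subsetIr //; apply: val_inj.
have ifH (c : bool) (K : {group gT}) : H \subset K -> H \subset (if c then (K : {set gT}) else G) by case: c.
have ifG (c : bool) (K : {group gT}) : K \subset G -> (if c then (K : {set gT}) else G) \subset G by case: c.
have /fP[X IX] : I \in overgroups G H.
  apply/overgroupsP; have [K0 e0'] := ifg (L \subset Gs i0) (Gs i0).
  have [K1 e1] := ifg (L \subset Gs i1) (Gs i1); have [K2 e2] := ifg (L \subset Gs i2) (Gs i2).
  exists [group of K0 :&: K1 :&: K2]; split.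
  - by rewrite /I e0' e1 e2.
  - by rewrite /= !subsetI -e0' -e1 -e2 !ifH.
  - by rewrite /= -e0' (subset_trans _ (ifG (L \subset Gs i0) (Gs i0) (subG i0))) // -setIA subsetIl.
have /fP[Y LY] : (L : {set gT}) \in overgroups G H by apply/overgroupsP; exists L; rewrite HE.
rewrite IX LY fs; apply/subsetP=> t tX; apply: contraLR tX => tY.
have LGt : L \subset f (~: [set t]) by rewrite LY fs; apply: sT.
suff : I \subset f (~: [set t]).
  by rewrite IX fs => /subsetP sub; apply/negP=> /sub; rewrite !inE eqxx.
have := all3 t; rewrite !inE -orbA => /or3P[]/eqP tE; rewrite tE in LGt *.
- by rewrite -E0 in LGt *; rewrite /I LGt -setIA subsetIl.
- by rewrite -E1 in LGt *; rewrite /I LGt setIAC subsetIr.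
- by rewrite -E2 in LGt *; rewrite /I LGt subsetIr.
Qed.

Lemma triple_atoms G A B C : boolean_triple G A B C ->
  atoms G (A :&: B :&: C) = [set B :&: C; A :&: B; A :&: C].
Proof.
have key A' B' C' : boolean_triple G A' B' C' -> A' :&: B' \in atoms G (A' :&: B' :&: C').
  move=> b; have [[AG BG CG] [n1 n2 n3] h] := b.
  rewrite inE; apply/andP; split.
    apply/setD1P; split; last first.
      apply/(overgroupsP _ [group of A' :&: B' :&: C']); exists [group of A' :&: B']; split=> //=.
        exact: subsetIl.
      by apply: subset_trans AG; apply: subsetIl.
    by apply/eqP=> e; apply: n1; rewrite e subsetIr.
  apply/forall_inP=> K /setD1P[KH /(overgroupsP _ [group of A' :&: B' :&: C'])[L [KE HL LG]]].
  apply/implyP=> KA; rewrite eqEsubset KA /=; rewrite KE in KH KA *.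
  have LA : L \subset A' by apply: subset_trans KA (subsetIl _ _).
  case: (triple_below b HL LA) => _ [//|LC|AL].
    by case/eqP: KH; apply/eqP; rewrite eqEsubset HL subsetI KA LC.
  by case: (triple_ne b); apply: subset_trans AL KA.
move=> b; have b1 := triple_rot b; have b2 := triple_swap (triple_rot b1).
have k1 := key _ _ _ b; have k2 := key _ _ _ b1; have k3 := key _ _ _ b2.
have e1 : B :&: C :&: A = A :&: B :&: C by rewrite setIC setIA.
have e2 : A :&: C :&: B = A :&: B :&: C by rewrite setIAC.
rewrite e1 in k2; rewrite e2 in k3.
apply/setP=> K; rewrite !in_setU !in_set1 -orbA; apply/idP/or3P; last by case=> /eqP->.
rewrite [K \in _]in_set; case/andP=> /setD1P[KH Ko] /forall_inP mn.
have [L [KE HL LG]] := overgroupsP G [group of A :&: B :&: C] K Ko.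
have minI X : X \in atoms G (A :&: B :&: C) -> X \subset K -> X = K.
  rewrite [X \in _]in_set => /andP[/setD1P[XH Xo] _] XK; apply/eqP.
  by apply: (implyP (mn X _)) => //; apply/setD1P.
have [[AG BG CG] [n1 n2 n3] h] := b.
have := h L HL LG.
case: (boolP (L \subset A)) => LA; case: (boolP (L \subset B)) => LB; case: (boolP (L \subset C)) => LC sub.
- by case/eqP: KH; apply/eqP; rewrite KE eqEsubset HL !subsetI LA LB LC.
- by constructor 2; rewrite eq_sym; apply/eqP/minI; rewrite // KE; apply: subset_trans sub; rewrite subsetI subxx (subset_trans (subsetIl _ _)).
- by constructor 3; rewrite eq_sym; apply/eqP/minI; rewrite // KE; apply: subset_trans sub; rewrite setIAC subsetI subxx (subset_trans (subsetIl _ _)).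
- have AL : A \subset L by apply: subset_trans sub; rewrite !subsetI subxx AG.
  by constructor 2; rewrite eq_sym; apply/eqP/minI; rewrite // KE (subset_trans (subsetIl _ _)).
- by constructor 1; rewrite eq_sym; apply/eqP/minI; rewrite // KE; apply: subset_trans sub; rewrite -setIA subsetI subxx andbT (subset_trans (subsetIl _ _)).
- have BL : B \subset L by apply: subset_trans sub; rewrite !subsetI subxx BG.
  by constructor 1; rewrite eq_sym; apply/eqP/minI; rewrite // KE (subset_trans (subsetIl _ _)).
- have CL : C \subset L by apply: subset_trans sub; rewrite !subsetI subxx CG.
  by constructor 1; rewrite eq_sym; apply/eqP/minI; rewrite // KE (subset_trans (subsetIr _ _)).
have GL : G \subset L by apply: subset_trans sub; rewrite !subsetI subxx.
by constructor 1; rewrite eq_sym; apply/eqP/minI; rewrite // KE (subset_trans _ GL) // (subset_trans (subsetIl _ _)).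
Qed.
End Lattice.

Section Partitions.
Variable T : finType.
Implicit Types (x y z : T) (g h : {perm T}) (S : {set {set T}}) (e f : rel T).

Definition part_rel S : rel T := fun x y => y \in pblock S x.

Lemma part_rel_eqv S : partition S setT -> equivalence_rel (part_rel S).
Proof.
by move=> pS x y z; apply: (pblock_equivalence pS).
Qed.

Lemma part_relP S A x : partition S setT -> A \in S -> x \in A -> cls (part_rel S) x = A.
Proof.
case/and3P=> _ ti _ AS xA; apply/setP=> y; rewrite inE /part_rel.
by rewrite (def_pblock ti AS xA).
Qed.

Lemma cls_in S x : partition S setT -> cls (part_rel S) x \in S.
Proof.
case/and3P=> /eqP cov ti _; rewrite (_ : cls _ _ = pblock S x) ?pblock_mem ?cov ?inE //.
by apply/setP=> y; rewrite inE.
Qed.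

Lemma part_stabE (G : {group {perm T}}) S : partition S setT -> part_stab G S = rstab G (part_rel S).
Proof.
move=> pS; have ee := part_rel_eqv pS; apply/setP=> g; apply/idP/rstabP.
  rewrite inE => /andP[gG /forall_inP h]; split=> // x y.
  have gA := h _ (cls_in x pS).
  have gx : g x \in g @: cls (part_rel S) x by rewrite im_mem inE (eqv_refl ee).
  have := part_relP pS gA gx => /setP/(_ (g y)); rewrite inE => ->.
  by rewrite im_mem inE.
case=> gG ge; rewrite inE gG; apply/forall_inP=> A AS.
have /and3P[_ _ n0] := pS.
have /set0Pn[x xA] : A != set0 by apply: contraNneq n0 => <-.
by rewrite -(part_relP pS AS xA) (im_cls x ge) cls_in.
Qed.

Lemma part_rel_proper S : partition S setT -> nontrivial_part S -> proper_eq (part_rel S).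
Proof.
move=> pS /andP[n1 n2]; have ee := part_rel_eqv pS.
have /and3P[/eqP cov _ n0] := pS.
have inh A : A \in S -> exists x, x \in A.
  by move=> AS; apply/set0Pn; apply: contraNneq n0 => <-.
split=> //.
  have [/existsP[x /existsP[y /andP[xy h]]]|no] := boolP [exists x, exists y, (x != y) && part_rel S x y].
    by exists x, y.
  case/eqP: n2; apply/setP=> A; apply/idP/imsetP.
    move=> AS; have [x xA] := inh A AS; exists x => //; rewrite -(part_relP pS AS xA).
    apply/setP=> y; rewrite !inE; apply/idP/eqP => [h|->]; last exact: eqv_refl.
    apply/esym/eqP/negPn/negP => n; case/negP: no.
    by apply/existsP; exists x; apply/existsP; exists y; rewrite n.
  case=> x _ ->; rewrite (_ : [set x] = cls (part_rel S) x) ?cls_in //.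
  apply/setP=> y; rewrite !inE; apply/eqP/idP => [->|h]; first exact: eqv_refl.
  apply/esym/eqP/negPn/negP => n; case/negP: no.
  by apply/existsP; exists x; apply/existsP; exists y; rewrite n.
have [/existsP[x /existsP[y h]]|no] := boolP [exists x, exists y, ~~ part_rel S x y]; first by exists x, y.
have all x y : part_rel S x y.
  by move: no; rewrite negb_exists => /forallP/(_ x); rewrite negb_exists => /forallP/(_ y); rewrite negbK.
have clsT x : cls (part_rel S) x = setT by apply/setP=> y; rewrite !inE all.
case/eqP: n1; apply/setP=> A; rewrite inE; apply/idP/eqP => [AS|->].
  by have [x xA] := inh A AS; rewrite -(part_relP pS AS xA).
have [x _] : exists x, x \in [set: T].
  have [A0|/set0Pn[A' AS]] := eqVneq S set0.
    case/eqP: n2; rewrite A0; apply/setP=> X; rewrite inE; apply/esym/imsetP=> -[x _ _].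
    by have := cls_in x pS; rewrite A0 inE.
  by have [x _] := inh A' AS; exists x.
by rewrite -(clsT x) cls_in.
Qed.

Lemma eqpart_rel e : equivalence_rel e -> forall x y, part_rel (eqpart e) x y = e x y.
Proof.
move=> ee x y; have pS := eqpart_partition ee.
have /and3P[_ ti _] := pS; rewrite /part_rel (@def_pblock _ _ (cls e x)) ?inE //.
  by apply: imset_f.
exact: eqv_refl.
Qed.

Lemma eqpart_stab (G : {group {perm T}}) e : equivalence_rel e -> part_stab G (eqpart e) = rstab G e.
Proof.
move=> ee; rewrite part_stabE ?eqpart_partition //; apply/setP=> g.
by apply/rstabP/rstabP => -[gG h]; split=> // x y; have := h x y; rewrite !eqpart_rel.
Qed.

Lemma eqpart_ntreg e : proper_eq e -> uniform e -> ntreg_part (eqpart e).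
Proof.
move=> [ee [x [y [xy exy]]] [u [v nuv]]] ue; apply/andP; split.
  apply/andP; split; first exact: eqpart_partition.
  apply/forall_inP=> _ /imsetP[a _ ->]; apply/forall_inP=> _ /imsetP[c _ ->].
  exact/eqP/ue.
apply/andP; split; apply/eqP=> h.
  have : cls e u \in eqpart e by apply: imset_f.
  by rewrite h inE => /eqP/setP/(_ v); rewrite !inE (negPf nuv).
have : cls e x \in eqpart e by apply: imset_f.
rewrite h => /imsetP[a _ E].
have : x \in cls e x by rewrite inE eqv_refl.
have : y \in cls e x by rewrite inE.
by rewrite E !inE => /eqP yE /eqP xE; rewrite xE yE eqxx in xy.
Qed.

Lemma eqpart_le e f : equivalence_rel f -> (forall x y, f x y -> e x y) -> part_le (eqpart e) (eqpart f).
Proof.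
move=> ff fe; apply/forall_inP=> _ /imsetP[x _ ->]; apply/exists_inP.
exists (cls e x); first exact: imset_f.
by apply/subsetP=> y; rewrite !inE; apply: fe.
Qed.

Lemma eqpart_eq e f : equivalence_rel e -> equivalence_rel f -> eqpart e = eqpart f -> forall x y, e x y = f x y.
Proof. by move=> ee ff E x y; rewrite -(eqpart_rel ee) E eqpart_rel. Qed.

(** The search for an invariant relation is made over sets of sets, which form a finite type, so
    that the alternative is decidable. *)
Lemma prim_dec (B : {group {perm T}}) : prim B \/ exists2 f, proper_eq f & einv B f.
Proof.
pose P S := [&& partition S setT, [forall g in B, forall X in S, g @: X \in S] & nontrivial_part S].
have stab S : partition S setT -> [forall g in B, forall X in S, g @: X \in S] -> einv B (part_rel S).
  move=> pS /forall_inP h g gB; have : g \in part_stab setT S.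
    by rewrite !inE /=; apply: h.
  by rewrite (part_stabE (setT_group _) pS) => /rstabP[].
have [/existsP[S /and3P[pS iS nS]]|no] := boolP [exists S, P S].
  by right; exists (part_rel S); [apply: part_rel_proper|apply: stab].
left=> e ee ie; have pS := eqpart_partition ee.
have : ~~ nontrivial_part (eqpart e).
  apply: contra no => nS; apply/existsP; exists (eqpart e); rewrite /P pS nS andbT /=.
  apply/forall_inP=> g gB; apply/forall_inP=> _ /imsetP[x _ ->].
  by rewrite (im_cls x (ie g gB)); apply: imset_f.
have inc x : cls e x \in eqpart e by apply: imset_f.
rewrite negb_and !negbK => /orP[]/eqP h; [right|left] => x y.
  by have := inc x; rewrite h inE => /eqP/setP/(_ y); rewrite !inE.
move=> exy; have := inc x; rewrite h => /imsetP[a _ E].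
have : x \in cls e x by rewrite inE eqv_refl.
have : y \in cls e x by rewrite inE.
by rewrite E !inE => /eqP-> /eqP->.
Qed.
End Partitions.

Section Conclusions.
Variables (T : finType) (G : {group {perm T}}).
Implicit Types (x y : T) (e f : rel T) (B C : {group {perm T}}).

(** A uniform proper relation needs a composite degree. In degree 4, transitivity and three proper
    inclusions up to [G] would give [G] at least 32 elements, more than 24. *)
Lemma triple_ge6 e B C : proper_eq e -> uniform e -> boolean_triple G (rstab_group G e) B C ->
  ptrans (rstab_group G e :&: B :&: C) setT -> 6 <= #|T|.
Proof.
move=> pe ue b tH; have [ee _ [x [y xy]]] := pe.
have dv : #|cls e x| %| #|T|.
  rewrite -cardsT (card_uniform_partition (n := #|cls e x|) _ (eqpart_partition ee)) ?dvdn_mull //.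
  by move=> A /imsetP[z _ ->]; apply: ue.
have gt1 := card_cls2 pe ue x.
have ltn : #|cls e x| < #|T|.
  rewrite -cardsT; apply: proper_card; rewrite properT; apply: contraNneq xy => h.
  by have := in_setT y; rewrite -h inE.
have [T4|n4] := eqVneq #|T| 4; last first.
  move: dv gt1 ltn n4; by case: #|T| => [|[|[|[|[|[|n]]]]]] //; move: (#|cls e x|) => [|[|[|[|[|[|k]]]]]].
have [[AG BG CG] [n1 n2 n3] _] := b.
have H4 : 4 <= #|rstab_group G e :&: B :&: C|.
  rewrite -T4 -(card_orbit_stab 'P [group of rstab_group G e :&: B :&: C] x).
  have -> : orbit 'P (rstab_group G e :&: B :&: C) x = setT.
    apply/setP=> t; rewrite inE; apply/orbitP; have [h hH ht] := tH x t (in_setT _) (in_setT _).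
    by exists h.
  by rewrite cardsT leq_pmulr // cardG_gt0.
have h1 := @double_card _ [group of rstab_group G e :&: B :&: C] [group of rstab_group G e :&: B] (subsetIl _ _).
have h2 := @double_card _ [group of rstab_group G e :&: B] (rstab_group G e) (subsetIl _ _) (triple_ne b).
have h3 := @double_card _ (rstab_group G e) G AG.
have {}h1 := h1 (fun s => n1 (subset_trans s (subsetIr _ _))).
have {}h3 := h3 (fun s => triple_nsub (triple_swap b) (subset_trans BG s)).
have : #|G| <= 24.
  apply: (@leq_trans #|'Sym_T|); first by apply/subset_leq_card/subsetT.
  by rewrite card_Sym T4.
suff le : 32 <= #|G| by move=> /(leq_trans le).
apply: leq_trans h3; rewrite (@leq_double 16); apply: leq_trans h2; rewrite (@leq_double 8).
by apply: leq_trans h1; rewrite (@leq_double 4).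
Qed.

(** The stabilizer of an invariant relation lies above [B]. By [triple_above] it could otherwise be
    in [A] or be [G]; both put [B] inside [rstab_group G e]. *)
Lemma triple_kind alt e B C : (forall g, (g \in G) = ~~ (alt && odd_perm g)) -> 6 <= #|T| -> proper_eq e ->
  boolean_triple G (rstab_group G e) B C -> ptrans (rstab_group G e :&: B :&: C) setT -> kind G B.
Proof.
move=> hG T6 pe b tH; case: (prim_dec B) => [pB|[f pf iB]]; [by left|right].
have [[AG BG CG] _ _] := b.
have BL : B \subset rstab_group G f by apply: sub_rstab.
exists f => //; apply/val_inj/eqP; rewrite eqEsubset BL /=.
case: (triple_above b (L := rstab_group G f) (subset_trans (subsetIr _ _) BL) (rstab_sub _ _)) => //= h.
  by case: (triple_nsub (triple_swap b)); apply: subset_trans BL h.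
case: (triple_nsub (triple_swap b)).
have ue : uniform e by apply: (uniform_inv (triple_tA tH)); apply: einv_rstab.
have uf : uniform f by apply: (uniform_inv (triple_tB tH)).
have ef := rstab_inj hG T6 pe ue pf uf (subset_trans AG h).
apply/subsetP=> g /(subsetP BL)/rstabP[gG gf]; apply/rstabP; split=> // x y.
by rewrite !ef.
Qed.

Lemma perm3 (a c d : 'I_3) : uniq [:: a; c; d] -> exists p : {perm 'I_3}, [/\ p i0 = a, p i1 = c & p i2 = d].
Proof.
move=> u; have inj : injective (fun i : 'I_3 => nth a [:: a; c; d] i).
  move=> i j /eqP; rewrite nth_uniq ?ltn_ord // => /eqP; exact: val_inj.
by exists (perm inj); rewrite !permE.
Qed.

Definition finer (r : 'I_3 -> rel T) i j := forall x y, r j x y -> r i x y.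

(** Of the eight ways to orient three comparisons, six are chains and the two cycles contradict
    distinctness. *)
Lemma three_rels (r : 'I_3 -> rel T) : (forall i, proper_eq (r i)) ->
  (forall i j, i != j -> comp (r i) (r j)) -> (forall i j, i != j -> ~ forall x y, r i x y = r j x y) ->
  exists p : {perm 'I_3}, part_lt (eqpart (r (p i0))) (eqpart (r (p i1))) && part_lt (eqpart (r (p i1))) (eqpart (r (p i2))).
Proof.
move=> pr cr nr.
have rE i : equivalence_rel (r i) by case: (pr i).
have lt i j : i != j -> finer r i j -> part_lt (eqpart (r i)) (eqpart (r j)).
  move=> ij L; apply/andP; split; first exact: eqpart_le.
  by apply/eqP=> E; apply: (nr i j ij); apply: eqpart_eq.
have fin a c d : uniq [:: a; c; d] -> finer r a c -> finer r c d ->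
    exists p : {perm 'I_3}, part_lt (eqpart (r (p i0))) (eqpart (r (p i1))) && part_lt (eqpart (r (p i1))) (eqpart (r (p i2))).
  move=> u L1 L2; have [p [pa pc pd]] := perm3 u; exists p; rewrite pa pc pd.
  move: u; rewrite /= !inE negb_or => /andP[/andP[ac _] /andP[cd _]].
  by rewrite !lt.
have n01 : i0 != i1 by []. have n02 : i0 != i2 by []. have n12 : i1 != i2 by [].
have cyc a c d : a != c -> finer r a c -> finer r c d -> finer r d a -> False.
  by move=> ac h1 h2 h3; apply: (nr a c ac) => x y; apply/idP/idP; [move=> h; apply/h2/h3|apply: h1].
have c01 : finer r i1 i0 \/ finer r i0 i1 := cr _ _ n01.
have c02 : finer r i2 i0 \/ finer r i0 i2 := cr _ _ n02.
have c12 : finer r i2 i1 \/ finer r i1 i2 := cr _ _ n12.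
case: c01 => h01; case: c02 => h02; case: c12 => h12.
- exact: (fin i2 i1 i0).
- exact: (fin i1 i2 i0).
- by case: (cyc i1 i0 i2).
- exact: (fin i1 i0 i2).
- exact: (fin i2 i0 i1).
- by case: (cyc i0 i1 i2).
- exact: (fin i0 i2 i1).
- exact: (fin i0 i1 i2).
Qed.

Lemma comp_lt e f : proper_eq e -> proper_eq f -> comp e f -> ~ (forall x y, e x y = f x y) ->
  part_lt (eqpart e) (eqpart f) || part_lt (eqpart f) (eqpart e).
Proof.
move=> [ee _ _] [ff _ _] c n.
have ne : eqpart e != eqpart f by apply/eqP=> E; apply: n; apply: eqpart_eq.
rewrite /part_lt ne eq_sym ne !andbT; case: c => h; apply/orP; [right|left]; exact: eqpart_le.
Qed.
End Conclusions.

Theorem theorem5p4 (T : finType) (G H : {group {perm T}})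
    (Gs : 'I_3 -> {group {perm T}}) (Sigma : {set {set T}}) :
  (G :=: 'Sym_T \/ G :=: 'Alt_T) ->
  ntreg_part Sigma ->
  Gs i0 :=: part_stab G Sigma ->
  maximal (Gs i1) G -> maximal (Gs i2) G ->
  H :=: Gs i0 :&: Gs i1 :&: Gs i2 ->
  boolean3 (overgroups G H) ->
  coatoms G H = [set (Gs i0 : {set {perm T}}); (Gs i1 : {set {perm T}});
                     (Gs i2 : {set {perm T}})] ->
  [transitive H, on [set: T] | 'P] ->
  (* (1) *)
  (exists Sig : 'I_3 -> {set {set T}},
      (forall i, ntreg_part (Sig i) /\ Gs i :=: part_stab G (Sig i)) /\
      exists p : {perm 'I_3},
        part_lt (Sig (p i0)) (Sig (p i1)) && part_lt (Sig (p i1)) (Sig (p i2)))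
  \/
  (* (2) *)
  (G :=: 'Sym_T /\
   exists p : {perm 'I_3},
     Gs (p i2) :=: 'Alt_T /\
     exists S1 S2 : {set {set T}},
       [/\ ntreg_part S1, ntreg_part S2,
           Gs (p i0) :=: part_stab G S1, Gs (p i1) :=: part_stab G S2
         & part_lt S1 S2 || part_lt S2 S1])
  \/
  (* (3) *)
  (G :=: 'Alt_T /\ #|T| = 8%N /\
   exists Sa Sb : {set {set T}},
     [/\ partition Sa [set: T] /\ (forall X, X \in Sa -> #|X| = 4%N),
         partition Sb [set: T] /\ (forall X, X \in Sb -> #|X| = 2%N),
         part_le Sa Sb,
         H :=: part_stab G Sa :&: part_stab G Sb &
         (exists K1 K2 L1 L2 : {group {perm T}},
            [/\ K1 \isog AGL3_2 /\ K2 \isog AGL3_2,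
                is_2cube_sdprod_S4 L1 /\ is_2cube_sdprod_S4 L2,
                coatoms G H = [set part_stab G Sa; (K1 : {set {perm T}});
                                   (K2 : {set {perm T}})] &
                atoms G H = [set part_stab G Sb; (L1 : {set {perm T}});
                                 (L2 : {set {perm T}})]])]).
Proof.
move=> GE ntS A_E _ _ HE bool co trH.
have HG : H \subset G.
  rewrite HE A_E -setIA; apply: subset_trans (subsetIl _ _) _.
  by apply/subsetP=> g; rewrite inE => /andP[].
have b3G := boolean3_b3 HE HG bool co.
have /andP[/andP[pS _] nS] := ntS.
pose e := part_rel Sigma; have pe : proper_eq e := part_rel_proper pS nS.
have Ae : Gs i0 = rstab_group G e by apply: val_inj; rewrite /= A_E part_stabE.
set A := Gs i0 in A_E HE co Ae b3G; set B := Gs i1 in HE co b3G; set C := Gs i2 in HE co b3G.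
have tH : ptrans (rstab_group G e :&: B :&: C) setT.
  rewrite -Ae -HE => x y _ _; have : y \in orbit 'P H x.
    by rewrite (atransP trH) ?inE.
  by case/orbitP=> h hH /= <-; exists h.
have tH' : ptrans (rstab_group G e :&: C :&: B) setT by rewrite setIAC.
have b : boolean_triple G (rstab_group G e) B C by rewrite -Ae.
have b' : boolean_triple G (rstab_group G e) C B := triple_swap (triple_rot (triple_rot b)).
have ue : uniform e by apply: (uniform_inv (triple_tA tH)); apply: einv_rstab.
have T6 := triple_ge6 pe ue b tH.
have [ee _ _] := pe.
have three f f' : proper_eq f -> proper_eq f' -> B = rstab_group G f -> C = rstab_group G f' ->
    [/\ comp e f, comp e f' & comp f f'] ->
    exists Sig : 'I_3 -> {set {set T}}, (forall i, ntreg_part (Sig i) /\ Gs i :=: part_stab G (Sig i)) /\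
      exists p : {perm 'I_3}, part_lt (Sig (p i0)) (Sig (p i1)) && part_lt (Sig (p i1)) (Sig (p i2)).
  move=> pf pf' BE CE [c1 c2 c3].
  have n1 : ~ forall x y, e x y = f x y by apply: (two_rel_ne (G := G) (C := C)); rewrite -BE.
  have n2 : ~ forall x y, e x y = f' x y by apply: (two_rel_ne (G := G) (C := B)); rewrite -CE.
  have n3 : ~ forall x y, f x y = f' x y.
    by apply: (two_rel_ne (G := G) (C := A)); rewrite -BE -CE Ae; apply: triple_rot.
  have uf : uniform f by apply: (uniform_inv (triple_tB tH)); rewrite BE; apply: einv_rstab.
  have uf' : uniform f' by apply: (uniform_inv (triple_tB tH')); rewrite CE; apply: einv_rstab.
  pose r (i : 'I_3) : rel T := nth e [:: e; f; f'] i.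
  have I3 (P : 'I_3 -> Prop) : P i0 -> P i1 -> P i2 -> forall i, P i.
    move=> h0 h1 h2 [[|[|[|k]]] lt] //.
    - by rewrite (_ : Ordinal lt = i0) //; apply: val_inj.
    - by rewrite (_ : Ordinal lt = i1) //; apply: val_inj.
    - by rewrite (_ : Ordinal lt = i2) //; apply: val_inj.
  have sym f1 f2 : comp f1 f2 -> comp f2 f1 by case=> h; [right|left].
  have nsym (f1 f2 : rel T) : ~ (forall x y, f1 x y = f2 x y) -> ~ forall x y, f2 x y = f1 x y.
    by move=> n h; apply: n => x y; rewrite h.
  exists (fun i => eqpart (r i)); split.
    apply: I3; split; try exact: eqpart_ntreg.
    - by rewrite eqpart_stab // -/A Ae.
    - by rewrite eqpart_stab -/B ?BE //; case: pf.
    - by rewrite eqpart_stab -/C ?CE //; case: pf'.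
  apply: three_rels; first exact: I3.
    by apply: (I3 _); apply: (I3 _) => //= _; rewrite /r /=; try exact: sym.
  by apply: (I3 _); apply: (I3 _) => //= _; rewrite /r /=; try exact: nsym.
case: GE => GE.
  have hG g : (g \in G) = ~~ (false && odd_perm g) by rewrite GE inE.
  have kB := triple_kind hG T6 pe b tH; have kC := triple_kind hG T6 pe b' tH'.
  have two f D D' : proper_eq f -> D = rstab_group G f -> boolean_triple G (rstab_group G e) D D' ->
      ptrans D setT -> comp e f ->
      [/\ ntreg_part (eqpart e), ntreg_part (eqpart f), A :=: part_stab G (eqpart e), D :=: part_stab G (eqpart f)
        & part_lt (eqpart e) (eqpart f) || part_lt (eqpart f) (eqpart e)].
    move=> pf DE bD tD c; have [ff _ _] := pf.
    have uf : uniform f by apply: (uniform_inv tD); rewrite DE; apply: einv_rstab.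
    have n : ~ forall x y, e x y = f x y by apply: (two_rel_ne (G := G) (C := D')); rewrite -DE.
    by split; rewrite ?eqpart_stab ?Ae ?DE //; [apply: eqpart_ntreg|apply: eqpart_ntreg|apply: comp_lt].
  case: (sym_main hG T6 pe b tH kB kC) => [[BE [f pf [CE c]]]|[CE [f pf [BE c]]]|[f [f' [[pf pf'] BE CE cs]]]].
  - right; left; split=> //; have [p [p0 p1 p2]] := @perm3 i0 i2 i1 isT.
    exists p; rewrite p0 p1 p2; split; first by rewrite -/B BE.
    by exists (eqpart e), (eqpart f); apply: (two f C B) => //; exact: triple_tB tH'.
  - right; left; split=> //; have [p [p0 p1 p2]] := @perm3 i0 i1 i2 isT.
    exists p; rewrite p0 p1 p2; split; first by rewrite -/C CE.
    by exists (eqpart e), (eqpart f); apply: (two f B C) => //; exact: triple_tB tH.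
  by left; apply: (three f f').
have hG g : (g \in G) = ~~ (true && odd_perm g) by rewrite GE Alt_even.
have kB := triple_kind hG T6 pe b tH; have kC := triple_kind hG T6 pe b' tH'.
have [n8|n8] := eqVneq #|T| 8; last first.
  have [f [f' [[pf pf'] BE CE cs]]] := alt_main hG T6 n8 pe b tH kB kC.
  by left; apply: (three f f').
right; right; split=> //; split=> //.
have [a4 pB nB] := kind_prim8 hG n8 pe b tH kB.
have [_ pC nC] := kind_prim8 hG n8 pe b' tH' kC.
(* In degree eight only the third conclusion is left; the pairing extracted from the triple meet
   gives the finer partition. *)
pose e3 : rel T := flip_rel G B C pe.
have ee3 : equivalence_rel e3 by apply: flip_rel_eqv.
have c2 x : #|cls e3 x| = 2 by apply: card_flip_rel.
have sub3 x y : e3 x y -> e x y by apply: flip_rel_sub.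
have H3 : einv (rstab_group G e :&: B :&: C) e3 by apply: flip_rel_inv.
have pe3 : proper_eq e3.
  split=> //; first exact: flip_rel_pair.
  by have [_ _ [x [y xy]]] := pe; exists x, y; apply: contra xy; apply: sub3.
have [E3 [isoB isoC] cubeB cubeC] := eight_groups hG n8 pe a4 pe3 c2 sub3 b pB H3.
exists (eqpart e), (eqpart e3); split.
- by split; [apply: eqpart_partition|move=> _ /imsetP[x _ ->]].
- by split; [apply: eqpart_partition|move=> _ /imsetP[x _ ->]].
- exact: eqpart_le.
- by rewrite !eqpart_stab // E3 HE Ae -setIA.
exists B, C, [group of A :&: B], [group of A :&: C]; split=> //.
- by split=> /=; rewrite Ae.
- by rewrite eqpart_stab // co Ae.
by rewrite eqpart_stab // E3 HE (triple_atoms b3G).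
Qed.
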